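(* The functor $F\colon\mathcal{O}^{\mathbf{Z}}\to\mathcal{O}^{\mathbf{Z}}$ (defined in the context) induces an action of the monoidal category $\mathrm{Crystals}$ on $\mathcal{O}^{\mathbf{Z}}$; that is, there is a monoidal functor from $\mathrm{Crystals}$ to the monoidal category of endofunctors of $\mathcal{O}^{\mathbf{Z}}$ (with monoidal product given by composition) which sends the crystal $\mathbf{B}(1)$ to $F$ (up to natural isomorphism).
   Context: **Crystals.** A crystal means a finite, normal $\mathfrak{sl}_2$-crystal: a finite set $B$ with maps $\mathrm{wt}\colon B\to\mathbf{Z}$, $\varepsilon,\phi\colon B\to\mathbf{Z}$, $e,f\colon B\to B\sqcup\{0\}$ such that: (1) $\phi(b)=\varepsilon(b)+\mathrm{wt}(b)$ for all $b\in B$; (2) if $eb\in B$ then $\mathrm{wt}(eb)=\mathrm{wt}(b)+2$, $\varepsilon(eb)=\varepsilon(b)-1$, $\phi(eb)=\phi(b)+1$; (3) if $fb\in B$ then $\mathrm{wt}(fb)=\mathrm{wt}(b)-2$, $\varepsilon(fb)=\varepsilon(b)+1$, $\phi(fb)=\phi(b)-1$; (4) for all $b,b'\in B$, $b=eb'$ if and only if $fb=b'$; (5) $\varepsilon(b)=\max\{n\mid e^nb\neq 0\}$ and $\phi(b)=\max\{n\mid f^nb\neq 0\}$ for all $b\in B$. A morphism of crystals $A\to B$ is a map of sets $\beta\colon A\to B\sqcup\{0\}$ compatible with $e,f,\varepsilon,\phi,\mathrm{wt}$ (with the conventions $\beta(0)=0$, $e0=f0=0$: $\beta(ea)=e\beta(a)$,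 $\beta(fa)=f\beta(a)$, and $\varepsilon,\phi,\mathrm{wt}$ are preserved at every $a$ with $\beta(a)\neq 0$). $\mathrm{Crystals}$ is the resulting category. For $n\in\mathbf{Z}_{\ge 0}$, $\mathbf{B}(n)=\{v_n,v_{n-2},\dots,v_{-n}\}$ is the crystal with $\mathrm{wt}(v_k)=k$, $ev_n=0$ and $ev_k=v_{k+2}$ for $k\ne n$. The tensor product $B\otimes B'$ has underlying set $B\times B'$, with $(a,b)$ written $a\otimes b$, and $\mathrm{wt}(a\otimes b)=\mathrm{wt}(a)+\mathrm{wt}(b)$; $e(a\otimes b)=ea\otimes b$ if $\varepsilon(a)>\phi(b)$, and $a\otimes eb$ otherwise; $f(a\otimes b)=fa\otimes b$ if $\varepsilon(a)\ge\phi(b)$, and $a\otimes fb$ otherwise; $\varepsilon(a\otimes b)=\max\{\varepsilon(b),\varepsilon(a)-\mathrm{wt}(b)\}$; $\phi(a\otimes b)=\max\{\phi(a),\phi(b)+\mathrm{wt}(a)\}$ (where $0\otimes b=a\otimes 0=0$). This makes $\mathrm{Crystals}$ monoidal with unit $\mathbf{B}(0)$. **Graded category $\mathcal{O}$.** $\mathrm{Vect}^{\mathbf{Z}}$ is the category of graded finite dimensional $\mathbf{C}$-vector spaces; for $n\in\mathbf{Z}$, $V\langle n\rangle$ has degree $i$ component $V_{i-n}$. $\mathcal{O}_0^{\mathbf{Z}}$ is the category of tuples $(\Psi,\Phi,\mathrm{var},\mathrm{can})$ with $\Psi,\Phi\in\mathrm{Vect}^{\mathbf{Z}}$ and $\mathrm{var}\colon\Phi\to\Psi\langle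 -1\rangle$, $\mathrm{can}\colon\Psi\to\Phi\langle -1\rangle$ morphisms of graded vector spaces such that $\mathrm{var}\circ\mathrm{can}=0$ (morphisms are pairs of graded maps on $\Psi,\Phi$ commuting with $\mathrm{var}$ and $\mathrm{can}$). Set $\mathcal{O}^{\mathbf{Z}}=\mathrm{Vect}^{\mathbf{Z}}\oplus\bigoplus_{k\in\mathbf{Z}_{\ge 0}}\mathcal{O}_0^{\mathbf{Z}}$ (direct sum of categories). Let $\mathrm{pr}_{-1}\colon\mathcal{O}^{\mathbf{Z}}\to\mathrm{Vect}^{\mathbf{Z}}$ and $\mathrm{pr}_k\colon\mathcal{O}^{\mathbf{Z}}\to\mathcal{O}^{\mathbf{Z}}_0$ ($k\ge 0$) be the projections onto the summands, and $i_k$ ($k\ge -1$) the corresponding inclusions. Define $\pi^*\colon\mathrm{Vect}^{\mathbf{Z}}\to\mathcal{O}_0^{\mathbf{Z}}$ by $\pi^*V=(\Psi,\Phi,\mathrm{var},\mathrm{can})$ with $\Psi=V\langle 1\rangle$, $\Phi=V\langle 2\rangle\oplus V$, $\mathrm{var}=\begin{pmatrix}0&\mathrm{id}_V\end{pmatrix}$, $\mathrm{can}=\begin{pmatrix}\mathrm{id}_{V\langle 1\rangle}\\0\end{pmatrix}$. Define $\pi_*\colon\mathcal{O}_0^{\mathbf{Z}}\to\mathrm{Vect}^{\mathbf{Z}}$ by $\pi_*(\Psi,\Phi,\mathrm{var},\mathrm{can})=\Phi$. Define $$F(V)=i_0\pi^*\mathrm{pr}_{-1}(V)\oplus i_{-1}\pi_*\mathrm{pr}_0(V)\oplus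 i_1\mathrm{pr}_0(V)\oplus\bigoplus_{k\ge 1}\bigl(i_{k-1}\mathrm{pr}_k(V)\oplus i_{k+1}\mathrm{pr}_k(V)\bigr).$$ *)

(* Defs.v *)
From HB Require Import structures.
From mathcomp Require Import all_boot all_order all_algebra.
From mathcomp Require Import boolp reals complex zify.

Set Implicit Arguments.
Unset Strict Implicit.
Unset Printing Implicit Defensive.

Import Order.TTheory GRing.Theory Num.Theory.
Local Open Scope ring_scope.

Record category := Category {
  obj :> Type;
  hom : obj -> obj -> Type;
  idm : forall X, hom X X;
  cmp : forall X Y Z, hom Y Z -> hom X Y -> hom X Z;
  cmp1m : forall X Y (f : hom X Y), cmp (idm Y) f = f;
  cmpm1 : forall X Y (f : hom X Y), cmp f (idm X) = f;
  cmpA : forall X Y Z W (h : hom Z W) (g : hom Y Z) (f : hom X Y),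
    cmp h (cmp g f) = cmp (cmp h g) f }.
Arguments hom {c} X Y.
Arguments idm {c} X.
Arguments cmp {c X Y Z} g f.
Notation "g \oc f" := (cmp g f) (at level 50, left associativity).

Record iso (C : category) (X Y : C) := Iso {
  iso_hom :> hom X Y;
  iso_inv : hom Y X;
  iso_invK : iso_inv \oc iso_hom = idm X;
  iso_homK : iso_hom \oc iso_inv = idm Y }.

Definition isomorphic (C : category) (X Y : C) : Prop := inhabited (iso X Y).

Definition zero_object (C : category) (X : C) : Prop :=
  forall Y : C, (exists! f : hom X Y, True) /\ (exists! f : hom Y X, True).

Record functor (C D : category) := Functor {
  fobj :> C -> D;
  fmap : forall X Y : C, hom X Y -> hom (fobj X) (fobj Y);
  fmap1 : forall X, fmap (idm X) = idm (fobj X);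
  fmapM : forall (X Y Z : C) (g : hom Y Z) (f : hom X Y),
    fmap (g \oc f) = fmap g \oc fmap f }.
Arguments fmap {C D} F {X Y} f : rename.

Record nat_trans (C D : category) (F G : functor C D) := NatTrans {
  ntc :> forall X, hom (F X) (G X);
  nt_natural : forall X Y (f : hom X Y),
    ntc Y \oc fmap F f = fmap G f \oc ntc X }.

Lemma nat_trans_eq (C D : category) (F G : functor C D) (a b : nat_trans F G) :
  (forall X, a X = b X) -> a = b.
Proof.
case: a b => [a aN] [b bN] /= ab.
have e : a = b by apply: functional_extensionality_dep.
by case: _ / e bN => bN; congr NatTrans; apply: Prop_irrelevance.
Qed.

Section FunctorCategory.
Variables C D : category.

Definition nt_id (F : functor C D) : nat_trans F F.
Proof.
refine {| ntc := fun X => idm (F X) |}.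
abstract (by move=> X Y f; rewrite cmp1m cmpm1).
Defined.

Definition nt_comp (F G H : functor C D) (b : nat_trans G H)
  (a : nat_trans F G) : nat_trans F H.
Proof.
refine {| ntc := fun X => b X \oc a X |}.
abstract (by move=> X Y f; rewrite -cmpA nt_natural !cmpA nt_natural).
Defined.

Definition functor_category : category.
Proof.
refine {| obj := functor C D; hom := @nat_trans C D;
          idm := nt_id; cmp := nt_comp |}.
- abstract (by move=> *; apply: nat_trans_eq => X; exact: cmp1m).
- abstract (by move=> *; apply: nat_trans_eq => X; exact: cmpm1).
- abstract (by move=> *; apply: nat_trans_eq => X; exact: cmpA).
Defined.

End FunctorCategory.

Definition functor_id (C : category) : functor C C.
Proof. by refine {| fobj := fun X => X; fmap := fun _ _ f => f |}. Defined.

Definition functor_comp (C D E : category) (G : functor D E) (F : functor C D) :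
  functor C E.
Proof.
refine {| fobj := fun X => G (F X); fmap := fun _ _ f => fmap G (fmap F f) |}.
- abstract (by move=> *; rewrite !fmap1).
- abstract (by move=> *; rewrite !fmapM).
Defined.

Record monoidal_category := MonoidalCategory {
  mcat :> category;
  munit : mcat;
  mten : mcat -> mcat -> mcat;
  mtenm : forall A A' B B' : mcat,
    hom A A' -> hom B B' -> hom (mten A B) (mten A' B');
  massoc : forall A B C, iso (mten (mten A B) C) (mten A (mten B C));
  mlunit : forall A, iso (mten munit A) A;
  mrunit : forall A, iso (mten A munit) A;
  mtenm1 : forall A B, mtenm (idm A) (idm B) = idm (mten A B);
  mtenmM : forall (A A' A'' B B' B'' : mcat) (f' : hom A' A'') (f : hom A A')
      (g' : hom B' B'') (g : hom B B'),
    mtenm (f' \oc f) (g' \oc g) = mtenm f' g' \oc mtenm f g;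
  massoc_natural : forall (A A' B B' C C' : mcat)
      (f : hom A A') (g : hom B B') (h : hom C C'),
    massoc A' B' C' \oc mtenm (mtenm f g) h =
    mtenm f (mtenm g h) \oc massoc A B C;
  mlunit_natural : forall (A A' : mcat) (f : hom A A'),
    mlunit A' \oc mtenm (idm munit) f = f \oc mlunit A;
  mrunit_natural : forall (A A' : mcat) (f : hom A A'),
    mrunit A' \oc mtenm f (idm munit) = f \oc mrunit A;
  mpentagon : forall A B C D : mcat,
    massoc A B (mten C D) \oc massoc (mten A B) C D =
    mtenm (idm A) (massoc B C D) \oc massoc A (mten B C) D
      \oc mtenm (massoc A B C) (idm D);
  mtriangle : forall A B : mcat,
    mtenm (idm A) (mlunit B) \oc massoc A munit B = mtenm (mrunit A) (idm B) }.
Arguments mten {m} A B.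
Arguments mtenm {m A A' B B'} f g.
Arguments munit {m}.

(* Monoidal functors are strong: the structure morphisms are invertible. *)
Record monoidal_functor (C D : monoidal_category) := MonoidalFunctor {
  mfun :> functor C D;
  mf_unit : iso (munit : D) (mfun munit);
  mf_ten : forall A B : C, iso (mten (mfun A) (mfun B)) (mfun (mten A B));
  mf_ten_natural : forall (A A' B B' : C) (f : hom A A') (g : hom B B'),
    mf_ten A' B' \oc mtenm (fmap mfun f) (fmap mfun g) =
    fmap mfun (mtenm f g) \oc mf_ten A B;
  mf_assoc : forall A B E : C,
    fmap mfun (massoc A B E) \oc mf_ten (mten A B) E
      \oc mtenm (mf_ten A B) (idm (mfun E)) =
    mf_ten A (mten B E) \oc mtenm (idm (mfun A)) (mf_ten B E)
      \oc massoc (mfun A) (mfun B) (mfun E);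
  mf_lunit : forall A : C,
    fmap mfun (mlunit A) \oc mf_ten munit A
      \oc mtenm mf_unit (idm (mfun A)) = mlunit (mfun A);
  mf_runit : forall A : C,
    fmap mfun (mrunit A) \oc mf_ten A munit
      \oc mtenm (idm (mfun A)) mf_unit = mrunit (mfun A) }.

Section Endofunctors.
Variable C : category.

Definition nt_hcomp (F F' G G' : functor C C) (a : nat_trans F F')
  (b : nat_trans G G') : nat_trans (functor_comp F G) (functor_comp F' G').
Proof.
refine (@NatTrans _ _ (functor_comp F G) (functor_comp F' G')
  (fun X => fmap F' (b X) \oc a (G X)) _).
abstract (by move=> X Y f /=;
  rewrite -cmpA nt_natural !cmpA -!fmapM nt_natural).
Defined.

Definition nt_iso (F G : functor_category C C)
  (a : nat_trans (F : functor C C) G) (b : nat_trans (G : functor C C) F)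
  (ba : forall X, b X \oc a X = idm _) (ab : forall X, a X \oc b X = idm _) :
  iso F G.
Proof.
refine (@Iso (functor_category C C) F G a b _ _).
- abstract exact: nat_trans_eq.
- abstract exact: nat_trans_eq.
Defined.

Definition end_assoc (F G H : functor_category C C) :
  iso (functor_comp (functor_comp F G) H : functor_category C C)
      (functor_comp F (functor_comp G H)).
Proof.
refine (@nt_iso
  (functor_comp (functor_comp F G) H) (functor_comp F (functor_comp G H))
  (@NatTrans _ _ (functor_comp (functor_comp F G) H)
     (functor_comp F (functor_comp G H)) (fun X => idm _)
     (fun X Y f => etrans (cmp1m _) (esym (cmpm1 _))))
  (@NatTrans _ _ (functor_comp F (functor_comp G H))
     (functor_comp (functor_comp F G) H) (fun X => idm _)
     (fun X Y f => etrans (cmp1m _) (esym (cmpm1 _)))) _ _);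
  abstract (by move=> *; exact: cmp1m).
Defined.

Definition end_lunit (F : functor_category C C) :
  iso (functor_comp (functor_id C) F : functor_category C C) F.
Proof.
refine (@nt_iso (functor_comp (functor_id C) F) F
  (@NatTrans _ _ (functor_comp (functor_id C) F) F (fun X => idm _)
     (fun X Y f => etrans (cmp1m _) (esym (cmpm1 _))))
  (@NatTrans _ _ F (functor_comp (functor_id C) F) (fun X => idm _)
     (fun X Y f => etrans (cmp1m _) (esym (cmpm1 _)))) _ _);
  abstract (by move=> *; exact: cmp1m).
Defined.

Definition end_runit (F : functor_category C C) :
  iso (functor_comp F (functor_id C) : functor_category C C) F.
Proof.
refine (@nt_iso (functor_comp F (functor_id C)) F
  (@NatTrans _ _ (functor_comp F (functor_id C)) F (fun X => idm _)
     (fun X Y f => etrans (cmp1m _) (esym (cmpm1 _))))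
  (@NatTrans _ _ F (functor_comp F (functor_id C)) (fun X => idm _)
     (fun X Y f => etrans (cmp1m _) (esym (cmpm1 _)))) _ _);
  abstract (by move=> *; exact: cmp1m).
Defined.

Definition End : monoidal_category.
Proof.
refine {| mcat := functor_category C C;
          munit := functor_id C;
          mten := fun F G => functor_comp F G;
          mtenm := nt_hcomp;
          massoc := end_assoc;
          mlunit := end_lunit;
          mrunit := end_runit |};
abstract (move=> *; apply: nat_trans_eq => X /=;
  rewrite ?fmap1 ?cmp1m ?cmpm1 ?fmap1 ?cmpm1 // ?fmapM ?cmpA //;
  by rewrite -!cmpA; congr (_ \oc _); rewrite !cmpA nt_natural).
Defined.

End Endofunctors.

(* The element 0 adjoined to B is None in option B; maps out of B are extended
   by 0 |-> 0 with obind. *)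

Definition is_max (P : nat -> Prop) (m : int) : Prop :=
  (exists2 n : nat, m = n%:Z & P n) /\ (forall n : nat, P n -> n%:Z <= m).

Record crystal := Crystal {
  carrier :> finType;
  cwt : carrier -> int;
  ceps : carrier -> int;
  cphi : carrier -> int;
  ce : carrier -> option carrier;
  cf : carrier -> option carrier;
  cphiE : forall b, cphi b = ceps b + cwt b;
  ceE : forall b b', ce b = Some b' ->
    [/\ cwt b' = cwt b + 2, ceps b' = ceps b - 1 & cphi b' = cphi b + 1];
  cfE : forall b b', cf b = Some b' ->
    [/\ cwt b' = cwt b - 2, ceps b' = ceps b + 1 & cphi b' = cphi b - 1];
  ce_cf : forall b b', ce b' = Some b <-> cf b = Some b';
  ceps_max : forall b,
    is_max (fun n => iter n (obind ce) (Some b) <> None) (ceps b);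
  cphi_max : forall b,
    is_max (fun n => iter n (obind cf) (Some b) <> None) (cphi b) }.

Lemma iter_obind_None (T : Type) (g : T -> option T) n :
  iter n (obind g) None = None.
Proof. by elim: n => //= n ->. Qed.

Lemma is_max_string (T : Type) (g : T -> option T) (h : T -> int) :
  (forall b b', g b = Some b' -> h b' = h b - 1) ->
  (forall b, 0 <= h b) -> (forall b, g b = None <-> h b = 0) ->
  forall b, is_max (fun n => iter n (obind g) (Some b) <> None) (h b).
Proof.
move=> gh h0 hN b; split.
- have [n] : exists n : nat, h b = n%:Z.
    by exists `|h b|%N; have := h0 b; lia.
  elim: n b => [|n IH] b hb; first by exists 0%N.
  case gb: (g b) => [b'|]; last by move/hN: gb; lia.
  have /IH[m hm m0] : h b' = n%:Z by rewrite (gh _ _ gb); lia.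
  exists m.+1; first by have := gh _ _ gb; lia.
  by rewrite iterSr /= gb.
- move=> n; elim: n b => [|n IH] b; first by have := h0 b; lia.
  rewrite iterSr /=; case gb: (g b) => [b'|]; last by rewrite iter_obind_None.
  by move=> /IH; have := gh _ _ gb; lia.
Qed.

Lemma is_max_ge0 P m : is_max P m -> 0 <= m.
Proof. by case=> -[n -> _]. Qed.

Lemma is_max_None (T : Type) (g : T -> option T) (h : T -> int) b :
  is_max (fun n => iter n (obind g) (Some b) <> None) (h b) ->
  g b = None <-> h b = 0.
Proof.
case=> -[n -> gn] gmax; split=> [gb|n0].
  by case: n gn gmax => // n; rewrite iterSr /= gb iter_obind_None.
case gb: (g b) => [b'|//]; have : 1%:Z <= n by apply: gmax; rewrite /= gb.
lia.
Qed.

Section CrystalTheory.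
Variable B : crystal.
Implicit Type b : B.
Lemma ceps_ge0 b : 0 <= ceps b. Proof. exact: is_max_ge0 (ceps_max b). Qed.
Lemma cphi_ge0 b : 0 <= cphi b. Proof. exact: is_max_ge0 (cphi_max b). Qed.
Lemma ce_None b : ce b = None <-> ceps b = 0.
Proof. exact: is_max_None (ceps_max b). Qed.
Lemma cf_None b : cf b = None <-> cphi b = 0.
Proof. exact: is_max_None (cphi_max b). Qed.
End CrystalTheory.

Record crystal_hom (A B : crystal) := CrystalHom {
  chom :> A -> option B;
  chom_e : forall a, obind chom (ce a) = obind (@ce B) (chom a);
  chom_f : forall a, obind chom (cf a) = obind (@cf B) (chom a);
  chom_inv : forall a b, chom a = Some b ->
    [/\ ceps b = ceps a, cphi b = cphi a & cwt b = cwt a] }.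

Lemma crystal_hom_eq (A B : crystal) (f g : crystal_hom A B) : f =1 g -> f = g.
Proof.
case: f g => f f1 f2 f3 [g g1 g2 g3] /= fg.
have e : f = g by apply: functional_extensionality_dep.
case: _ / e g1 g2 g3 => g1 g2 g3.
by congr CrystalHom; apply: Prop_irrelevance.
Qed.

Definition crystal_idm (A : crystal) : crystal_hom A A.
Proof.
refine {| chom := @Some A |}.
- abstract (by move=> a /=; case: (ce a)).
- abstract (by move=> a /=; case: (cf a)).
- abstract (by move=> a b [->]).
Defined.

Section CrystalCmp.
Variables (A B C : crystal) (g : crystal_hom B C) (f : crystal_hom A B).
Let h (a : A) := obind g (f a).

Lemma crystal_cmp_e a : obind h (ce a) = obind (@ce C) (h a).
Proof.
transitivity (obind g (obind f (ce a))); first by case: (ce a).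
by rewrite chom_e /h; case: (f a) => // b; exact: chom_e.
Qed.

Lemma crystal_cmp_f a : obind h (cf a) = obind (@cf C) (h a).
Proof.
transitivity (obind g (obind f (cf a))); first by case: (cf a).
by rewrite chom_f /h; case: (f a) => // b; exact: chom_f.
Qed.

Lemma crystal_cmp_inv a c : h a = Some c ->
  [/\ ceps c = ceps a, cphi c = cphi a & cwt c = cwt a].
Proof.
rewrite /h; case fa: (f a) => [b|] //= gb.
by have [-> -> ->] := chom_inv gb; have := chom_inv fa.
Qed.

Definition crystal_cmp : crystal_hom A C := {|
  chom := fun a => obind g (f a);
  chom_e := crystal_cmp_e;
  chom_f := crystal_cmp_f;
  chom_inv := crystal_cmp_inv |}.

End CrystalCmp.

Definition crystal_category : category.
Proof.
refine {| obj := crystal; hom := crystal_hom;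
          idm := crystal_idm; cmp := crystal_cmp |}.
- abstract (by move=> A B f; apply: crystal_hom_eq => a /=; case: (f a)).
- abstract (by move=> A B f; apply: crystal_hom_eq).
- abstract (by move=> A B C D h g f; apply: crystal_hom_eq => a /=; case: (f a)).
Defined.

Section BCrystal.
Variable n : nat.

(* The element i of 'I_n.+1 is v_{n - 2i}. *)
Definition Bwt (i : 'I_n.+1) : int := n%:Z - i%:Z *+ 2.
Definition Beps (i : 'I_n.+1) : int := i%:Z.
Definition Bphi (i : 'I_n.+1) : int := n%:Z - i%:Z.
Definition Be (i : 'I_n.+1) : option 'I_n.+1 :=
  if (0 < i)%N then Some (inord i.-1) else None.
Definition Bf (i : 'I_n.+1) : option 'I_n.+1 :=
  if (i < n)%N then Some (inord i.+1) else None.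

Lemma Bphi_eq : forall i, Bphi i = Beps i + Bwt i.
Proof. by move=> i; rewrite /Bwt /Beps /Bphi; lia. Qed.

Lemma Be_eq : forall i j, Be i = Some j ->
  [/\ Bwt j = Bwt i + 2, Beps j = Beps i - 1 & Bphi j = Bphi i + 1].
Proof.
rewrite /Bwt /Beps /Bphi /Be /Bf.
move=> i j; case: ifP => // i0 [<-]; have ij := ltn_ord i.
by rewrite inordK; [split|]; lia.
Qed.

Lemma Bf_eq : forall i j, Bf i = Some j ->
  [/\ Bwt j = Bwt i - 2, Beps j = Beps i + 1 & Bphi j = Bphi i - 1].
Proof.
rewrite /Bwt /Beps /Bphi /Be /Bf.
move=> i j; case: ifP => // i0 [<-]; have ij := ltn_ord i.
by rewrite inordK; [split|]; lia.
Qed.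

Lemma Be_Bf : forall i j, Be j = Some i <-> Bf i = Some j.
Proof.
rewrite /Bwt /Beps /Bphi /Be /Bf.
move=> i j; have := ltn_ord i; have := ltn_ord j => hj hi.
split.
+ case: (ltnP 0 j) => // h [<-].
  by rewrite inordK ?ifT; [congr Some; apply/val_inj; rewrite /= inordK|..]; lia.
+ case: (ltnP i n) => // h [<-].
  by rewrite inordK ?ifT; [congr Some; apply/val_inj; rewrite /= inordK|..]; lia.
Qed.

Lemma Beps_max : forall i,
  is_max (fun k => iter k (obind Be) (Some i) <> None) (Beps i).
Proof.
apply: (is_max_string (h := Beps)) => [i j /Be_eq[]//|//|i].
by rewrite /Be /Beps; case: ifP => // i0; split => // *; lia.
Qed.

Lemma Bphi_max : forall i,
  is_max (fun k => iter k (obind Bf) (Some i) <> None) (Bphi i).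
Proof.
apply: (is_max_string (h := Bphi)) => [i j /Bf_eq[]//|i|i].
  by rewrite /Bphi; have := ltn_ord i; lia.
have := ltn_ord i; rewrite /Bf /Bphi.
by case: ifP => // i0; split => // *; lia.
Qed.

Definition Bcrystal : crystal := {|
  carrier := 'I_n.+1;
  cwt := Bwt; ceps := Beps; cphi := Bphi; ce := Be; cf := Bf;
  cphiE := Bphi_eq; ceE := Be_eq; cfE := Bf_eq; ce_cf := Be_Bf;
  ceps_max := Beps_max; cphi_max := Bphi_max |}.

End BCrystal.

Section TensorProduct.
Variables A B : crystal.

Definition ten_wt (x : A * B) : int := cwt x.1 + cwt x.2.
Definition ten_eps (x : A * B) : int :=
  Num.max (ceps x.2) (ceps x.1 - cwt x.2).
Definition ten_phi (x : A * B) : int :=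
  Num.max (cphi x.1) (cphi x.2 + cwt x.1).
Definition ten_e (x : A * B) : option (A * B) :=
  if ceps x.1 > cphi x.2 then omap (fun a => (a, x.2)) (ce x.1)
  else omap (fun b => (x.1, b)) (ce x.2).
Definition ten_f (x : A * B) : option (A * B) :=
  if ceps x.1 >= cphi x.2 then omap (fun a => (a, x.2)) (cf x.1)
  else omap (fun b => (x.1, b)) (cf x.2).

Lemma ten_phiE x : ten_phi x = ten_eps x + ten_wt x.
Proof.
by rewrite /ten_phi /ten_eps /ten_wt (cphiE x.1) (cphiE x.2); lia.
Qed.

Lemma ten_eE x y : ten_e x = Some y ->
  [/\ ten_wt y = ten_wt x + 2, ten_eps y = ten_eps x - 1
    & ten_phi y = ten_phi x + 1].
Proof.
case: x => a b; rewrite /ten_e /ten_wt /ten_eps /ten_phi /=.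
have ha := cphiE a; have hb := cphiE b; case: ifP => h.
  by case ea: (ce a) => [a'|] //= -[<-] /=; have [] := ceE ea; split; lia.
by case eb: (ce b) => [b'|] //= -[<-] /=; have [] := ceE eb; split; lia.
Qed.

Lemma ten_fE x y : ten_f x = Some y ->
  [/\ ten_wt y = ten_wt x - 2, ten_eps y = ten_eps x + 1
    & ten_phi y = ten_phi x - 1].
Proof.
case: x => a b; rewrite /ten_f /ten_wt /ten_eps /ten_phi /=.
have ha := cphiE a; have hb := cphiE b; case: ifP => h.
  by case ea: (cf a) => [a'|] //= -[<-] /=; have [] := cfE ea; split; lia.
by case eb: (cf b) => [b'|] //= -[<-] /=; have [] := cfE eb; split; lia.
Qed.

Lemma ten_ef x y : ten_e y = Some x <-> ten_f x = Some y.
Proof.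
case: x y => a b [c d]; rewrite /ten_f /ten_e /=; split.
- case: (ltP (cphi d) (ceps c)) => h.
  + case ea: (ce c) => [a'|] //= -[<- <-].
    have [_ h1 _] := ceE ea; move/ce_cf: ea => ->; rewrite ifT //; lia.
  + case ea: (ce d) => [a'|] //= -[<- <-].
    have [_ _ h1] := ceE ea; move/ce_cf: ea => ->; rewrite ifF //; lia.
- case: (leP (cphi b) (ceps a)) => h.
  + case ea: (cf a) => [a'|] //= -[<- <-].
    have [_ h1 _] := cfE ea; move/ce_cf: ea => ->; rewrite ifT //; lia.
  + case ea: (cf b) => [a'|] //= -[<- <-].
    have [_ _ h1] := cfE ea; move/ce_cf: ea => ->; rewrite ifF //; lia.
Qed.

Lemma ten_eps_max x :
  is_max (fun n => iter n (obind ten_e) (Some x) <> None) (ten_eps x).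
Proof.
apply: is_max_string => [y z /ten_eE[]//|[a b]|[a b]]; rewrite /ten_eps /=.
  by have := ceps_ge0 b; lia.
have := (ceps_ge0 a, ceps_ge0 b, cphi_ge0 a, cphi_ge0 b) => -[[[h1 h2] h3] h4].
have ha := cphiE a; have hb := cphiE b; have := ce_None a.
have := ce_None b; rewrite /ten_e /=; case: ifP => h.
  by case: (ce a) => [a'|] /= _ [n1 n2]; [|have := n1 erefl]; split=> // *; lia.
by case: (ce b) => [b'|] /= [n1 n2] _; [|have := n1 erefl]; split=> // *;
   [have := n2 ltac:(lia)|lia].
Qed.

Lemma ten_phi_max x :
  is_max (fun n => iter n (obind ten_f) (Some x) <> None) (ten_phi x).
Proof.
apply: is_max_string => [y z /ten_fE[]//|[a b]|[a b]]; rewrite /ten_phi /=.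
  by have := cphi_ge0 a; lia.
have := (ceps_ge0 a, ceps_ge0 b, cphi_ge0 a, cphi_ge0 b) => -[[[h1 h2] h3] h4].
have ha := cphiE a; have hb := cphiE b; have := cf_None a.
have := cf_None b; rewrite /ten_f /=; case: ifP => h.
  by case: (cf a) => [a'|] /= _ [n1 n2]; [|have := n1 erefl]; split=> // *;
     [have := n2 ltac:(lia)|lia].
by case: (cf b) => [b'|] /= [n1 n2] _; [|have := n1 erefl]; split=> // *; lia.
Qed.

Definition ten_crystal : crystal := {|
  carrier := (A * B)%type;
  cwt := ten_wt; ceps := ten_eps; cphi := ten_phi; ce := ten_e; cf := ten_f;
  cphiE := ten_phiE; ceE := ten_eE; cfE := ten_fE; ce_cf := ten_ef;
  ceps_max := ten_eps_max; cphi_max := ten_phi_max |}.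

End TensorProduct.

Section TensorHom.
Variables (A A' B B' : crystal) (f : crystal_hom A A') (g : crystal_hom B B').

Definition ten_hom_fun (x : A * B) : option (A' * B') :=
  obind (fun a' => omap (fun b' => (a', b')) (g x.2)) (f x.1).

Lemma ten_hom_e x :
  obind ten_hom_fun (ten_e x) = obind (@ten_e A' B') (ten_hom_fun x).
Proof.
case: x => a b; rewrite /ten_hom_fun /=; rewrite /ten_e /=.
have := chom_e f a; have := chom_e g b; have := @chom_inv _ _ f a.
have := @chom_inv _ _ g b.
case fa: (f a) => [a'|]; case gb: (g b) => [b'|] /=; last first.
+ case: ifP => _; last by case: (ce b) => //= x; rewrite fa.
  by move=> _ _ _; case: (ce a) => //= x ->.
+ by case: ifP => _; [move=> _ _ _; case: (ce a) => //= x -> |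
                      move=> _ _ _; case: (ce b) => //= x; rewrite fa].
+ case: ifP => _; first by case: (ce a) => //= x; rewrite gb; case: (f x).
  by move=> _ _ + _; case: (ce b) => //= x; rewrite fa => /= ->.
+ move=> /(_ _ erefl)[_ -> _] /(_ _ erefl)[-> _ _]; case: ifP => _.
  * by move=> _; case: (ce a) => //= [x ->|<-//]; rewrite gb; case: ce.
  * move=> + _; case: (ce b) => //= [x ->|<-//].
    by rewrite fa; case: ce.
Qed.

Lemma ten_hom_f x :
  obind ten_hom_fun (ten_f x) = obind (@ten_f A' B') (ten_hom_fun x).
Proof.
case: x => a b; rewrite /ten_hom_fun /=; rewrite /ten_f /=.
have := chom_f f a; have := chom_f g b; have := @chom_inv _ _ f a.
have := @chom_inv _ _ g b.
case fa: (f a) => [a'|]; case gb: (g b) => [b'|] /=; last first.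
+ case: ifP => _; last by case: (cf b) => //= x; rewrite fa.
  by move=> _ _ _; case: (cf a) => //= x ->.
+ by case: ifP => _; [move=> _ _ _; case: (cf a) => //= x -> |
                      move=> _ _ _; case: (cf b) => //= x; rewrite fa].
+ case: ifP => _; first by case: (cf a) => //= x; rewrite gb; case: (f x).
  by move=> _ _ + _; case: (cf b) => //= x; rewrite fa => /= ->.
+ move=> /(_ _ erefl)[_ -> _] /(_ _ erefl)[-> _ _]; case: ifP => _.
  * by move=> _; case: (cf a) => //= [x ->|<-//]; rewrite gb; case: cf.
  * move=> + _; case: (cf b) => //= [x ->|<-//].
    by rewrite fa; case: cf.
Qed.

Lemma ten_hom_inv x y : ten_hom_fun x = Some y ->
  [/\ ten_eps y = ten_eps x, ten_phi y = ten_phi x & ten_wt y = ten_wt x].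
Proof.
case: x y => a b [a' b']; rewrite /ten_hom_fun /= /ten_eps /ten_phi /ten_wt /=.
case fa: (f a) => [x|] //=; case gb: (g b) => [y|] //= [<- <-].
by have [-> -> ->] := chom_inv fa; have [-> -> ->] := chom_inv gb.
Qed.

Definition ten_hom : crystal_hom (ten_crystal A B) (ten_crystal A' B') :=
  @CrystalHom (ten_crystal A B) (ten_crystal A' B')
    ten_hom_fun ten_hom_e ten_hom_f ten_hom_inv.

End TensorHom.

Definition crystal_bij (A B : crystal) (u : A -> B)
  (ue : forall a, omap u (ce a) = ce (u a))
  (uf : forall a, omap u (cf a) = cf (u a))
  (uinv : forall a, [/\ ceps (u a) = ceps a, cphi (u a) = cphi a
                      & cwt (u a) = cwt a]) : crystal_hom A B.
Proof.
refine {| chom := fun a => Some (u a) |}.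
- abstract (by move=> a; rewrite /= -ue; case: (ce a)).
- abstract (by move=> a; rewrite /= -uf; case: (cf a)).
- abstract (by move=> a b [<-]).
Defined.

Section CrystalIso.
Variables (A B : crystal) (u : A -> B) (v : B -> A).
Hypotheses (uv : cancel u v) (vu : cancel v u).
Hypothesis ue : forall a, omap u (ce a) = ce (u a).
Hypothesis uf : forall a, omap u (cf a) = cf (u a).
Hypothesis uinv : forall a,
  [/\ ceps (u a) = ceps a, cphi (u a) = cphi a & cwt (u a) = cwt a].

Lemma crystal_inv_e b : omap v (ce b) = ce (v b).
Proof.
by rewrite -{1}(vu b) -ue; case: (ce (v b)) => //= x; rewrite uv.
Qed.

Lemma crystal_inv_f b : omap v (cf b) = cf (v b).
Proof.
by rewrite -{1}(vu b) -uf; case: (cf (v b)) => //= x; rewrite uv.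
Qed.

Lemma crystal_inv_inv b :
  [/\ ceps (v b) = ceps b, cphi (v b) = cphi b & cwt (v b) = cwt b].
Proof. by rewrite -{2 4 6}(vu b); have [-> -> ->] := uinv (v b). Qed.

Definition crystal_iso : iso (A : crystal_category) B.
Proof.
refine (@Iso crystal_category A B
  (crystal_bij ue uf uinv)
  (crystal_bij crystal_inv_e crystal_inv_f crystal_inv_inv) _ _).
- abstract (by apply: crystal_hom_eq => a /=; rewrite uv).
- abstract (by apply: crystal_hom_eq => a /=; rewrite vu).
Defined.

End CrystalIso.

Section Associator.
Variables A B C : crystal.
Let T1 := ten_crystal (ten_crystal A B) C.
Let T2 := ten_crystal A (ten_crystal B C).
Let u (x : T1) : T2 := (x.1.1, (x.1.2, x.2)).
Let v (x : T2) : T1 := (x.1, x.2.1, x.2.2).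

Lemma ten_assoc_uv : cancel u v.
Proof. by case=> -[]. Qed.

Lemma ten_assoc_vu : cancel v u.
Proof. by case=> ? []. Qed.

Lemma ten_assoc_e : forall x, omap u (ce x) = ce (u x).
Proof.
case=> -[a b] c; rewrite /= /ten_e /= /ten_eps /ten_phi /ten_e /=.
have hb := cphiE b.
case: (ltP (cphi b) (ceps a)) => h1; case: (ltP (cphi c) (ceps b)) => h2.
+ rewrite !ifT; [by case: (ce a)|lia..].
+ case: (ltP (cphi c) (Num.max (ceps b) (ceps a - cwt b))) => h3.
    by rewrite ifT; [case: (ce a)|lia].
  by rewrite ifF; [case: (ce c)|lia].
+ by rewrite ifT ?ifF; [case: (ce b)|lia..].
+ by rewrite !ifF; [case: (ce c)|lia..].
Qed.

Lemma ten_assoc_f : forall x, omap u (cf x) = cf (u x).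
Proof.
case=> -[a b] c; rewrite /= /ten_f /= /ten_eps /ten_phi /ten_f /=.
have hb := cphiE b.
case: (leP (cphi b) (ceps a)) => h1; case: (leP (cphi c) (ceps b)) => h2.
+ rewrite !ifT; [by case: (cf a)|lia..].
+ case: (leP (cphi c) (Num.max (ceps b) (ceps a - cwt b))) => h3.
    by rewrite ifT; [case: (cf a)|lia].
  by rewrite ifF; [case: (cf c)|lia].
+ by rewrite ifT ?ifF; [case: (cf b)|lia..].
+ by rewrite !ifF; [case: (cf c)|lia..].
Qed.

Lemma ten_assoc_inv : forall x,
  [/\ ceps (u x) = ceps x, cphi (u x) = cphi x & cwt (u x) = cwt x].
Proof.
case=> -[a b] c; rewrite /= /ten_eps /ten_phi /ten_wt /= /ten_eps /ten_phi
  /ten_wt /=.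
by have hb := cphiE b; split; lia.
Qed.

Definition ten_assoc : iso (T1 : crystal_category) T2 :=
  crystal_iso ten_assoc_uv ten_assoc_vu ten_assoc_e ten_assoc_f ten_assoc_inv.

End Associator.

Section LeftUnitor.
Variable A : crystal.
Let T1 := ten_crystal (Bcrystal 0) A.
Let u (x : T1) : A := x.2.
Let v (x : A) : T1 := (ord0, x).

Lemma ten_lunit_uv : cancel u v.
Proof. by case=> w a; rewrite (ord1 w). Qed.

Lemma ten_lunit_vu : cancel v u.
Proof. by []. Qed.

Lemma ten_lunit_e : forall x, omap u (ce x) = ce (u x).
Proof.
case=> w a; rewrite (ord1 w) /u /= /ten_e /= /Bphi /Beps /=.
by rewrite ifF; [case: (ce a)|have := cphi_ge0 a; lia].
Qed.

Lemma ten_lunit_f : forall x, omap u (cf x) = cf (u x).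
Proof.
case=> w a; rewrite (ord1 w) /u /= /ten_f /= /Bphi /Beps /=; have h0 := cphi_ge0 a.
by case: leP => h; [symmetry; apply/cf_None; lia|case: (cf a)].
Qed.

Lemma ten_lunit_inv : forall x,
  [/\ ceps (u x) = ceps x, cphi (u x) = cphi x & cwt (u x) = cwt x].
Proof.
case=> w a; rewrite (ord1 w) /u /= /ten_eps /ten_phi /ten_wt /= /Bphi /Beps /Bwt /=.
by have := (ceps_ge0 a, cphi_ge0 a) => -[? ?]; have := cphiE a; split; lia.
Qed.

Definition ten_lunit : iso (T1 : crystal_category) A :=
  crystal_iso ten_lunit_uv ten_lunit_vu ten_lunit_e ten_lunit_f ten_lunit_inv.

End LeftUnitor.

Section RightUnitor.
Variable A : crystal.
Let T1 := ten_crystal A (Bcrystal 0).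
Let u (x : T1) : A := x.1.
Let v (x : A) : T1 := (x, ord0).

Lemma ten_runit_uv : cancel u v.
Proof. by case=> a w; rewrite (ord1 w). Qed.

Lemma ten_runit_vu : cancel v u.
Proof. by []. Qed.

Lemma ten_runit_e : forall x, omap u (ce x) = ce (u x).
Proof.
case=> a w; rewrite (ord1 w) /u /= /ten_e /= /Bphi /Beps /=; have h0 := ceps_ge0 a.
by case: ltP => h; [case: (ce a)|symmetry; apply/ce_None; lia].
Qed.

Lemma ten_runit_f : forall x, omap u (cf x) = cf (u x).
Proof.
case=> a w; rewrite (ord1 w) /u /= /ten_f /= /Bphi /Beps /=; have h0 := ceps_ge0 a.
by rewrite ifT; [case: (cf a)|lia].
Qed.

Lemma ten_runit_inv : forall x,
  [/\ ceps (u x) = ceps x, cphi (u x) = cphi x & cwt (u x) = cwt x].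
Proof.
case=> a w; rewrite (ord1 w) /u /= /ten_eps /ten_phi /ten_wt /= /Bphi /Beps /Bwt /=.
by have := (ceps_ge0 a, cphi_ge0 a) => -[? ?]; have := cphiE a; split; lia.
Qed.

Definition ten_runit : iso (T1 : crystal_category) A :=
  crystal_iso ten_runit_uv ten_runit_vu ten_runit_e ten_runit_f ten_runit_inv.

End RightUnitor.

Definition Crystals : monoidal_category.
Proof.
refine {| mcat := crystal_category;
          munit := Bcrystal 0;
          mten := ten_crystal;
          mtenm := ten_hom;
          massoc := ten_assoc;
          mlunit := ten_lunit;
          mrunit := ten_runit |}.
- abstract (by move=> A B; apply: crystal_hom_eq => -[a b]).
- abstract (by move=> A A' A'' B B' B'' f' f g' g;
    apply: crystal_hom_eq => -[a b]; rewrite /= /ten_hom_fun /=;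
    case: (f a) => [a'|//]; case: (g b) => [b'|//]; rewrite /=;
    case: (f' a')).
- abstract (by move=> A A' B B' C C' f g h;
    apply: crystal_hom_eq => -[[a b] c];
    rewrite /ten_assoc /= /ten_hom_fun /= /ten_hom_fun /=;
    case: (f a) => [a'|//]; case: (g b) => [b'|//]; case: (h c)).
- abstract (by move=> A A' f; apply: crystal_hom_eq => -[v a];
    rewrite /ten_lunit /= /ten_hom_fun /=; case: (f a)).
- abstract (by move=> A A' f; apply: crystal_hom_eq => -[a v];
    rewrite /ten_runit /= /ten_hom_fun /=; case: (f a)).
- abstract (by move=> A B C D; apply: crystal_hom_eq => -[[[a b] c] d]).
- abstract (by move=> A B; apply: crystal_hom_eq => -[[a v] b]).
Defined.

Section ProductCategory.
Variables C D : category.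

Definition prod_category : category.
Proof.
refine {| obj := (C * D)%type;
          hom := fun X Y => (hom X.1 Y.1 * hom X.2 Y.2)%type;
          idm := fun X => (idm X.1, idm X.2);
          cmp := fun X Y Z g f => (g.1 \oc f.1, g.2 \oc f.2) |}.
- abstract (by move=> X Y [f g] /=; rewrite !cmp1m).
- abstract (by move=> X Y [f g] /=; rewrite !cmpm1).
- abstract (by move=> X Y Z W h g f /=; rewrite !cmpA).
Defined.

Definition pr_fst : functor prod_category C.
Proof.
by refine {| fobj := fun X : prod_category => X.1; fmap := fun _ _ f => f.1 |}.
Defined.

Definition pr_snd : functor prod_category D.
Proof.
by refine {| fobj := fun X : prod_category => X.2; fmap := fun _ _ f => f.2 |}.
Defined.

Definition functor_pair (E : category) (F : functor E C) (G : functor E D) :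
  functor E prod_category.
Proof.
refine {| fobj := fun X => (F X, G X) : prod_category;
          fmap := fun _ _ f => (fmap F f, fmap G f) |}.
- abstract (by move=> X; rewrite !fmap1).
- abstract (by move=> X Y Z g f; rewrite !fmapM).
Defined.

End ProductCategory.

Definition functor_const (C D : category) (Z : D) : functor C D.
Proof.
refine {| fobj := fun _ : C => Z; fmap := fun _ _ _ => idm Z |}.
- abstract (by []).
- abstract (by move=> *; rewrite cmp1m).
Defined.

Section DirectSumCategory.
Variable C : category.

Record family := Family {
  fam_at :> nat -> C;
  fam_fin : exists N : nat, forall k, (N <= k)%N -> zero_object (fam_at k) }.

Definition dsum_category : category.
Proof.
refine {| obj := family;
          hom := fun X Y => forall k, hom (X k) (Y k);
          idm := fun X k => idm (X k);
          cmp := fun X Y Z g f k => g k \oc f k |}.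
- abstract (by move=> X Y f; apply: functional_extensionality_dep => k;
    rewrite cmp1m).
- abstract (by move=> X Y f; apply: functional_extensionality_dep => k;
    rewrite cmpm1).
- abstract (by move=> X Y Z W h g f; apply: functional_extensionality_dep => k;
    rewrite cmpA).
Defined.

Definition pr_at (k : nat) : functor dsum_category C.
Proof.
by refine {| fobj := fun X : dsum_category => (X : family) k;
             fmap := fun _ _ f => f k |}.
Defined.

Section Tuple.
Variables (E : category) (G : nat -> functor E C).
Hypothesis Gfin : forall X, exists N : nat,
  forall k, (N <= k)%N -> zero_object (G k X).

Definition functor_tuple : functor E dsum_category.
Proof.
refine {| fobj := fun X => Family (Gfin X) : dsum_category;
          fmap := fun _ _ f k => fmap (G k) f |}.
- abstract (by move=> X; apply: functional_extensionality_dep => k; rewrite fmap1).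
- abstract (by move=> X Y Z g f; apply: functional_extensionality_dep => k;
    rewrite fmapM).
Defined.

End Tuple.

Section Inclusion.
Variables (Z : C) (Z0 : zero_object Z) (k : nat).

Definition incl_component (j : nat) : functor C C :=
  if j == k then functor_id C else functor_const C Z.

Lemma incl_fin X : exists N : nat,
  forall j, (N <= j)%N -> zero_object (incl_component j X).
Proof.
exists k.+1 => j kj; rewrite /incl_component ifF //.
by apply/negbTE; rewrite neq_ltn kj orbT.
Qed.

Definition incl_at : functor C dsum_category := functor_tuple incl_fin.

End Inclusion.

End DirectSumCategory.

Section GradedO.
Variable K : fieldType.

Section LinearMaps.
Variables V W : vectType K.

Definition lin_fst : 'Hom((V * W)%type : vectType K, V) := linfun fst.
Definition lin_snd : 'Hom((V * W)%type : vectType K, W) := linfun snd.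

Let inl_fun (v : V) : V * W := (v, 0).
Let inr_fun (w : W) : V * W := (0, w).

Fact inl_is_linear : linear inl_fun.
Proof. by move=> a u v; congr pair; rewrite /= scaler0 addr0. Qed.
Fact inr_is_linear : linear inr_fun.
Proof. by move=> a u v; congr pair; rewrite /= scaler0 addr0. Qed.

HB.instance Definition _ := GRing.isLinear.Build K V (V * W)%type *:%R inl_fun
  inl_is_linear.
HB.instance Definition _ := GRing.isLinear.Build K W (V * W)%type *:%R inr_fun
  inr_is_linear.

Definition lin_inl : 'Hom(V, (V * W)%type : vectType K) := linfun inl_fun.
Definition lin_inr : 'Hom(W, (V * W)%type : vectType K) := linfun inr_fun.

Lemma lin_fstE x : lin_fst x = x.1. Proof. exact: lfunE. Qed.
Lemma lin_sndE x : lin_snd x = x.2. Proof. exact: lfunE. Qed.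
Lemma lin_inlE v : lin_inl v = (v, 0). Proof. exact: lfunE. Qed.
Lemma lin_inrE w : lin_inr w = (0, w). Proof. exact: lfunE. Qed.

End LinearMaps.
Definition linE := (lin_fstE, lin_sndE, lin_inlE, lin_inrE).

Definition lin_sum (V V' W W' : vectType K) (f : 'Hom(V, V'))
  (g : 'Hom(W, W')) : 'Hom((V * W)%type : vectType K, (V' * W')%type : vectType K) :=
  ((lin_inl V' W' \o f \o lin_fst V W) +
   (lin_inr V' W' \o g \o lin_snd V W))%VF.

Lemma lin_sumE (V V' W W' : vectType K) (f : 'Hom(V, V')) (g : 'Hom(W, W')) x :
  lin_sum f g x = (f x.1, g x.2).
Proof.
rewrite add_lfunE !comp_lfunE !linE; congr pair; first exact: addr0.
exact: add0r.
Qed.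

Record gvect := GVect {
  gsp :> int -> vectType K;
  gfin : exists s : seq int, forall i, i \notin s -> forall v : gsp i, v = 0 }.

Definition Vect : category.
Proof.
refine {| obj := gvect;
          hom := fun V W => forall i, 'Hom(V i, W i);
          idm := fun V i => \1%VF;
          cmp := fun _ _ _ g f i => (g i \o f i)%VF |}.
- abstract (by move=> V W f; apply: functional_extensionality_dep => i;
    rewrite comp_lfun1l).
- abstract (by move=> V W f; apply: functional_extensionality_dep => i;
    rewrite comp_lfun1r).
- abstract (by move=> V W X Y h g f; apply: functional_extensionality_dep => i;
    rewrite comp_lfunA).
Defined.

Lemma shift_fin (n : int) (V : gvect) : exists s : seq int,
  forall i, i \notin s -> forall v : V (i - n), v = 0.
Proof.
have [s sV] := gfin V; exists [seq i + n | i <- s] => i si; apply: sV.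
by apply: contra si => si; apply/mapP; exists (i - n); rewrite ?subrK.
Qed.

Definition shift (n : int) : functor Vect Vect.
Proof.
by refine {| fobj := fun V : Vect => GVect (shift_fin n V) : Vect;
             fmap := fun _ _ f i => f (i - n) |}.
Defined.

Lemma gsum_fin (V W : gvect) : exists s : seq int,
  forall i, i \notin s -> forall v : (V i * W i)%type, v = 0.
Proof.
have [s sV] := gfin V; have [t tW] := gfin W; exists (s ++ t) => i.
by rewrite mem_cat negb_or => /andP[si ti] [v w]; rewrite (sV _ si v) (tW _ ti w).
Qed.

Definition gsum (V W : Vect) : Vect :=
  @GVect (fun i => ((V : gvect) i * (W : gvect) i)%type : vectType K)
    (gsum_fin V W).

Definition gsum_hom (V V' W W' : Vect) (f : hom V V') (g : hom W W') :
  hom (gsum V W) (gsum V' W') := fun i => lin_sum (f i) (g i).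

Definition g0 (V W : Vect) : hom V W := fun i => 0.

Definition gcast (V : gvect) (i j : int) (e : i = j) : 'Hom(V i, V j) :=
  match e with erefl => \1%VF end.

Lemma gcast_natural (V W : Vect) (f : hom V W) i j (e : i = j) :
  (gcast W e \o f i = f j \o gcast V e)%VF.
Proof. by case: _ / e; rewrite /= comp_lfun1l comp_lfun1r. Qed.

Lemma gzero_fin : exists s : seq int,
  forall i : int, i \notin s -> forall v : 'rV[K]_0, v = 0.
Proof. by exists [::] => i _ v; exact: thinmx0. Qed.

Definition gzero : Vect := @GVect (fun _ => 'rV[K]_0 : vectType K) gzero_fin.

Record O0_obj := O0Obj {
  Psi : Vect;
  Phi : Vect;
  ovar : hom Phi (shift (-1) Psi);
  ocan : hom Psi (shift (-1) Phi);
  var_can : fmap (shift (-1)) ovar \oc ocan = g0 _ _ }.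
Arguments ovar : clear implicits.
Arguments ocan : clear implicits.

Record O0_hom (M N : O0_obj) := O0Hom {
  mPsi : hom (Psi M) (Psi N);
  mPhi : hom (Phi M) (Phi N);
  m_var : fmap (shift (-1)) mPsi \oc ovar M = ovar N \oc mPhi;
  m_can : fmap (shift (-1)) mPhi \oc ocan M = ocan N \oc mPsi }.

Lemma O0_hom_eq (M N : O0_obj) (f g : O0_hom M N) :
  mPsi f = mPsi g -> mPhi f = mPhi g -> f = g.
Proof.
case: f g => [f1 f2 fv fc] [g1 g2 gv gc] /= e1 e2.
by case: _ / e1 gv gc; case: _ / e2 => gv gc; congr O0Hom; apply: Prop_irrelevance.
Qed.

Definition O0_idm (M : O0_obj) : O0_hom M M.
Proof.
refine {| mPsi := idm (Psi M); mPhi := idm (Phi M) |}.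
- abstract (by rewrite fmap1 cmp1m cmpm1).
- abstract (by rewrite fmap1 cmp1m cmpm1).
Defined.

Definition O0_cmp (M N P : O0_obj) (g : O0_hom N P) (f : O0_hom M N) :
  O0_hom M P.
Proof.
refine {| mPsi := mPsi g \oc mPsi f; mPhi := mPhi g \oc mPhi f |}.
- abstract (by rewrite fmapM -cmpA m_var !cmpA m_var).
- abstract (by rewrite fmapM -cmpA m_can !cmpA m_can).
Defined.

Definition O0 : category.
Proof.
refine {| obj := O0_obj; hom := O0_hom; idm := O0_idm; cmp := O0_cmp |}.
- abstract (by move=> M N f; apply: O0_hom_eq; exact: cmp1m).
- abstract (by move=> M N f; apply: O0_hom_eq; exact: cmpm1).
- abstract (by move=> M N P Q h g f; apply: O0_hom_eq; exact: cmpA).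
Defined.

Lemma gvect_hom_eq (V W : Vect) (f g : hom V W) :
  (forall i v, f i v = g i v) -> f = g.
Proof.
by move=> fg; apply: functional_extensionality_dep => i; apply/lfunP => v.
Qed.

Lemma gvect_hom_at (V W : Vect) (f g : hom V W) :
  f = g -> forall i v, f i v = g i v.
Proof. by move->. Qed.

Definition O0_zero_hom (M N : O0) : @hom O0 M N.
Proof.
refine {| mPsi := g0 (Psi M) (Psi N); mPhi := g0 (Phi M) (Phi N) |}.
- abstract (by apply: gvect_hom_eq => i v; rewrite /= comp_lfun0l comp_lfun0r).
- abstract (by apply: gvect_hom_eq => i v; rewrite /= comp_lfun0l comp_lfun0r).
Defined.

Definition O0_zero : O0.
Proof.
refine (@O0Obj gzero gzero (g0 _ _) (g0 _ _) _).
abstract (by apply: gvect_hom_eq => i v; rewrite /= comp_lfun0l).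
Defined.

Lemma O0_zeroP (M : O0) : zero_object M <->
  forall i, (forall v : gsp (Psi M) i, v = 0) /\ (forall v : gsp (Phi M) i, v = 0).
Proof.
split=> [/(_ M)[[f [_ fu]] _] i|M0].
  have e : idm M = O0_zero_hom M M.
    exact: etrans (esym (fu (idm M) I)) (fu (O0_zero_hom M M) I).
  split=> v.
    have := gvect_hom_at (congr1 (@mPsi M M) e) v.
    by rewrite /= id_lfunE lfunE.
  have := gvect_hom_at (congr1 (@mPhi M M) e) v.
  by rewrite /= id_lfunE lfunE.
move=> N; split; exists (O0_zero_hom _ _); split=> // f _; apply: O0_hom_eq;
  apply: gvect_hom_eq => i v; have [z1 z2] := M0 i.
- by rewrite [v]z1 !linear0.
- by rewrite [v]z2 !linear0.
- by rewrite [RHS]z1 [LHS]z1.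
- by rewrite [RHS]z2 [LHS]z2.
Qed.

Lemma O0_zero_zero : zero_object O0_zero.
Proof. by apply/O0_zeroP => i; split=> v; exact: thinmx0. Qed.

Definition O0_sum (M N : O0) : O0.
Proof.
refine (@O0Obj (gsum (Psi M) (Psi N)) (gsum (Phi M) (Phi N))
  (gsum_hom (ovar M) (ovar N)) (gsum_hom (ocan M) (ocan N)) _).
abstract (apply: gvect_hom_eq => i v; rewrite /= comp_lfunE !lin_sumE /= -!comp_lfunE;
  rewrite ?(gvect_hom_at (var_can M) v.1);
  rewrite ?(gvect_hom_at (var_can N) v.2);
  by rewrite !lfunE).
Defined.

Definition O0_sum_hom (M M' N N' : O0) (f : hom M M') (g : hom N N') :
  @hom O0 (O0_sum M N) (O0_sum M' N').
Proof.
refine (@O0Hom (O0_sum M N) (O0_sum M' N')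
  (gsum_hom (mPsi f) (mPsi g)) (gsum_hom (mPhi f) (mPhi g)) _ _).
- abstract (apply: gvect_hom_eq => i v;
    rewrite /= !comp_lfunE !lin_sumE /= -!comp_lfunE;
    rewrite ?(gvect_hom_at (m_var f) v.1);
    by rewrite ?(gvect_hom_at (m_var g) v.2)).
- abstract (apply: gvect_hom_eq => i v;
    rewrite /= !comp_lfunE !lin_sumE /= -!comp_lfunE;
    rewrite ?(gvect_hom_at (m_can f) v.1);
    by rewrite ?(gvect_hom_at (m_can g) v.2)).
Defined.

Definition functor_sum (C : category) (G H : functor C O0) : functor C O0.
Proof.
refine {| fobj := fun X => O0_sum (G X) (H X);
          fmap := fun _ _ f => O0_sum_hom (fmap G f) (fmap H f) |}.
- abstract (move=> X; apply: O0_hom_eq; apply: gvect_hom_eq => i v;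
    by rewrite /= lin_sumE !fmap1 /= !id_lfunE -surjective_pairing).
- abstract (move=> X Y Z g f; apply: O0_hom_eq; apply: gvect_hom_eq => i v;
    by rewrite /= !comp_lfunE !lin_sumE !fmapM /= !comp_lfunE).
Defined.

Section PiUp.
Variable V : Vect.

Fact var_degree (i : int) : i = i - -1 - 1. Proof. by rewrite opprK addrK. Qed.
Fact can_degree (i : int) : i - 1 = i - -1 - 2. Proof. lia. Qed.

(* The matrices (0 id) and (id 0)^T, up to the identifications
   V<1><-1> = V and V<1> = V<2><-1>. *)
Definition pi_var : hom (gsum (shift 2 V) V) (shift (-1) (shift 1 V)) :=
  fun i => (gcast V (var_degree i) \o lin_snd _ _)%VF.
Definition pi_can : hom (shift 1 V) (shift (-1) (gsum (shift 2 V) V)) :=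
  fun i => (lin_inl _ _ \o gcast V (can_degree i))%VF.

Lemma pi_var_can : fmap (shift (-1)) pi_var \oc pi_can = g0 _ _.
Proof.
by apply: gvect_hom_eq => i v; rewrite /= !comp_lfunE !linE /= !lfunE linear0.
Qed.

Definition pi_up_obj : O0 := O0Obj pi_var_can.

End PiUp.

Section PiUpHom.
Variables (V W : Vect) (f : hom V W).

Lemma pi_up_var :
  fmap (shift (-1)) (fmap (shift 1) f) \oc pi_var V =
  pi_var W \oc gsum_hom (fmap (shift 2) f) f.
Proof.
apply: gvect_hom_eq => i v; rewrite /= !comp_lfunE lin_sumE !linE /=.
by rewrite -!comp_lfunE gcast_natural.
Qed.

Lemma pi_up_can :
  fmap (shift (-1)) (gsum_hom (fmap (shift 2) f) f) \oc pi_can V =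
  pi_can W \oc fmap (shift 1) f.
Proof.
apply: gvect_hom_eq => i v; rewrite /= !comp_lfunE lin_sumE !linE /= linear0.
by rewrite -!comp_lfunE gcast_natural.
Qed.

Definition pi_up_hom : @hom O0 (pi_up_obj V) (pi_up_obj W) :=
  @O0Hom (pi_up_obj V) (pi_up_obj W) _ _ pi_up_var pi_up_can.

End PiUpHom.

Definition pi_up : functor Vect O0.
Proof.
refine (@Functor Vect O0 pi_up_obj pi_up_hom _ _).
- abstract (move=> V; apply: O0_hom_eq => //; apply: gvect_hom_eq => i v;
    by rewrite /= lin_sumE !id_lfunE -surjective_pairing).
- abstract (move=> V W X g f; apply: O0_hom_eq => //; apply: gvect_hom_eq => i v;
    by rewrite /= !comp_lfunE !lin_sumE !comp_lfunE).
Defined.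

Definition pi_down : functor O0 Vect.
Proof. by refine (@Functor O0 Vect Phi (fun _ _ f => mPhi f) _ _). Defined.

Definition OZ : category := prod_category Vect (dsum_category O0).

(* The projection and inclusion of the summand Vect are indexed by -1. *)
Definition pr_m1 : functor OZ Vect := pr_fst Vect (dsum_category O0).
Definition pr (k : nat) : functor OZ O0 :=
  functor_comp (pr_at O0 k) (pr_snd Vect (dsum_category O0)).

Lemma dsum_zero_fin : exists N : nat,
  forall k, (N <= k)%N -> zero_object ((fun _ => O0_zero) k).
Proof. by exists 0%N => k _; exact: O0_zero_zero. Qed.

Definition dsum_zero : dsum_category O0 := Family dsum_zero_fin.

Definition i_m1 : functor Vect OZ :=
  functor_pair (functor_id Vect) (functor_const Vect dsum_zero).
Definition i_ (k : nat) : functor O0 OZ :=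
  functor_pair (functor_const O0 gzero) (incl_at O0_zero_zero k).

(* The summands of F, in order; SDown k and SUp k stand for
   i_{k-1} pr_k and i_{k+1} pr_k, with k shifted by one so that k >= 1. *)
Inductive F_index := SPiUp | SPiDown | SUp0 | SDown of nat | SUp of nat.

Definition F_summand (s : F_index) : functor OZ OZ :=
  match s with
  | SPiUp => functor_comp (i_ 0) (functor_comp pi_up pr_m1)
  | SPiDown => functor_comp i_m1 (functor_comp pi_down (pr 0))
  | SUp0 => functor_comp (i_ 1) (pr 0)
  | SDown k => functor_comp (i_ k) (pr k.+1)
  | SUp k => functor_comp (i_ k.+2) (pr k.+1)
  end.

(* The direct sum of the F_summand s is computed in each component of OZ,
   where at most two of the summands are nonzero; F_direct_sum below checks
   that this is the direct sum. *)
Definition F_component (j : nat) : functor OZ O0 :=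
  match j with
  | 0 => functor_sum (functor_comp pi_up pr_m1) (pr 1)
  | j'.+1 => functor_sum (pr j') (pr j'.+2)
  end.

Lemma F_fin (V : OZ) : exists N : nat,
  forall j, (N <= j)%N -> zero_object (F_component j V).
Proof.
have [N VN] := fam_fin V.2; exists N.+1 => -[//|j] Nj; apply/O0_zeroP => i.
have /O0_zeroP/(_ i)[a1 a2] := VN j Nj.
have /O0_zeroP/(_ i)[b1 b2] := VN j.+2 (leq_trans Nj (leqW (leqnSn _))).
by split=> -[v w]; [rewrite (a1 v) (b1 w)|rewrite (a2 v) (b2 w)].
Qed.

Definition F : functor OZ OZ :=
  functor_pair (functor_comp pi_down (pr 0)) (functor_tuple F_fin).

Definition O0_inl (M N : O0) : @hom O0 M (O0_sum M N).
Proof.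
refine (@O0Hom M (O0_sum M N) (fun i => lin_inl _ _) (fun i => lin_inl _ _) _ _).
- abstract (apply: gvect_hom_eq => i v;
    by rewrite /= !comp_lfunE lin_sumE !linE /= linear0).
- abstract (apply: gvect_hom_eq => i v;
    by rewrite /= !comp_lfunE lin_sumE !linE /= linear0).
Defined.

Definition O0_inr (M N : O0) : @hom O0 N (O0_sum M N).
Proof.
refine (@O0Hom N (O0_sum M N) (fun i => lin_inr _ _) (fun i => lin_inr _ _) _ _).
- abstract (apply: gvect_hom_eq => i v;
    by rewrite /= !comp_lfunE lin_sumE !linE /= linear0).
- abstract (apply: gvect_hom_eq => i v;
    by rewrite /= !comp_lfunE lin_sumE !linE /= linear0).
Defined.

Definition O0_copair (M N P : O0) (f : @hom O0 M P) (g : @hom O0 N P) :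
  @hom O0 (O0_sum M N) P.
Proof.
refine (@O0Hom (O0_sum M N) P
  (fun i => (mPsi f i \o lin_fst _ _)%VF + (mPsi g i \o lin_snd _ _)%VF)
  (fun i => (mPhi f i \o lin_fst _ _)%VF + (mPhi g i \o lin_snd _ _)%VF) _ _).
- abstract (apply: gvect_hom_eq => i v;
    rewrite /= !comp_lfunE lin_sumE !add_lfunE !comp_lfunE !linE /= linearD /=;
    have := gvect_hom_at (m_var f) v.1; have := gvect_hom_at (m_var g) v.2;
    by rewrite /= !comp_lfunE => -> ->).
- abstract (apply: gvect_hom_eq => i v;
    rewrite /= !comp_lfunE lin_sumE !add_lfunE !comp_lfunE !linE /= linearD /=;
    have := gvect_hom_at (m_can f) v.1; have := gvect_hom_at (m_can g) v.2;
    by rewrite /= !comp_lfunE => -> ->).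
Defined.

Lemma O0_copair_inl (M N P : O0) (f : @hom O0 M P) (g : @hom O0 N P) :
  O0_copair f g \oc O0_inl M N = f.
Proof.
by apply: O0_hom_eq; apply: gvect_hom_eq => i v;
  rewrite /= !(comp_lfunE, add_lfunE, linE) /= linear0 addr0.
Qed.

Lemma O0_copair_inr (M N P : O0) (f : @hom O0 M P) (g : @hom O0 N P) :
  O0_copair f g \oc O0_inr M N = g.
Proof.
by apply: O0_hom_eq; apply: gvect_hom_eq => i v;
  rewrite /= !(comp_lfunE, add_lfunE, linE) /= linear0 add0r.
Qed.

Lemma O0_sum_ext (M N P : O0) (f g : @hom O0 (O0_sum M N) P) :
  f \oc O0_inl M N = g \oc O0_inl M N -> f \oc O0_inr M N = g \oc O0_inr M N ->
  f = g.
Proof.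
move=> el er; apply: O0_hom_eq; apply: gvect_hom_eq => i [v w].
  have := gvect_hom_at (congr1 (@mPsi _ _) el) v.
  have := gvect_hom_at (congr1 (@mPsi _ _) er) w.
  rewrite /= !comp_lfunE !linE => e1 e2.
  have -> : (v, w) = (v, 0) + (0, w) by congr pair; rewrite /= ?addr0 ?add0r.
  by rewrite !linearD /= e1 e2.
have := gvect_hom_at (congr1 (@mPhi _ _) el) v.
have := gvect_hom_at (congr1 (@mPhi _ _) er) w.
rewrite /= !comp_lfunE !linE => e1 e2.
have -> : (v, w) = (v, 0) + (0, w) by congr pair; rewrite /= ?addr0 ?add0r.
by rewrite !linearD /= e1 e2.
Qed.

Section FromInclusion.
Variable k : nat.

Definition incl_eta (X : O0) : hom X (pr k (i_ k X)).
Proof.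
rewrite /= /incl_component; case: (k =P k) => [_|/(_ erefl) []].
exact: (idm X).
Defined.

Definition incl_map (j : nat) (X T : O0) (f : j = k -> hom X T) :
  hom (incl_component O0_zero k j X) T.
Proof.
rewrite /incl_component; case: (j =P k) => [/f//|_]; exact: O0_zero_hom.
Defined.

Definition from_i (X : O0) (Y : OZ) (f : hom X (pr k Y)) : hom (i_ k X) Y :=
  (g0 gzero Y.1,
   fun j => incl_map (fun e : j = k => eq_rect_r (fun j => hom X (pr j Y)) f e)).

Definition to_pr (X : O0) (Y : OZ) (h : hom (i_ k X) Y) : hom X (pr k Y) :=
  fmap (pr k) h \oc incl_eta X.

Lemma from_iK X Y (f : hom X (pr k Y)) : to_pr (from_i f) = f.
Proof.
rewrite /to_pr /= /incl_eta /incl_map /= /incl_component.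
case: (k =P k) => [e|/(_ erefl)[]]; rewrite (eq_irrelevance e erefl) /=.
exact: (@cmpm1 O0).
Qed.

Lemma to_pr_inj X Y (h h' : hom (i_ k X) Y) : to_pr h = to_pr h' -> h = h'.
Proof.
case: h h' => [a b] [a' b']; rewrite /to_pr /= => e; congr pair.
  apply: functional_extensionality_dep => i; apply/lfunP => v.
  by rewrite (thinmx0 v) !linear0.
apply: functional_extensionality_dep => j; have [ej|jk] := j =P k.
  rewrite {j}ej; move: (b k) (b' k) e; rewrite /incl_eta /= /incl_component.
  case: (k =P k) => [_ c c' e|/(_ erefl)[]//].
  exact: etrans (esym (@cmpm1 O0 _ _ c)) (etrans e (@cmpm1 O0 _ _ c')).
move: (b j) (b' j); rewrite /= /incl_component.
case: (j =P k) => // _ c c'.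
by have [[z [_ zu]] _] := O0_zero_zero (Y.2 j); rewrite -(zu c I) -(zu c' I).
Qed.

Lemma to_prM X Y Y' (g : hom Y Y') (h : hom (i_ k X) Y) :
  to_pr (g \oc h) = fmap (pr k) g \oc to_pr h.
Proof. by rewrite /to_pr (@fmapM _ _ (pr k)) -cmpA. Qed.

Lemma to_pr_natural X X' Y (h : hom (i_ k X') Y) (f : hom X X') :
  to_pr (h \oc fmap (i_ k) f) = to_pr h \oc f.
Proof.
rewrite /to_pr (@fmapM _ _ (pr k)) -!cmpA; congr (_ \oc _).
rewrite /incl_eta /= /incl_component; case: (k =P k) => [_|/(_ erefl)[]//].
exact: etrans (@cmpm1 O0 _ _ f) (esym (@cmp1m O0 _ _ f)).
Qed.

Definition from_i_nat (G : functor OZ O0) (T : functor OZ OZ)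
  (t : nat_trans G (functor_comp (pr k) T)) :
  nat_trans (functor_comp (i_ k) G) T.
Proof.
refine (@NatTrans _ _ (functor_comp (i_ k) G) T (fun V => from_i (t V)) _).
abstract (by move=> V W f; apply: to_pr_inj;
  apply: etrans (to_pr_natural _ (fmap G f)) _;
  rewrite to_prM !from_iK; exact: (nt_natural t f)).
Defined.

End FromInclusion.

Definition F_inj_pi_down : nat_trans (F_summand SPiDown) F.
Proof.
refine (@NatTrans _ _ (F_summand SPiDown) F
  (fun V => (idm (Phi (V.2 0%N)), fun k => O0_zero_hom O0_zero _)) _).
abstract (move=> V W f; congr pair => /=;
  [exact: etrans (@cmp1m Vect _ _ _) (esym (@cmpm1 Vect _ _ _))|];
  apply: functional_extensionality_dep => k;
  have [[z [_ zu]] _] := O0_zero_zero (F_component k W);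
  by rewrite -[LHS]zu // -[RHS]zu).
Defined.

Definition inl_nat (C : category) (G H : functor C O0) :
  nat_trans G (functor_sum G H).
Proof.
refine (@NatTrans _ _ G (functor_sum G H) (fun V => O0_inl (G V) (H V)) _).
abstract (by move=> V W f; apply: O0_hom_eq; apply: gvect_hom_eq => i v;
  rewrite /= !comp_lfunE lin_sumE !linE /= linear0).
Defined.

Definition inr_nat (C : category) (G H : functor C O0) :
  nat_trans H (functor_sum G H).
Proof.
refine (@NatTrans _ _ H (functor_sum G H) (fun V => O0_inr (G V) (H V)) _).
abstract (by move=> V W f; apply: O0_hom_eq; apply: gvect_hom_eq => i v;
  rewrite /= !comp_lfunE lin_sumE !linE /= linear0).
Defined.

Definition F_comp_nat (j : nat) :
  nat_trans (F_component j) (functor_comp (pr j) F).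
Proof.
refine (@NatTrans _ _ (F_component j) (functor_comp (pr j) F)
  (fun V => idm (F_component j V)) _).
abstract (by move=> V W f; rewrite cmp1m cmpm1).
Defined.

Definition F_inj (s : F_index) : nat_trans (F_summand s) F :=
  match s with
  | SPiUp => from_i_nat (nt_comp (F_comp_nat 0) (inl_nat _ _))
  | SPiDown => F_inj_pi_down
  | SUp0 => from_i_nat (nt_comp (F_comp_nat 1) (inl_nat _ _))
  | SDown 0 => from_i_nat (nt_comp (F_comp_nat 0) (inr_nat _ _))
  | SDown k.+1 => from_i_nat (nt_comp (F_comp_nat k.+1) (inr_nat _ _))
  | SUp k => from_i_nat (nt_comp (F_comp_nat k.+2) (inl_nat _ _))
  end.

Lemma from_i_eq k (X : O0) (Y Y' : OZ) (h : hom Y Y') (t : hom X (pr k Y))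
  (g : hom (i_ k X) Y') :
  h \oc from_i t = g <-> fmap (pr k) h \oc t = to_pr g.
Proof.
by split=> [<-|e]; [|apply: to_pr_inj]; rewrite to_prM from_iK.
Qed.

Lemma F_inj_pi_down_eq (V Y : OZ) (h : hom (F V) Y)
  (g : hom (F_summand SPiDown V) Y) : h \oc F_inj_pi_down V = g <-> h.1 = g.1.
Proof.
split=> [<-|e]; first exact: esym (@cmpm1 Vect _ _ h.1).
case: g e => a b /= e; congr pair; first exact: etrans (@cmpm1 Vect _ _ h.1) e.
apply: functional_extensionality_dep => k.
have [[z [_ zu]] _] := O0_zero_zero (Y.2 k).
exact: etrans (esym (zu _ I)) (zu _ I).
Qed.

Lemma F_direct_sum (V Y : OZ) (g : forall s, hom (F_summand s V) Y) :
  exists! h : hom (F V) Y, forall s, h \oc F_inj s V = g s.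
Proof.
pose h_ (j : nat) : hom (F_component j V) (pr j Y) :=
  match j with
  | 0 => O0_copair (to_pr (g SPiUp)) (to_pr (g (SDown 0)))
  | 1 => O0_copair (to_pr (g SUp0)) (to_pr (g (SDown 1)))
  | k.+2 => O0_copair (to_pr (g (SUp k))) (to_pr (g (SDown k.+2)))
  end.
exists (((g SPiDown).1, h_) : hom (F V) Y); split=> [s|[a b] hg].
  case: s => [|||[|[|k]]|k]; try by [apply/F_inj_pi_down_eq];
    apply/from_i_eq; apply: etrans (congr1 _ (@cmp1m O0 _ _ _)) _;
    by [exact: O0_copair_inl|exact: O0_copair_inr].
congr pair; first by have /F_inj_pi_down_eq := hg SPiDown.
apply: functional_extensionality_dep => j.
have L k (X : O0) (t : hom X (F_component k V)) s' :
    fmap (pr k) ((a, b) : hom (F V) Y) \oc (idm (F_component k V) \oc t) = s' ->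
    (b k : hom (F_component k V) (pr k Y)) \oc t = s'.
  by move=> <-; rewrite cmp1m.
case: j => [|[|k]]; apply: O0_sum_ext; rewrite ?O0_copair_inl ?O0_copair_inr;
  apply/esym/L/from_i_eq; [exact: (hg SPiUp)|exact: (hg (SDown 0))
    |exact: (hg SUp0)|exact: (hg (SDown 1))|exact: (hg (SUp k))
    |exact: (hg (SDown k.+2))].
Qed.

End GradedO.

(* Main.v *)
Require Import Defs.
From mathcomp Require Import all_boot all_order all_algebra.
From mathcomp Require Import reals complex.
From mathcomp Require Import boolp zify.
Import Defs.

(** The functor F is built from the inclusions, projections, shifts, pi^* and
    pi_*, and the only relation between these that matters is that pi_* pi^* V
    is V + V<2>.  Hence every composite of copies of F splits into explicit
    elementary summands, and the action of a crystal can be written down in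
    closed form.

    Number the summands of OZ by levels: Vect is level 0 and the k-th copy of
    O_0 is level k + 1.  An element b of a crystal B leads from level k to level
    l = k + wt b.  If eps b < k, the descent of b stays above level 0, and b
    contributes the identity functor from level k to level l.  If k <= eps b,
    it reaches level 0, the wall, and b contributes the functor
    pi^* pi_* <2 (eps b - k)>, where pi_* is dropped for k = 0 and pi^* for
    l = 0.  The crystal B acts by the direct sum of these functors over all b
    with k, l >= 0.  For B = B(1) this sum is F: that is [action_B1_iso_F].

    For the tensor product, compare the summands of the composite of the actions
    of A and B with those of A (x) B.  They agree termwise unless both a and b
    reach the wall.  If b leads from level k to level j and a leads on to l,
    let x = eps b - k and y = eps a - j be their excess depths; the composite is
    then a sum of two wall functors, of excess x + y and x + y + 1, because of
    pi_* pi^* V = V + V<2> (only the first occurs for j = 0), whereas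
    a (x) b has excess max(x, y).  Lowering b and raising a by the same number s
    of steps fixes k and l and adds s to both x and y.  So the summand of excess
    x + y + h, for h = 0 or 1, is matched with the pair obtained from (a, b) by
    s = min(x, y) + h steps.  This is a bijection ([split_labelP],
    [comp_labelK]), and it is associative ([comp_labelA]); after the tensor
    rule for strings ([move_ten]) both facts are statements about maxima and
    minima of integers.

    Everything else is bookkeeping that has been reduced to labels of summands:
    OZ is equivalent to a category of representations of a quiver with
    one arrow out of each vertex, the action of B on a representation is a direct
    sum of its spaces, and a linear map out of a direct sum is determined by the
    images of the generators [gen].  All coherence laws thus become equalities
    of labels ([rep_action]).  The action is carried back to OZ along the
    equivalence ([conj_monoidal], [OZ_action]). *)

Set Implicit Arguments.
Unset Strict Implicit.
Unset Printing Implicit Defensive.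
Import Order.TTheory GRing.Theory Num.Theory.
Local Open Scope ring_scope.

(** * Strings of a crystal *)

Section Moves.
Variable B : crystal.
Implicit Type b : B.

Definition lower b : B := odflt b (cf b).
Definition raise b : B := odflt b (ce b).

Lemma lowerE b : 0 < cphi b -> cf b = Some (lower b).
Proof. by rewrite /lower; case E: (cf b) => //; move/cf_None: E; lia. Qed.

Lemma raiseE b : 0 < ceps b -> ce b = Some (raise b).
Proof. by rewrite /raise; case E: (ce b) => //; move/ce_None: E; lia. Qed.

Lemma raiseK b : 0 < ceps b -> lower (raise b) = b.
Proof. by move=> /raiseE/ce_cf; rewrite {1}/lower => ->. Qed.

Lemma lowerK b : 0 < cphi b -> raise (lower b) = b.
Proof. by move=> /lowerE/ce_cf; rewrite {1}/raise => ->. Qed.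

(** Moves by s > 0 are lowerings and moves by s < 0 are raisings; the value is
    meaningful only for [in_string s b], since [lower] and [raise] stop at the
    ends of a string. *)
Definition move (s : int) (b : B) : B :=
  match s with Posz n => iter n lower b | Negz n => iter n.+1 raise b end.

#[global] Arguments move : simpl never.

Definition in_string (s : int) b : bool := - ceps b <= s <= cphi b.

Lemma iter_lower n b : n%:Z <= cphi b ->
  [/\ cwt (iter n lower b) = cwt b - n%:Z *+ 2,
      ceps (iter n lower b) = ceps b + n%:Z &
      cphi (iter n lower b) = cphi b - n%:Z].
Proof.
elim: n => [|n IH] hn /=; first by split; lia.
have [h1 h2 h3] := IH ltac:(lia).
have /cfE[-> -> ->] := @lowerE (iter n lower b) ltac:(lia).
by split; lia.
Qed.

Lemma iter_raise n b : n%:Z <= ceps b ->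
  [/\ cwt (iter n raise b) = cwt b + n%:Z *+ 2,
      ceps (iter n raise b) = ceps b - n%:Z &
      cphi (iter n raise b) = cphi b + n%:Z].
Proof.
elim: n => [|n IH] hn /=; first by split; lia.
have [h1 h2 h3] := IH ltac:(lia).
have /ceE[-> -> ->] := @raiseE (iter n raise b) ltac:(lia).
by split; lia.
Qed.

Lemma moveE s b : in_string s b ->
  [/\ cwt (move s b) = cwt b - s *+ 2, ceps (move s b) = ceps b + s &
      cphi (move s b) = cphi b - s].
Proof.
rewrite /in_string; case: s => n h.
  by have := @iter_lower n b ltac:(lia).
by have [? ? ?] := @iter_raise n.+1 b ltac:(lia); split; rewrite /move; lia.
Qed.

Lemma move_succ s b : in_string s b -> s < cphi b -> move (s + 1) b = lower (move s b).
Proof.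
rewrite /in_string; case: s => n h1 h2; first by have -> : n%:Z + 1 = n.+1 by lia.
have [? ? ?] := @iter_raise n b ltac:(lia).
rewrite [move (Negz n) b]/move /= raiseK; last by lia.
clear -n; by case: n => [|n]; [|have -> : Negz n.+1 + 1 = Negz n by lia].
Qed.

Lemma move_pred s b : in_string s b -> - ceps b < s -> move (s - 1) b =
    raise (move s b).
Proof.
rewrite /in_string => h1 h2; have h : in_string (s - 1) b by rewrite /in_string; lia.
have [_ _ h3] := moveE h.
rewrite -[in RHS](subrK 1 s) move_succ ?lowerK //; [rewrite h3; clear h3; lia|lia].
Qed.

Lemma move0 b : move 0 b = b. Proof. by []. Qed.

(** Within a string the moves form an action of the integers, because lowering
    and raising are mutually inverse there. *)
Lemma moveD s t b : in_string t b -> in_string (s + t) b ->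
  move s (move t b) = move (s + t) b.
Proof.
move=> ht; have [h1 h2 h3] := moveE ht; move: ht; rewrite /in_string => ht.
elim/int_rec: s => [|n IH|n IH] hst; first by rewrite add0r.
- have -> : n.+1%:Z = n%:Z + 1 by lia.
  rewrite move_succ /in_string; [|lia|lia]; rewrite IH; last by lia.
  by rewrite addrAC move_succ // /in_string; lia.
- have -> : - n.+1%:Z = - n%:Z - 1 by lia.
  rewrite move_pred /in_string; [|lia|lia]; rewrite IH; last by lia.
  by rewrite addrAC move_pred // /in_string; lia.
Qed.

Lemma moveK s b : in_string s b -> move (- s) (move s b) = b.
Proof.
move=> h; rewrite moveD ?addNr ?move0 //.
by rewrite /in_string; have := ceps_ge0 b; have := cphi_ge0 b; lia.
Qed.

Lemma moveVK s b : in_string (- s) b -> move s (move (- s) b) = b.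
Proof. by move=> /moveK; rewrite opprK. Qed.

End Moves.

Section MoveHom.
Variables (A B : crystal) (f : crystal_hom A B).

Lemma hom_lower a : 0 < cphi a -> f (lower a) = omap (@lower B) (f a).
Proof.
move=> h; have := chom_f f a; rewrite (lowerE h) /= => ->.
case E: (f a) => [b|] //=; rewrite (@lowerE _ b) //.
by have [_ -> _] := chom_inv E.
Qed.

Lemma hom_raise a : 0 < ceps a -> f (raise a) = omap (@raise B) (f a).
Proof.
move=> h; have := chom_e f a; rewrite (raiseE h) /= => ->.
case E: (f a) => [b|] //=; rewrite (@raiseE _ b) //.
by have [-> _ _] := chom_inv E.
Qed.

(** A morphism that does not kill b kills nothing in its string, since the
    lowering and raising steps can be undone. *)
Lemma hom_move s a : in_string s a -> f (move s a) = omap (move s) (f a).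
Proof.
rewrite /in_string; case: s => n h; rewrite /move.
  elim: n h => [|n IH] h; first by case: (f a).
  have [? ? ?] := @iter_lower _ n a ltac:(lia); have ? := ceps_ge0 a.
  by rewrite /= hom_lower ?IH; [case: (f a)|lia..].
have {h}: n.+1%:Z <= ceps a by lia.
elim: n.+1 => {n}[|n IH] h; first by case: (f a).
have [? ? ?] := @iter_raise _ n a ltac:(lia).
by rewrite /= hom_raise ?IH; [case: (f a)|lia..].
Qed.
End MoveHom.

Section MoveTensor.
Variables (A B : crystal).
Implicit Types (a : A) (b : B).

(** The part of a move by s of a (x) b that falls on b. Lowering acts on b
    until the surplus of phi b over eps a is used up, and then on a; raising
    acts on a until the surplus of eps a over phi b is used up, and then on b. *)
Definition ten_share (s : int) a b : int :=
  Num.min (Num.max s 0) (Num.max 0 (cphi b - ceps a)) +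
  Num.min 0 (Num.min s 0 + Num.max 0 (ceps a - cphi b)).

Lemma move_ten s a b : in_string s ((a, b) : ten_crystal A B) ->
  move s ((a, b) : ten_crystal A B) =
  (move (s - ten_share s a b) a, move (ten_share s a b) b).
Proof.
rewrite /in_string /= /ten_eps /ten_phi /=.
have := (cphiE a, cphiE b, ceps_ge0 a, ceps_ge0 b, cphi_ge0 a, cphi_ge0 b).
move=> [[[[[ha hb] a0] b0] a1] b1].
elim/int_rec: s => [|n IH|n IH] hs.
- by have -> : ten_share 0 a b = 0 by rewrite /ten_share; lia.
- have -> : n.+1%:Z = n%:Z + 1 by lia.
  rewrite move_succ; last first.
  + by rewrite /= /ten_phi /=; lia.
  + by rewrite /in_string /= /ten_eps /ten_phi /=; lia.
  rewrite IH; last by lia.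
  set t := ten_share _ _ _; set t' := ten_share _ _ _.
  have [Ea1 Ea2 Ea3] := @moveE _ (n%:Z - t) a ltac:(rewrite /in_string /t /ten_share;
      lia).
  have [Eb1 Eb2 Eb3] := @moveE _ t b ltac:(rewrite /in_string /t /ten_share; lia).
  rewrite /lower /= /ten_f /= Ea2 Eb3.
  case: ifP => h.
  + rewrite lowerE /=; last by rewrite Ea3 /t /ten_share; lia.
    have -> : t' = t by move: h; rewrite /t /t' /ten_share; lia.
    have -> : n%:Z + 1 - t = (n%:Z - t) + 1 by lia.
    by rewrite move_succ //; move: h; rewrite /in_string /t /ten_share; lia.
  + rewrite lowerE /=; last by move: h; rewrite Eb3 /t /ten_share; lia.
    have -> : t' = t + 1 by move: h; rewrite /t /t' /ten_share; lia.
    have -> : n%:Z + 1 - (t + 1) = (n%:Z - t) by lia.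
    by rewrite move_succ //; move: h; rewrite /in_string /t /ten_share; lia.
- have -> : - n.+1%:Z = - n%:Z - 1 by lia.
  rewrite move_pred; last first.
  + by rewrite /= /ten_eps /=; lia.
  + by rewrite /in_string /= /ten_eps /ten_phi /=; lia.
  rewrite IH; last by lia.
  set t := ten_share _ _ _; set t' := ten_share _ _ _.
  have [Ea1 Ea2 Ea3] := @moveE _ (- n%:Z - t) a ltac:(rewrite /in_string /t /ten_share;
      lia).
  have [Eb1 Eb2 Eb3] := @moveE _ t b ltac:(rewrite /in_string /t /ten_share; lia).
  rewrite /raise /= /ten_e /= Ea2 Eb3.
  case: ifP => h.
  + rewrite raiseE /=; last by move: h; rewrite Ea2 /t /ten_share; lia.
    have -> : t' = t by move: h; rewrite /t /t' /ten_share; lia.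
    have -> : - n%:Z - 1 - t = (- n%:Z - t) - 1 by lia.
    by rewrite move_pred //; move: h; rewrite /in_string /t /ten_share; lia.
  + rewrite raiseE /=; last by move: h; rewrite Eb2 /t /ten_share; lia.
    have -> : t' = t - 1 by move: h; rewrite /t /t' /ten_share; lia.
    have -> : - n%:Z - 1 - (t - 1) = (- n%:Z - t) by lia.
    by rewrite move_pred //; move: h; rewrite /in_string /t /ten_share; lia.
Qed.
End MoveTensor.

(** * The summands of the action and how they compose *)

(** A triple (l, p, i) stands for the degree i part of Phi (p = true) or Psi
    (p = false) at level l, where level 0 is Vect, regarded as having Phi
    only, and level k + 1 is the k-th copy of O_0. Levels are integers so that
    they can be shifted by weights. *)
Definition vertex := (int * bool * int)%type.

(** The target of var or can. The degree is written as i - -1 so that it is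
    convertible with the degree in a shift by -1. *)
Definition next_vertex (q : vertex) : vertex := (q.1.1, ~~ q.1.2, q.2 - -1).
Definition admissible (q : vertex) : bool := (0 <= q.1.1) && ((q.1.1 == 0) ==> q.1.2).

Section Label.
Variable B : crystal.
Implicit Types (b : B) (l : int) (q : vertex) (x : B * nat).

(** With l the level reached, l - wt b is the level at which b starts. *)
Definition hits_wall l b : bool := l - cwt b <= ceps b.

(** A label is a pair (b, d). It indexes a summand at the vertex q of the
    action of B. A wall functor pi^* V has three graded pieces V, V<1>, V<2>,
    linked by var and can; they are numbered d = 0, 1, 2, so that d is even
    for Phi and odd for Psi. Only d = 0 remains at level 0, and for an
    identity functor. *)
Definition valid_label q x : bool :=
  [&& admissible q, 0 <= q.1.1 - cwt x.1 &
   if hits_wall q.1.1 x.1 then [&& x.2 < 3, odd x.2 == ~~ q.1.2 &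
      (q.1.1 == 0) ==> (x.2 == 0)]%N
   else x.2 == 0%N].

(** The vertex whose space is the summand (b, d): the identity functor only
    changes the level, the wall functor reads Phi in the degree given by its
    shift and by the piece d. *)
Definition source q x : vertex :=
  if hits_wall q.1.1 x.1
  then (q.1.1 - cwt x.1, true, q.2 - x.2%:Z - (ceps x.1 - (q.1.1 - cwt x.1)) *+ 2)
  else (q.1.1 - cwt x.1, q.1.2, q.2).

Lemma source_level q x : (source q x).1.1 = q.1.1 - cwt x.1.
Proof. by rewrite /source; case: ifP. Qed.

Lemma admissible_source q x : valid_label q x -> admissible (source q x).
Proof.
rewrite /valid_label /source /admissible; have := ceps_ge0 x.1.
by case: ifP => w /=; move: w; rewrite /hits_wall; lia.
Qed.

End Label.

Section Compose.
Variables A B : crystal.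
Implicit Types (x : A * nat) (y : B * nat) (q : vertex).

(** The number of steps s = min(x, y) + h of the matching, with h = d / 2 for
    the piece d of the inner label; the factor 2 in the shift of a wall
    functor turns h into the choice between V and V<2>. The maximum with 0
    makes s vanish as soon as one of the two excess depths is negative, since
    h <= 1. *)
Definition comp_shift q x y : int :=
  Num.max 0 (Num.min (ceps x.1 - (q.1.1 - cwt x.1))
                     (ceps y.1 - (q.1.1 - cwt x.1 - cwt y.1)) + y.2./2%:Z).

(** At most one of the pieces of the two labels concerns var and can of the
    composite: the outer one if the outer functor is a wall functor, and the
    inner one otherwise. *)
Definition comp_label q x y : ten_crystal A B * nat :=
  ((move (- comp_shift q x y) x.1, move (comp_shift q x y) y.1),
   if hits_wall q.1.1 x.1 then x.2 else y.2).

Lemma comp_shift_in_string q x y : valid_label q x -> valid_label (source q x) y ->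
  in_string (- comp_shift q x y) x.1 /\ in_string (comp_shift q x y) y.1.
Proof.
case: q => [[l p] i]; case: x => a d2; case: y => b d1.
have := (cphiE a, cphiE b, ceps_ge0 a, ceps_ge0 b, cphi_ge0 a, cphi_ge0 b).
move=> [[[[[ha hb] a0] b0] a1] b1].
rewrite /valid_label /source /admissible /hits_wall /comp_shift /in_string /=.
case: ifP => wa /=; case: ifP => wb /=; lia.
Qed.

(** Where the elements are moved, both excess depths are nonnegative and the
    moves increase them; elsewhere this is the maximum rule for eps of a
    tensor product. *)
Lemma comp_hits_wall q x y : valid_label q x -> valid_label (source q x) y ->
  hits_wall q.1.1 (comp_label q x y).1 =
  hits_wall q.1.1 x.1 || hits_wall (q.1.1 - cwt x.1) y.1.
Proof.
move=> va vb; have [ia ib] := comp_shift_in_string va vb.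
have [sa1 sa2 sa3] := moveE ia; have [sb1 sb2 sb3] := moveE ib.
rewrite /hits_wall /= /ten_eps /ten_wt /= sa1 sa2 sb1 sb2.
have := (cphiE x.1, cphiE y.1, ceps_ge0 x.1, ceps_ge0 y.1, cphi_ge0 x.1, cphi_ge0 y.1).
move=> [[[[[ha hb] a0] b0] a1] b1].
move: va vb {sa1 sa2 sa3 sb1 sb2 sb3 ia ib}.
rewrite /comp_shift /valid_label /source_level /source /admissible /hits_wall.
case: q x y ha hb a0 b0 a1 b1 => [[l p] i] [a d2] [b d1] /= ha hb a0 b0 a1 b1.
by case: ifP => wa /=; case: ifP => wb /=; lia.
Qed.

Lemma comp_labelP q x y : valid_label q x -> valid_label (source q x) y ->
  valid_label q (comp_label q x y) /\ source q (comp_label q x y) =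
      source (source q x) y.
Proof.
move=> va vb; have [ia ib] := comp_shift_in_string va vb.
have [sa1 sa2 sa3] := moveE ia; have [sb1 sb2 sb3] := moveE ib.
have wc := comp_hits_wall va vb.
rewrite /valid_label /source wc /= /ten_eps /ten_wt /= sa1 sa2 sb1 sb2 {wc}.
have := (cphiE x.1, cphiE y.1, ceps_ge0 x.1, ceps_ge0 y.1, cphi_ge0 x.1, cphi_ge0 y.1).
move=> [[[[[ha hb] a0] b0] a1] b1].
move: va vb {sa1 sa2 sa3 sb1 sb2 sb3 ia ib}.
rewrite /comp_shift /valid_label /source /admissible /=.
case: q x y ha hb a0 b0 a1 b1 => [[l p] i] [a d2] [b d1] /= ha hb a0 b0 a1 b1.
case: ifP => wa /=; case: ifP => wb /= va vb; move: wa wb; rewrite /hits_wall => wa wb.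
all: split; [lia|congr (_, _, _); lia].
Qed.

(** The pairs obtained from one another by simultaneous steps form a sequence,
    on which the smaller excess depth is the position t. The two summands h =
    0, 1 of the composite of the pair at position r are matched with the
    positions 2r and 2r + 1, whence the halving of t below. *)
Definition split_depth q (z : ten_crystal A B * nat) : nat :=
  absz (Num.max 0 (Num.min (ceps z.1.1 - (q.1.1 - cwt z.1.1))
                     (ceps z.1.2 - (q.1.1 - cwt z.1.1 - cwt z.1.2)))).

Definition split_label1 q (z : ten_crystal A B * nat) : A * nat :=
  (move (uphalf (split_depth q z))%:Z z.1.1, if hits_wall q.1.1 z.1.1 then z.2 else
      0%N).

Definition split_label2 q (z : ten_crystal A B * nat) : B * nat :=
  (move (- (uphalf (split_depth q z))%:Z) z.1.2,
   if hits_wall q.1.1 z.1.1 then (odd (split_depth q z)).*2 else z.2).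

Lemma split_depth_in_string q z : valid_label q z ->
  in_string (uphalf (split_depth q z))%:Z z.1.1 /\
  in_string (- (uphalf (split_depth q z))%:Z) z.1.2.
Proof.
case: q => [[l p] i]; case: z => -[a b] d.
have := (cphiE a, cphiE b, ceps_ge0 a, ceps_ge0 b, cphi_ge0 a, cphi_ge0 b).
move=> [[[[[ha hb] a0] b0] a1] b1].
rewrite /valid_label /hits_wall /split_depth /in_string /admissible /= /ten_eps /ten_wt
    /=.
by case: ifP => wa /=; lia.
Qed.

(** The label z at position t is hit by the composite at position t / 2
    (rounded down), that is uphalf t steps back, with h the parity of t; this
    is surjectivity of the matching. *)
Lemma split_labelP q z (x := split_label1 q z) (y := split_label2 q z) :
  valid_label q z -> [/\ valid_label q x, valid_label (source q x) y & comp_label q x y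
      = z].
Proof.
move=> vz; have [ia ib] := split_depth_in_string vz.
have [sa1 sa2 sa3] := moveE ia; have [sb1 sb2 sb3] := moveE ib.
have [h1 h2 h3] : [/\ hits_wall q.1.1 x.1 = hits_wall q.1.1 z.1.1,
     hits_wall (q.1.1 - cwt x.1) y.1 = hits_wall (q.1.1 - cwt z.1.1) z.1.2
   & comp_shift q x y = (uphalf (split_depth q z))%:Z].
  rewrite /x /y {x y} /comp_shift /= /hits_wall !sa1 !sb1 !sa2 !sb2.
  move: vz {sa1 sa2 sa3 sb1 sb2 sb3 ia ib}.
  case: q => [[l p] i]; case: z => -[a b] d.
  have := (cphiE a, cphiE b, ceps_ge0 a, ceps_ge0 b, cphi_ge0 a, cphi_ge0 b).
  move=> [[[[[ha hb] a0] b0] a1] b1].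
  rewrite /valid_label /split_depth /admissible /= /hits_wall /= /ten_eps /ten_wt /=.
  case: (leP _ (ceps a)) => wa; case: ifP => wb /= vz; split; lia.
have vx : valid_label q x.
  rewrite /valid_label h1 /x /= sa1;
      move: vz {sa1 sa2 sa3 sb1 sb2 sb3 ia ib h1 h2 h3 x y}.
  case: q => [[l p] i]; case: z => -[a b] d.
  have := (cphiE a, cphiE b, ceps_ge0 a, ceps_ge0 b, cphi_ge0 a, cphi_ge0 b).
  move=> [[[[[ha hb] a0] b0] a1] b1].
  rewrite /valid_label /split_depth /admissible /= /hits_wall /= /ten_eps /ten_wt /=.
  by case: (leP _ (ceps a)) => wa; case: ifP => wb vz /=; lia.
split=> //.
  rewrite {1}/valid_label (admissible_source vx) source_level h2.
  rewrite /source h1 /x /y /= sa1 sb1;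
      move: vz {sa1 sa2 sa3 sb1 sb2 sb3 ia ib h1 h2 h3 x y vx}.
  case: q => [[l p] i]; case: z => -[a b] d.
  have := (cphiE a, cphiE b, ceps_ge0 a, ceps_ge0 b, cphi_ge0 a, cphi_ge0 b).
  move=> [[[[[ha hb] a0] b0] a1] b1].
  rewrite /valid_label /split_depth /admissible /= /hits_wall /= /ten_eps /ten_wt /=.
  by case: (leP _ (ceps a)) => wa; case: ifP => wb vz; case: ifP => wc /=; lia.
rewrite /comp_label h1 h3 /x /y /= moveK // moveVK //.
by case: (hits_wall _ _); case: (z) => -[].
Qed.

Lemma comp_labelK q x y : valid_label q x -> valid_label (source q x) y ->
  split_label1 q (comp_label q x y) = x /\ split_label2 q (comp_label q x y) = y.
Proof.
move=> va vb; have [ia ib] := comp_shift_in_string va vb.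
have [sa1 sa2 sa3] := moveE ia; have [sb1 sb2 sb3] := moveE ib.
have [h1 h2 h3] : [/\ hits_wall q.1.1 (comp_label q x y).1.1 = hits_wall q.1.1 x.1,
    comp_shift q x y = (uphalf (split_depth q (comp_label q x y)))%:Z &
    (hits_wall q.1.1 x.1 -> (odd (split_depth q (comp_label q x y))).*2 = y.2) /\
    (~~ hits_wall q.1.1 x.1 -> x.2 = 0%N)].
  rewrite /comp_label /hits_wall /split_depth /= !sa1 !sb1 !sa2 !sb2.
  move: va vb {sa1 sa2 sa3 sb1 sb2 sb3 ia ib}.
  rewrite /comp_shift /valid_label /source /admissible /=.
  case: q x y => [[l p] i] [a d2] [b d1] /=.
  have := (cphiE a, cphiE b, ceps_ge0 a, ceps_ge0 b, cphi_ge0 a, cphi_ge0 b).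
  move=> [[[[[ha hb] a0] b0] a1] b1].
  case: ifP => wa /=; case: ifP => wb /= va vb; move: wa wb;
      rewrite /hits_wall => wa wb; split; lia.
rewrite /split_label1 /split_label2 -h2 h1 /= moveK // moveVK //.
case: h3; case: (hits_wall _ _) => [/(_ isT) -> _|_ /(_ isT) e].
  by rewrite -!surjective_pairing.
by rewrite -{1}e -!surjective_pairing.
Qed.

End Compose.

(** * Associativity of the composition of summands *)

(** The numbers u, v, w are the excess depths of three composable elements.
    The two bracketings perform the shifts s1, s3 and s2, s4, and t3, t4 are
    the shares of the second shifts that fall on the right factor of the pair
    being moved; the claim is that each element is moved by the same total
    amount. *)
Lemma assoc_arith (u v w h1 h2 h4 s1 s2 s3 s4 t3 t4 : int) :
  0 <= h1 <= 1 -> 0 <= h2 <= 1 -> (v < 0 -> h2 = 0) -> (w < 0 -> h1 = 0) ->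
  h4 = (if 0 <= v then h2 else h1) ->
  s1 = Num.max 0 (Num.min u v + h2) ->
  s2 = Num.max 0 (Num.min v w + h1) ->
  s3 = Num.max 0 (Num.min (Num.max v u + s1) w + h1) ->
  s4 = Num.max 0 (Num.min u (Num.max w v + s2) + h4) ->
  t3 = Num.min 0 (- s3 + Num.max 0 (u - v)) ->
  t4 = Num.min s4 (Num.max 0 (w - v)) ->
  [/\ s1 + s3 + t3 = s4, t3 + s1 = s4 - t4 - s2 & s3 = t4 + s2].
Proof.
move=> H1 H2 H3 H4 H5 e1 e2 e3 e4 e5 e6.
suff : s1 + s3 + t3 = s4 /\ s3 = t4 + s2.
  by case=> E1 E2; clear -E1 E2; split; lia.
move: e1 e2 e3 e4 e5 e6 H5 H4 H3.
case: (leP 0 v) => v0; case: (leP u v) => uv; case: (leP v w) => vw /=.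
all: move=> e1 e2 e3 e4 e5 e6 ? H4 H3; subst h4.
all: move: e1 e2 e3 e4 e5 e6; case: (leP 0 (_ + h2)) => ? ->;
    case: (leP 0 (_ + h1)) => ? -> e3 e4 e5 e6.
all: by split; lia.
Qed.

Section Assoc.
Variables A B C : crystal.
Implicit Types (x : A * nat) (y : B * nat) (z : C * nat) (q : vertex).

(** Both bracketings give three elements moved along their strings and one
    piece number; the total moves agree by [assoc_arith]. *)
Lemma comp_labelA q x y z :
  valid_label q x -> valid_label (source q x) y ->
      valid_label (source (source q x) y) z ->
  ((comp_label q (comp_label q x y) z).1.1.1,
   ((comp_label q (comp_label q x y) z).1.1.2,
    (comp_label q (comp_label q x y) z).1.2),
   (comp_label q (comp_label q x y) z).2) =
  comp_label q x (comp_label (source q x) y z).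
Proof.
move=> vx vy vz.
have [ix iy] := comp_shift_in_string vx vy.
have [iy' iz'] := comp_shift_in_string vy vz.
have [vxy sxy] := comp_labelP vx vy.
have [vyz syz] := comp_labelP vy vz.
have vz1 : valid_label (source q (comp_label q x y)) z by rewrite sxy.
have [i1 i2] := comp_shift_in_string vxy vz1.
have [i3 i4] := comp_shift_in_string vx vyz.
have w12 := comp_hits_wall vx vy.
set s3 := comp_shift q (comp_label q x y) z in i1 i2 *.
set s4 := comp_shift q x (comp_label (source q x) y z) in i3 i4 *.
set s1 := comp_shift q x y in ix iy *.
set s2 := comp_shift (source q x) y z in iy' iz' *.
have e3 : s3 = comp_shift q (comp_label q x y) z by [].
have e4 : s4 = comp_shift q x (comp_label (source q x) y z) by [].
have e1 : s1 = comp_shift q x y by [].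
have e2 : s2 = comp_shift (source q x) y z by [].
move: i1 i2 i3 i4; rewrite [comp_label q (comp_label q x y) z]/comp_label -/s3 w12.
rewrite [comp_label q x (comp_label (source q x) y z)]/comp_label -/s4.
rewrite /comp_label -/s1 -/s2 source_level => i1 i2 i3 i4.
rewrite (move_ten i1) (move_ten i4).
rewrite [_.1.1]/= [_.1.2]/= [_.2]/=.
clearbody s1 s2 s3 s4.
have [a1 a2 a3] := moveE ix; have [b1 b2 b3] := moveE iy.
have [b1' b2' b3'] := moveE iy'; have [c1 c2 c3] := moveE iz'.
set t3 := ten_share _ _ _; set t4 := ten_share _ _ _.
have [n1 n2 n3] : [/\ s1 + s3 + t3 = s4, t3 + s1 = s4 - t4 - s2 & s3 = t4 + s2].
  rewrite /comp_label -e1 -e2 in e3 e4.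
  rewrite /comp_shift source_level /= /ten_eps /ten_wt /= in e1 e2 e3 e4.
  rewrite a1 a2 b1 b2 in e3; rewrite b1' b2' c1 c2 in e4.
  rewrite /t3 /t4 /ten_share a2 b3 b2' c3 {t3 t4 i1 i2 i3 i4}.
  have := (cphiE x.1, cphiE y.1, cphiE z.1) => -[[ha hb] hc].
  have := (ceps_ge0 x.1, ceps_ge0 y.1, ceps_ge0 z.1) => -[[xa xb] xc].
  move: vy vz; rewrite /valid_label !source_level => /and3P[_ _ vy] /and3P[_ _ vz].
  have s3_ge0 : 0 <= s3 by rewrite e3 le_max lexx.
  have s4_ge0 : 0 <= s4 by rewrite e4 le_max lexx.
  apply: (@assoc_arith (ceps x.1 - (q.1.1 - cwt x.1))
    (ceps y.1 - (q.1.1 - cwt x.1 - cwt y.1))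
    (ceps z.1 - (q.1.1 - cwt x.1 - cwt y.1 - cwt z.1)) z.2./2 y.2./2
    (if hits_wall (q.1.1 - cwt x.1) y.1 then y.2 else z.2)./2).
  - by move: vz; clear; case: ifP; lia.
  - by move: vy; clear; case: ifP; lia.
  - by move: vy; clear; rewrite /hits_wall; case: ifP; lia.
  - by move: vz; clear; rewrite /hits_wall; case: ifP; lia.
  - have -> : hits_wall (q.1.1 - cwt x.1) y.1 =
      (0 <= ceps y.1 - (q.1.1 - cwt x.1 - cwt y.1)).
      by clear; rewrite /hits_wall; lia.
    by case: ifP.
  - exact: e1.
  - exact: e2.
  - by rewrite e3; congr (Num.max 0 (Num.min _ _ + _)); clear; lia.
  - by rewrite e4; congr (Num.max 0 (Num.min _ _ + _)); clear; lia.
  - by clear -s3_ge0 ha hb; lia.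
  - by clear -s4_ge0 hb hc; lia.
have n4 : in_string (t3 + s1) y.1.
  move: iy iy' n2; rewrite /in_string /t3 /t4 /ten_share.
  have s3_ge0 : 0 <= s3 by rewrite e3 le_max lexx.
  have s4_ge0 : 0 <= s4 by rewrite e4 le_max lexx.
  by clear -s3_ge0 s4_ge0; lia.
have -> : - s3 - t3 = - s4 + s1 by clear -n1; lia.
rewrite [move (- s4 + s1) _]moveD ?[move t3 _]moveD //; last by rewrite addrK.
rewrite moveD ?[move t4 _]moveD -?n2 -?n3 // addrK.
congr (_, _); case: (hits_wall q.1.1 x.1); case: (hits_wall _ y.1) => //.
Qed.
End Assoc.

(** * Morphisms, steps and units on summands *)

Section HomLabel.
Variables (A B : crystal) (f : crystal_hom A B).

(** The value None means that the summand is sent to 0. *)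
Definition hom_label (x : A * nat) : option (B * nat) :=
  omap (fun b => (b, x.2)) (f x.1).

Lemma hom_labelP q x y : hom_label x = Some y ->
  valid_label q y = valid_label q x /\ source q y = source q x.
Proof.
rewrite /hom_label; case E: (f x.1) => [b|] //= [<-].
by rewrite /valid_label /source /hits_wall /=; have [-> _ ->] := chom_inv E.
Qed.
End HomLabel.

Lemma hom_comp_label (A A' B B' : crystal) (f : crystal_hom A A')
    (g : crystal_hom B B') q x y :
  valid_label q x -> valid_label (source q x) y ->
  hom_label (ten_hom f g) (comp_label q x y) =
  obind (fun x' => omap (comp_label q x') (hom_label g y)) (hom_label f x).
Proof.
move=> vx vy; have [ix iy] := comp_shift_in_string vx vy.
rewrite /hom_label /= /ten_hom_fun /= (hom_move f ix) (hom_move g iy).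
case E: (f x.1) => [a|] //=; case E': (g y.1) => [b|] //=.
rewrite /comp_label /comp_shift /hits_wall /=.
by have [-> _ ->] := chom_inv E; have [-> _ ->] := chom_inv E'.
Qed.

Section StepLabel.
Variable B : crystal.
Implicit Types (x : B * nat) (q : vertex).

Definition next_copy x : B * nat := (x.1, x.2.+1).

(** The maps var and can of pi^* V are identities between consecutive pieces,
    and consecutive pieces read the same space. *)
Lemma source_next_copy q x : hits_wall q.1.1 x.1 -> valid_label q x ->
    source (next_vertex q) (next_copy x) = source q x.
Proof. by rewrite /source /= => -> _; congr (_, _, _); lia. Qed.

Lemma source_next_vertex q x : ~~ hits_wall q.1.1 x.1 -> source (next_vertex q) x =
    next_vertex (source q x).
Proof. by rewrite /source /= => /negbTE->. Qed.

Lemma valid_next_vertex q x : ~~ hits_wall q.1.1 x.1 -> valid_label q x ->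
    valid_label (next_vertex q) x.
Proof.
rewrite /valid_label /admissible /= => w; rewrite (negbTE w); move: w;
    rewrite /hits_wall.
by have := cphiE x.1; have := cphi_ge0 x.1; case: q => [[l p] i] /=; lia.
Qed.

(** The last piece, and every piece at level 0, is killed by the next map. *)
Lemma valid_next_copy q x : hits_wall q.1.1 x.1 -> valid_label q x ->
  valid_label (next_vertex q) (next_copy x) = (x.2 < 2)%N && (q.1.1 != 0).
Proof.
rewrite /valid_label /admissible /= => w; rewrite w; move: w; rewrite /hits_wall.
by case: q => [[l p] i] /=; lia.
Qed.
End StepLabel.

Section StepComp.
Variables A B : crystal.
Implicit Types (x : A * nat) (y : B * nat) (q : vertex).

Lemma comp_label_next_copy_l q x y : hits_wall q.1.1 x.1 ->
  comp_label q (next_copy x) y = next_copy (comp_label q x y).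
Proof. by rewrite /comp_label /comp_shift /= => ->. Qed.

Lemma comp_label_next_copy_r q x y : ~~ hits_wall q.1.1 x.1 ->
  valid_label q x -> valid_label (source q x) y -> hits_wall (q.1.1 - cwt x.1) y.1 ->
  comp_label q x (next_copy y) = next_copy (comp_label q x y).
Proof.
move=> w vx vy wy; rewrite /comp_label /next_copy /= (negbTE w).
suff [-> ->] : comp_shift q x y = 0 /\ comp_shift q x (y.1, y.2.+1) = 0 by [].
move: w vy wy; rewrite /comp_shift /hits_wall /valid_label source_level /hits_wall /=.
by case: ifP => _; split; lia.
Qed.
End StepComp.

Section UnitLabel.
Variable A : crystal.
Implicit Types (x : A * nat) (q : vertex).

Definition unit_label : Bcrystal 0 * nat := (ord0, 0%N).

Lemma unit_valid q : admissible q -> valid_label q unit_label.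
Proof.
by rewrite /valid_label /hits_wall /admissible /= /Bwt /Beps /=;
    case: q => [[l p] i] /=; case: ifP; lia.
Qed.

Lemma unit_source q : admissible q -> source q unit_label = q.
Proof.
rewrite /source /hits_wall /admissible /= /Bwt /Beps /=; case: q => [[l p] i] /=.
by case: ifP => w h; congr (_, _, _); move: w; lia.
Qed.

Lemma unit_labelP q (u : Bcrystal 0 * nat) : valid_label q u -> u = unit_label.
Proof.
case: u => u d; rewrite /valid_label /hits_wall /admissible /= (ord1 u) /Bwt /Beps /=.
case: q => [[l p] i] /= h; congr (_, _); move: h; case: ifP; lia.
Qed.

(** The unit crystal has one element, which changes no level, reaches the wall
    only at level 0, and has excess 0 there. *)
Lemma comp_unit_l q x : valid_label q x ->
  comp_label q unit_label x = ((ord0, x.1), x.2).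
Proof.
move=> vx; suff [e1 e2] : comp_shift q unit_label x = 0 /\
    (hits_wall q.1.1 unit_label.1 -> x.2 = 0%N).
  rewrite /comp_label e1 oppr0 !move0 /=; case: ifP => // /e2 ->//.
move: vx; rewrite /comp_shift /hits_wall /valid_label /admissible /= /Bwt /Beps /=
    /hits_wall.
by case: ifP => w vx; split; lia.
Qed.

Lemma comp_unit_r q x : valid_label q x ->
  comp_label q x unit_label = ((x.1, ord0), x.2).
Proof.
move=> vx; suff [e1 e2] : comp_shift q x unit_label = 0 /\
    (~~ hits_wall q.1.1 x.1 -> x.2 = 0%N).
  rewrite /comp_label e1 oppr0 !move0 /=; case: ifP => // /negbT/e2 ->//.
move: vx; rewrite /comp_shift /hits_wall /valid_label /admissible /= /Bwt /Beps /=
    /hits_wall.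
by case: ifP => w vx; split; lia.
Qed.
End UnitLabel.

(** * Representations of the quiver of vertices and sums over labels *)

Section DirectSum.
Variables (K : fieldType) (I : eqType) (T : I -> vectType K).

Definition transport_hom (a b : I) (e : a = b) : 'Hom(T a, T b) :=
  match e with erefl => \1%VF end.

Fixpoint dsum (s : seq I) : vectType K :=
  if s is a :: s' then (T a * dsum s')%type : vectType K else 'rV[K]_0.

(** Equal to 0 for i outside s, which makes the inclusions total. *)
Fixpoint dinj (s : seq I) (i : I) : 'Hom(T i, dsum s) :=
  match s with
  | [::] => 0
  | a :: s' =>
    match i =P a with
    | ReflectT e => (lin_inl (T a) (dsum s') \o transport_hom e)%VF
    | ReflectF _ => (lin_inr (T a) (dsum s') \o dinj s' i)%VF
    end
  end.

Fixpoint dlift (s : seq I) (W : vectType K) (g : forall i, 'Hom(T i, W)) :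
  'Hom(dsum s, W) :=
  match s with
  | [::] => 0
  | a :: s' => ((g a \o lin_fst (T a) (dsum s')) +
                (dlift s' g \o lin_snd (T a) (dsum s')))%VF
  end.

Lemma dlift_inj s (W : vectType K) (g : forall i, 'Hom(T i, W)) i x :
  i \in s -> dlift s g (dinj s i x) = g i x.
Proof.
elim: s => //= a s IH; rewrite inE add_lfunE !comp_lfunE !linE.
case: (i =P a) => [e _|_ /= /IH <-]; rewrite comp_lfunE !linE /=.
  by case: a / e; rewrite /= id_lfunE linear0 addr0.
by rewrite linear0 add0r.
Qed.

Lemma dinj_notin s i : i \notin s -> dinj s i = 0.
Proof.
elim: s => //= a s IH; rewrite inE; case: (i =P a) => //= _ /IH ->.
by rewrite comp_lfun0r.
Qed.

Lemma dsum_ext s (W : vectType K) (f g : 'Hom(dsum s, W)) : uniq s ->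
  (forall i, i \in s -> forall x, f (dinj s i x) = g (dinj s i x)) -> f = g.
Proof.
elim: s f g => [|a s IH] f g /=.
  by move=> _ _; apply/lfunP => v; rewrite (thinmx0 v) !linear0.
case/andP=> as_ us fg; have fg_l x : f (x, 0) = g (x, 0).
  have := fg a (mem_head _ _) x; case: (a =P a) => // e.
  by rewrite (eq_irrelevance e erefl) /= comp_lfunE id_lfunE !linE.
have fg_r : (f \o lin_inr (T a) (dsum s))%VF = (g \o lin_inr (T a) (dsum s))%VF.
  apply: IH => // i si x; have /fg/(_ x) : i \in a :: s by rewrite inE si orbT.
  case: (i =P a) => [e|_]; first by rewrite e (negbTE as_) in si.
  by rewrite !comp_lfunE.
apply/lfunP => -[x v]; have -> : (x, v) = (x, 0) + (0, v).
  by congr pair; rewrite /= ?addr0 ?add0r.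
rewrite !linearD /= fg_l; congr (_ + _).
by have /lfunP/(_ v) := fg_r; rewrite !comp_lfunE !linE.
Qed.

Lemma dsum_eq0 s : uniq s -> (forall i, i \in s -> forall x : T i, x = 0) ->
  forall v : dsum s, v = 0.
Proof.
move=> us T0 v; have e : (\1 : 'End(dsum s))%VF = 0.
  by apply: dsum_ext => // i si x; rewrite [x]T0 // !linear0.
by rewrite -[LHS](id_lfunE) e zero_lfunE.
Qed.

End DirectSum.

Section Rep.
Variable K : fieldType.

Definition far_vertex (N : nat) (q : vertex) : bool :=
    (N%:Z < q.1.1) || (N%:Z < `|q.2|).

(** The quiver has the single arrow from q to [next_vertex q] out of each
    vertex, and [rep_step2] is var o can = 0. Vertices of negative level and
    Psi at level 0 are not in use, and representations vanish there. *)
Record rep := Rep {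
  rep_space :> vertex -> vectType K;
  rep_step : forall q, 'Hom(rep_space q, rep_space (next_vertex q));
  rep_step2 : forall q, ~~ q.1.2 ->
    forall v, rep_step (next_vertex q) (rep_step q v) = 0;
  rep_not_admissible : forall q, ~~ admissible q -> forall v : rep_space q, v = 0;
  rep_finite : exists N, forall q, far_vertex N q -> forall v : rep_space q, v = 0 }.

Record rhom (X Y : rep) := RHom {
  rhom_at :> forall q, 'Hom(X q, Y q);
  rhom_step : forall q v, rhom_at (next_vertex q) (rep_step X q v) =
      rep_step Y q (rhom_at q v) }.

Lemma rhom_eq X Y (f g : rhom X Y) : (forall q v, f q v = g q v) -> f = g.
Proof.
case: f g => f f1 [g g1] /= fg.
have e : f = g by apply: functional_extensionality_dep => q; apply/lfunP => v;
    exact: fg.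
by case: _ / e g1 => g1; congr RHom; apply: Prop_irrelevance.
Qed.

Definition rhom_id X : rhom X X.
Proof.
refine (@RHom X X (fun q => \1%VF) _).
abstract (by move=> q v; rewrite !id_lfunE).
Defined.

Definition rhom_cmp X Y Z (g : rhom Y Z) (f : rhom X Y) : rhom X Z.
Proof.
refine (@RHom X Z (fun q => (g q \o f q)%VF) _).
abstract (by move=> q v; rewrite !comp_lfunE !rhom_step).
Defined.

Definition rep_category : category.
Proof.
refine {| obj := rep; hom := rhom; idm := rhom_id; cmp := rhom_cmp |}.
- abstract (by move=> X Y f; apply: rhom_eq => q v; rewrite /= comp_lfun1l).
- abstract (by move=> X Y f; apply: rhom_eq => q v; rewrite /= comp_lfun1r).
- abstract (by move=> X Y Z W h g f; apply: rhom_eq => q v; rewrite /= comp_lfunA).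
Defined.

(** Comparison of the spaces at two provably equal vertices, extended by 0 so
    that no equality proof occurs in terms. *)
Definition recast (X : vertex -> vectType K) (q q' : vertex) : 'Hom(X q, X q') :=
  if q =P q' is ReflectT e then transport_hom X e else 0.

Lemma recast_id (X : vertex -> vectType K) q x : recast X q q x = x.
Proof.
rewrite /recast; case: (q =P q) => // e.
by rewrite (eq_irrelevance e erefl) /= id_lfunE.
Qed.

Lemma recast_neq (X : vertex -> vectType K) q q' : q != q' -> recast X q q' = 0.
Proof. by rewrite /recast; case: (q =P q'). Qed.

Section Gen.
Variable B : crystal.
Implicit Types (X Y : vertex -> vectType K) (q : vertex) (x : B * nat).

Definition all_labels : seq (B * nat) := [seq (b, d) | b <- enum B, d <- iota 0 3].
Definition labels q : seq (B * nat) := [seq x <- all_labels | valid_label q x].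

Lemma mem_labels q x : (x \in labels q) = valid_label q x.
Proof.
rewrite mem_filter andb_idr // => vx; case: x vx => b d vx.
apply: allpairs_f; first by rewrite mem_enum.
by move: vx; rewrite mem_iota /valid_label /=; case: ifP; lia.
Qed.

Lemma uniq_labels q : uniq (labels q).
Proof.
apply/filter_uniq/allpairs_uniq; rewrite ?enum_uniq ?iota_uniq //.
by move=> [? ?] [? ?].
Qed.

Definition induced_space X q : vectType K := dsum (fun x => X (source q x)) (labels q).

(** The inclusion of the summand x, read from any vertex q': it is 0 unless x
    is valid and q' is the source of x. Locking stops unification from looking
    into the composite. *)
Definition gen X q x q' : 'Hom(X q', induced_space X q) :=
  locked (dinj (fun x => X (source q x)) (labels q) x \o recast X q' (source q x))%VF.

Definition glift X q (W : vectType K) (g : forall x, 'Hom(X (source q x), W)) :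
    'Hom(induced_space X q, W) :=
  dlift (labels q) g.

Lemma glift_gen X q (W : vectType K) (g : forall x, 'Hom(X (source q x), W)) x v :
  valid_label q x -> glift g (gen X q x (source q x) v) = g x v.
Proof.
by move=> vx; rewrite /glift /gen -lock comp_lfunE recast_id dlift_inj ?mem_labels.
Qed.

Lemma gen_invalid X q x q' v : ~~ valid_label q x -> gen X q x q' v = 0.
Proof.
by move=> vx; rewrite /gen -lock comp_lfunE dinj_notin ?mem_labels // zero_lfunE.
Qed.

Lemma gen_neq X q x q' v : q' != source q x -> gen X q x q' v = 0.
Proof. by move=> e; rewrite /gen -lock comp_lfunE recast_neq // zero_lfunE linear0. Qed.

(** Linear maps out of the sum are compared on generators; all identities
    between maps below are proved in this way. *)
Lemma gen_ext X q (W : vectType K) (f g : 'Hom(induced_space X q, W)) :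
  (forall x v, valid_label q x ->
     f (gen X q x (source q x) v) = g (gen X q x (source q x) v)) -> f =1 g.
Proof.
move=> fg; apply/lfunP; apply: (dsum_ext (uniq_labels q)) => x.
by rewrite mem_labels => vx v; have := fg x v vx;
    rewrite /gen -lock !comp_lfunE recast_id.
Qed.

Lemma induced_space_eq0 X q : (forall x, valid_label q x ->
    forall v : X (source q x), v = 0) ->
  forall v : induced_space X q, v = 0.
Proof.
move=> X0; apply: dsum_eq0 (uniq_labels q) _ => x.
by rewrite mem_labels; apply: X0.
Qed.

End Gen.
End Rep.

(** * The action of a crystal on representations *)

Section CrystalFunctor.
Variable K : fieldType.
Section Fixed.
Variable B : crystal.
Implicit Types (X Y : rep K) (q : vertex) (x : B * nat).

(** On a wall summand var and can pass to the next piece, on an identity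
    summand they are those of X. *)
Definition induced_step X q : 'Hom(induced_space B X q, induced_space B X (next_vertex
    q)) :=
  glift (fun x => if hits_wall q.1.1 x.1 then gen X (next_vertex q) (next_copy x)
      (source q x)
    else (gen X (next_vertex q) x (next_vertex (source q x)) \o rep_step X (source q
        x))%VF).

Lemma induced_step_wall X q x q' (v : X q') : hits_wall q.1.1 x.1 -> valid_label q x ->
    q' = source q x ->
  induced_step X q (gen X q x q' v) = gen X (next_vertex q) (next_copy x) q' v.
Proof. by move=> w vx e; subst q'; rewrite /induced_step glift_gen // w. Qed.

Lemma induced_step_id X q x q' (v : X q') : ~~ hits_wall q.1.1 x.1 ->
    valid_label q x -> q' = source q x ->
  induced_step X q (gen X q x q' v) =
      gen X (next_vertex q) x (next_vertex q') (rep_step X q' v).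
Proof.
by move=> /negbTE w vx e; subst q'; rewrite /induced_step glift_gen // w comp_lfunE.
Qed.

Lemma induced_step2 X q : ~~ q.1.2 ->
    forall v, induced_step X (next_vertex q) (induced_step X q v) = 0.
Proof.
move=> pq v; suff /(_ v) : (induced_step X (next_vertex q) \o induced_step X q)%VF =1
    (0 : 'Hom(induced_space B X q, induced_space B X (next_vertex (next_vertex q)))).
  by rewrite comp_lfunE zero_lfunE.
apply: gen_ext => x {}v vx; rewrite comp_lfunE zero_lfunE.
have [w|w] := boolP (hits_wall q.1.1 x.1).
  rewrite induced_step_wall //.
  have [vx'|vx'] := boolP (valid_label (next_vertex q) (next_copy x)); last first.
    by rewrite gen_invalid // linear0.
  rewrite induced_step_wall ?source_next_copy // gen_invalid // /valid_label /= w.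
  by move: vx; rewrite /valid_label w pq; case: (x.2) => [|[|[]]] //=;
      rewrite ?andbF //= andbF.
rewrite induced_step_id // induced_step_id ?source_next_vertex //;
    last exact: valid_next_vertex.
by rewrite rep_step2 ?linear0 // /source (negbTE w).
Qed.

(** Weights and depths of the finitely many elements of B are bounded, so that
    the action of B preserves finiteness. *)
Lemma crystal_bound : exists C : nat, forall b : B,
  (`|cwt b| <= C%:Z) /\ (ceps b <= C%:Z).
Proof.
exists (\max_(b : B) (absz (cwt b) + absz (ceps b)))%N => b.
have : (absz (cwt b) + absz (ceps b) <= \max_(b : B) (absz (cwt b) + absz (ceps b)))%N.
  exact: leq_bigmax.
by move: (\max_b _)%N => C; lia.
Qed.

Lemma induced_finite X : exists N, forall q, far_vertex N q ->
    forall v : induced_space B X q, v = 0.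
Proof.
have [N XN] := rep_finite X; have [C hC] := crystal_bound.
exists (N + C.*2 + 2)%N => q fq; apply: induced_space_eq0 => x vx; apply: XN.
have [h1 h2] := hC x.1; move: fq vx;
    rewrite /far_vertex /valid_label /source /hits_wall.
by have := ceps_ge0 x.1; case: ifP => w /=; lia.
Qed.

Definition induced X : rep K.
Proof.
refine (@Rep K (induced_space B X) (induced_step X) (@induced_step2 X) _
    (induced_finite X)).
abstract (by move=> q bq; apply: induced_space_eq0 => x;
    rewrite /valid_label (negbTE bq)).
Defined.

Lemma induced_stepE X q v : rep_step (induced X) q v = induced_step X q v.
Proof. by []. Qed.

Definition induced_map_at X Y (h : rhom X Y) q :
    'Hom(induced_space B X q, induced_space B Y q) :=
  glift (fun x => (gen Y q x (source q x) \o h (source q x))%VF).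

Lemma induced_map_gen X Y (h : rhom X Y) q x q' v :
  induced_map_at h q (gen X q x q' v) = gen Y q x q' (h q' v).
Proof.
have [vx|vx] := boolP (valid_label q x); last by rewrite !gen_invalid ?linear0.
have [e|e] := eqVneq q' (source q x); last by rewrite !gen_neq ?linear0.
by subst q'; rewrite /induced_map_at glift_gen // comp_lfunE.
Qed.

Lemma induced_map_step X Y (h : rhom X Y) q (v : induced X q) :
  induced_map_at h (next_vertex q) (rep_step (induced X) q v) =
      rep_step (induced Y) q (induced_map_at h q v).
Proof.
suff /(_ v) : (induced_map_at h (next_vertex q) \o induced_step X q)%VF =1
    (induced_step Y q \o induced_map_at h q)%VF.
  by rewrite !comp_lfunE.
apply: gen_ext => x {}v vx; rewrite !comp_lfunE induced_map_gen.
have [w|w] := boolP (hits_wall q.1.1 x.1).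
  by rewrite !induced_step_wall // induced_map_gen.
by rewrite !induced_step_id // induced_map_gen rhom_step.
Qed.

Definition induced_map X Y (h : rhom X Y) : rhom (induced X) (induced Y) :=
  @RHom K (induced X) (induced Y) (induced_map_at h) (@induced_map_step X Y h).

Definition induced_functor : functor (rep_category K) (rep_category K).
Proof.
refine (@Functor (rep_category K) (rep_category K) induced induced_map _ _).
- abstract (move=> X; apply: rhom_eq => q; apply: gen_ext => x v vx;
    by rewrite /= induced_map_gen /= !id_lfunE).
- abstract (move=> X Y Z g f; apply: rhom_eq => q; apply: gen_ext => x v vx;
    by rewrite /= comp_lfunE !induced_map_gen /= comp_lfunE).
Defined.

End Fixed.

Section Morphism.
Variables (A B : crystal) (f : crystal_hom A B).
Implicit Types (X Y : rep K) (q : vertex) (x : A * nat).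

Definition gen_opt X q (x : option (B * nat)) q' : 'Hom(X q', induced_space B X q) :=
  if x is Some x' then gen X q x' q' else 0.

(** A morphism of crystals preserves wt and eps, so that it maps summands to
    summands of the same kind, or to 0. *)
Definition crystal_map_at X q : 'Hom(induced_space A X q, induced_space B X q) :=
  glift (fun x => gen_opt X q (hom_label f x) (source q x)).

Lemma crystal_map_gen X q x q' v : valid_label q x -> q' = source q x ->
  crystal_map_at X q (gen X q x q' v) = gen_opt X q (hom_label f x) q' v.
Proof. by move=> vx e; subst q'; rewrite /crystal_map_at glift_gen. Qed.

Lemma hom_next_copy x : hom_label f (next_copy x) = omap (@next_copy B) (hom_label f x).
Proof. by rewrite /hom_label /=; case: (f x.1). Qed.

Lemma hom_hits_wall l x y : hom_label f x = Some y -> hits_wall l y.1 = hits_wall l x.1.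
Proof.
rewrite /hom_label; case E: (f x.1) => [b|] //= [<-].
by rewrite /hits_wall /=; have [-> _ ->] := chom_inv E.
Qed.

Lemma crystal_map_step X q (v : induced A X q) :
  crystal_map_at X (next_vertex q) (rep_step (induced A X) q v) =
      rep_step (induced B X) q (crystal_map_at X q v).
Proof.
suff /(_ v) : (crystal_map_at X (next_vertex q) \o induced_step A X q)%VF =1
    (induced_step B X q \o crystal_map_at X q)%VF.
  by rewrite !comp_lfunE.
apply: gen_ext => x {}v vx; rewrite !comp_lfunE [in RHS]crystal_map_gen //.
have [w|w] := boolP (hits_wall q.1.1 x.1).
  rewrite induced_step_wall //.
  have [vx'|vx'] := boolP (valid_label (next_vertex q) (next_copy x)).
    rewrite crystal_map_gen ?source_next_copy // hom_next_copy.
    case E: (hom_label f x) => [y|] /=; last by rewrite !zero_lfunE ?linear0.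
    have [e1 e2] := hom_labelP q E.
    by rewrite induced_step_wall ?(hom_hits_wall _ E) ?e1 ?e2.
  rewrite gen_invalid // linear0.
  case E: (hom_label f x) => [y|] /=; last by rewrite !zero_lfunE ?linear0.
  have [e1 e2] := hom_labelP q E.
  rewrite induced_step_wall ?(hom_hits_wall _ E) ?e1 ?e2 // gen_invalid //.
  have E' : hom_label f (next_copy x) = Some (next_copy y) by rewrite hom_next_copy E.
  by have [-> _] := hom_labelP (next_vertex q) E'.
rewrite induced_step_id // crystal_map_gen ?source_next_vertex ?valid_next_vertex //.
case E: (hom_label f x) => [y|] /=; last by rewrite !zero_lfunE linear0.
have [e1 e2] := hom_labelP q E.
by rewrite induced_step_id ?(hom_hits_wall _ E) ?e1 ?e2.
Qed.

Definition crystal_map X : rhom (induced A X) (induced B X) :=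
  @RHom K (induced A X) (induced B X) (crystal_map_at X) (@crystal_map_step X).

Definition crystal_map_nat : nat_trans (induced_functor A) (induced_functor B).
Proof.
refine (@NatTrans (rep_category K) (rep_category K) (induced_functor A)
    (induced_functor B) crystal_map _).
abstract (move=> X Y h; apply: rhom_eq => q; apply: gen_ext => x v vx;
  rewrite /= !comp_lfunE induced_map_gen !crystal_map_gen //;
  by case: (hom_label f x) => [y|] /=; rewrite ?induced_map_gen ?zero_lfunE ?linear0).
Defined.

End Morphism.

Lemma hom_label_id (A : crystal) x : hom_label (crystal_idm A) x = Some x.
Proof. by rewrite /hom_label /= -surjective_pairing. Qed.

Lemma hom_label_cmp (A B C : crystal) (g : crystal_hom B C) (f : crystal_hom A B) x :
  hom_label (crystal_cmp g f) x = obind (hom_label g) (hom_label f x).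
Proof. by rewrite /hom_label /=; case: (f x.1). Qed.

Definition crystal_action : functor Crystals (End (rep_category K)).
Proof.
refine (@Functor Crystals (End (rep_category K)) induced_functor crystal_map_nat _ _).
- abstract (move=> A; apply: nat_trans_eq => X; apply: rhom_eq => q;
    apply: gen_ext => x v vx; by rewrite /= crystal_map_gen // hom_label_id id_lfunE).
- abstract (move=> A B C g f; apply: nat_trans_eq => X; apply: rhom_eq => q;
    apply: gen_ext => x v vx; rewrite /= comp_lfunE !crystal_map_gen // hom_label_cmp;
    case E: (hom_label f x) => [y|] /=; last (by rewrite !zero_lfunE ?linear0);
    have [e1 e2] := hom_labelP q E; by rewrite crystal_map_gen ?e1 ?e2).
Defined.

End CrystalFunctor.
#[global] Arguments induced : simpl never.

(** * The monoidal structure *)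

Section Monoidal.
Variable K : fieldType.
Implicit Types (X Y : rep K) (q : vertex).

Lemma induced_mapE B X Y (h : rhom X Y) q v : induced_map B h q v =
    induced_map_at B h q v.
Proof. by []. Qed.

Section Tensor.
Variables A B : crystal.
Let AB := ten_crystal A B.
Implicit Types (x : A * nat) (y : B * nat).

(** The matching of summands, made into a linear map. *)
Definition ten_at X q : 'Hom(induced_space A (induced B X) q, induced_space AB X q) :=
  glift (X := induced B X) (fun x => glift (X := X) (q := source q x) (fun y =>
    gen X q (comp_label q x y) (source (source q x) y))).

Definition split_at X q : 'Hom(induced_space AB X q, induced_space A (induced B X) q) :=
  glift (fun z : AB * nat =>
    gen (induced B X) q (split_label1 q z) (source q (split_label1 q z)) \o
    gen X (source q (split_label1 q z)) (split_label2 q z) (source q z))%VF.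

Lemma ten_gen X q x q1 y q2 v : q1 = source q x -> q2 = source q1 y ->
  valid_label q x -> valid_label q1 y ->
  ten_at X q (gen (induced B X) q x q1 (gen X q1 y q2 v)) =
  gen X q (comp_label q x y) q2 v.
Proof.
by move=> e1 e2; subst q2; subst q1 => vx vy; rewrite /ten_at !glift_gen.
Qed.

Lemma split_gen X q x y q2 v : q2 = source (source q x) y ->
  valid_label q x -> valid_label (source q x) y ->
  split_at X q (gen X q (comp_label q x y) q2 v) =
  gen (induced B X) q x (source q x) (gen X (source q x) y q2 v).
Proof.
move=> e2 vx vy.
have [vz ez] := comp_labelP vx vy; have [h1 h2] := comp_labelK vx vy.
move: v; rewrite {}e2 -ez => v.
by rewrite /split_at glift_gen // comp_lfunE h1 h2.
Qed.

(** Generators of a twofold sum are generators inside generators. *)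
Lemma gen2_ext X q (W : vectType K) (f g : 'Hom(induced_space A (induced B X) q, W)) :
  (forall x y (q1 := source q x) (q2 := source q1 y) v, valid_label q x ->
      valid_label q1 y ->
    f (gen (induced B X) q x q1 (gen X q1 y q2 v)) =
    g (gen (induced B X) q x q1 (gen X q1 y q2 v))) -> f =1 g.
Proof.
move=> fg; apply: gen_ext => x w vx; pose q1 := source q x.
suff /(_ w) : (f \o gen (induced B X) q x q1)%VF =1 (g \o gen (induced B X) q x q1)%VF.
  by rewrite !comp_lfunE.
by apply: gen_ext => y v vy; rewrite !comp_lfunE; apply: fg.
Qed.

(** Every label of the tensor product comes from a composite, by
    [split_labelP]. *)
Lemma comp_gen_ext X q (W : vectType K) (f g : 'Hom(induced_space AB X q, W)) :
  (forall x y (q1 := source q x) (q2 := source q1 y) v, valid_label q x ->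
      valid_label q1 y ->
    f (gen X q (comp_label q x y) q2 v) = g (gen X q (comp_label q x y) q2 v)) ->
  f =1 g.
Proof.
move=> fg; apply: gen_ext => z v vz; have [vx vy ez] := split_labelP vz.
by move: v; rewrite -ez (comp_labelP vx vy).2 => v; exact: fg.
Qed.

(** The matching respects var and can because it keeps the piece number of the
    factor on which var and can act. *)
Lemma ten_step X q (v : induced A (induced B X) q) :
  ten_at X (next_vertex q) (rep_step (induced A (induced B X)) q v) =
      rep_step (induced AB X) q (ten_at X q v).
Proof.
suff /(_ v) : (ten_at X (next_vertex q) \o induced_step A (induced B X) q)%VF =1
   (induced_step AB X q \o ten_at X q)%VF by rewrite !comp_lfunE.
apply: gen2_ext => x y q1 q2 {}v vx vy; rewrite !comp_lfunE [in RHS]ten_gen //.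
have [vz ez] := comp_labelP vx vy; have wz := comp_hits_wall vx vy.
have [wx|wx] := boolP (hits_wall q.1.1 x.1).
  rewrite induced_step_wall // induced_step_wall //; last by rewrite wz wx.
  have e : comp_label (next_vertex q) (next_copy x) y = next_copy (comp_label q x y).
    exact: comp_label_next_copy_l.
  (* If there is no next piece, then both sides vanish. *)
  have [vx'|vx'] := boolP (valid_label (next_vertex q) (next_copy x)).
    by rewrite ten_gen ?source_next_copy // e.
  rewrite gen_invalid // linear0 gen_invalid // valid_next_copy ?wz ?wx //.
  by move: vx'; rewrite valid_next_copy //= wx.
rewrite induced_step_id //; have vx' := valid_next_vertex wx vx.
have lev1 : q1.1.1 = q.1.1 - cwt x.1 by exact: source_level.
rewrite induced_stepE; have [wy|wy] := boolP (hits_wall q1.1.1 y.1).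
  have wz' : hits_wall q.1.1 (comp_label q x y).1 by rewrite wz -lev1 wy orbT.
  rewrite induced_step_wall // induced_step_wall //.
  have e : comp_label (next_vertex q) x (next_copy y) = next_copy (comp_label q x y).
    by apply: (comp_label_next_copy_r wx vx vy); rewrite -lev1.
  have [vy'|vy'] := boolP (valid_label (next_vertex q1) (next_copy y)).
    by rewrite ten_gen ?source_next_copy ?source_next_vertex // e.
  rewrite [gen X (next_vertex q1) _ _ _]gen_invalid // !linear0 gen_invalid // -e.
  have [vz'|//] := boolP (valid_label _ _).
  move: vz'; rewrite e valid_next_copy //= (negbTE wx) => /andP[d2 _].
  move: vy'; rewrite valid_next_copy // d2 /= lev1 negbK; move: wx.
  by rewrite /hits_wall; have := ceps_ge0 x.1; lia.
rewrite induced_step_id // induced_step_id //; last by rewrite wz -lev1 negb_or wx.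
by rewrite ten_gen ?source_next_vertex //; exact: valid_next_vertex.
Qed.

Lemma tenK X q v : split_at X q (ten_at X q v) = v.
Proof.
suff /(_ v) : (split_at X q \o ten_at X q)%VF =1 \1%VF by rewrite comp_lfunE id_lfunE.
apply: gen2_ext => x y q1 q2 {}v vx vy.
by rewrite comp_lfunE id_lfunE ten_gen // split_gen.
Qed.

Lemma splitK X q v : ten_at X q (split_at X q v) = v.
Proof.
suff /(_ v) : (ten_at X q \o split_at X q)%VF =1 \1%VF by rewrite comp_lfunE id_lfunE.
apply: comp_gen_ext => x y q1 q2 {}v vx vy.
by rewrite comp_lfunE id_lfunE split_gen // ten_gen.
Qed.

Definition ten_map X : rhom (induced A (induced B X)) (induced AB X) :=
  @RHom K (induced A (induced B X)) (induced AB X) (ten_at X) (@ten_step X).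

Lemma ten_mapE X q v : ten_map X q v = ten_at X q v. Proof. by []. Qed.

Lemma split_step X q (v : induced AB X q) :
  split_at X (next_vertex q) (rep_step (induced AB X) q v) =
  rep_step (induced A (induced B X)) q (split_at X q v).
Proof. by rewrite -{1}[v]splitK -[rep_step (induced AB X) _ _]ten_step tenK. Qed.

Definition split_map X : rhom (induced AB X) (induced A (induced B X)) :=
  @RHom K (induced AB X) (induced A (induced B X)) (split_at X) (@split_step X).

Lemma ten_natural X Y (h : rhom X Y) q v :
  ten_at Y q (induced_map_at A (induced_map B h) q v) =
      induced_map_at AB h q (ten_at X q v).
Proof.
suff /(_ v) : (ten_at Y q \o induced_map_at A (induced_map B h) q)%VF =1
   (induced_map_at AB h q \o ten_at X q)%VF by rewrite !comp_lfunE.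
apply: gen2_ext => x y q1 q2 {}v vx vy.
by rewrite !comp_lfunE induced_map_gen induced_mapE induced_map_gen !ten_gen //
    induced_map_gen.
Qed.

Definition ten_nat : nat_trans (functor_comp (induced_functor K A) (induced_functor K
    B))
  (induced_functor K AB).
Proof.
refine (@NatTrans (rep_category K) (rep_category K)
  (functor_comp (induced_functor K A) (induced_functor K B)) (induced_functor K AB)
      ten_map _).
abstract (move=> X Y h; apply: rhom_eq => q v; rewrite /= !comp_lfunE;
    exact: ten_natural).
Defined.

Definition split_nat : nat_trans (induced_functor K AB)
  (functor_comp (induced_functor K A) (induced_functor K B)).
Proof.
refine (@NatTrans (rep_category K) (rep_category K) (induced_functor K AB)
  (functor_comp (induced_functor K A) (induced_functor K B)) split_map _).
abstract (move=> X Y h; apply: rhom_eq => q v; rewrite /= !comp_lfunE;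
  rewrite -{1}[v]splitK; by have /= <- := ten_natural h (split_at X q v); rewrite tenK).
Defined.

Definition ten_iso : iso (mten (crystal_action K A) (crystal_action K B))
    (crystal_action K AB).
Proof.
refine (@nt_iso (rep_category K) (functor_comp (induced_functor K A) (induced_functor K
    B)) (induced_functor K AB)
  ten_nat split_nat _ _).
- abstract (by move=> X; apply: rhom_eq => q v; rewrite /= comp_lfunE id_lfunE tenK).
- abstract (by move=> X; apply: rhom_eq => q v; rewrite /= comp_lfunE id_lfunE splitK).
Defined.

End Tensor.

Section Unit.
Let I0 := Bcrystal 0.

Definition unit_at X q : 'Hom(X q, induced_space I0 X q) := gen X q unit_label q.
Definition counit_at X q : 'Hom(induced_space I0 X q, X q) := glift (fun x =>
    recast X (source q x) q).

(** At level 0 the unit summand is a wall summand without var and can, and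
    there X has no Psi. *)
Lemma unit_step X q (v : X q) :
  unit_at X (next_vertex q) (rep_step X q v) =
      rep_step (induced I0 X) q (unit_at X q v).
Proof.
have [gq|gq] := boolP (admissible q); last by rewrite [v]rep_not_admissible // !linear0.
rewrite /unit_at /=; have vq := unit_valid gq; have sq := unit_source gq.
have [w|w] := boolP (hits_wall q.1.1 unit_label.1); last by rewrite induced_step_id.
rewrite induced_step_wall // [rep_step X q v]rep_not_admissible ?linear0.
  by rewrite gen_invalid // valid_next_copy //; move: w gq;
      rewrite /hits_wall /= /Bwt /Beps /admissible /=; lia.
move: vq w; rewrite /valid_label /admissible => /and3P[h1 _ _]; move: h1.
by rewrite /hits_wall /= /Bwt /Beps /=; case: q {v sq gq} => [[l p] i] /=; lia.
Qed.

Lemma counit_gen X q x q' v : q' = source q x -> valid_label q x ->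
  counit_at X q (gen X q x q' v) = recast X q' q v.
Proof. by move=> e vx; subst q'; rewrite /counit_at glift_gen. Qed.

Lemma unitK X q v : counit_at X q (unit_at X q v) = v.
Proof.
have [gq|gq] := boolP (admissible q);
    last by rewrite [LHS](rep_not_admissible gq) [RHS](rep_not_admissible gq).
by rewrite /unit_at counit_gen ?unit_source ?unit_valid // recast_id.
Qed.

Lemma counitK X q v : unit_at X q (counit_at X q v) = v.
Proof.
suff /(_ v) : (unit_at X q \o counit_at X q)%VF =1 \1%VF by rewrite comp_lfunE id_lfunE.
apply: gen_ext => x {}v vx; rewrite comp_lfunE id_lfunE.
have gq : admissible q by case/and3P: vx.
move: v; rewrite (unit_labelP vx) (unit_source gq) => v.
by rewrite counit_gen ?unit_source ?unit_valid // recast_id.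
Qed.

Definition unit_map X : rhom X (induced I0 X) :=
  @RHom K X (induced I0 X) (unit_at X) (@unit_step X).

Lemma counit_step X q (v : induced I0 X q) :
  counit_at X (next_vertex q) (rep_step (induced I0 X) q v) =
      rep_step X q (counit_at X q v).
Proof. by rewrite -{1}[v]counitK -[rep_step (induced I0 X) _ _]unit_step unitK. Qed.

Definition counit_map X : rhom (induced I0 X) X :=
  @RHom K (induced I0 X) X (counit_at X) (@counit_step X).

Definition unit_nat : nat_trans (functor_id (rep_category K)) (induced_functor K I0).
Proof.
refine (@NatTrans (rep_category K) (rep_category K) (functor_id _) (induced_functor K
    I0) unit_map _).
abstract (by move=> X Y h; apply: rhom_eq => q v;
  rewrite /= !comp_lfunE /= /unit_at induced_map_gen).
Defined.

Definition counit_nat : nat_trans (induced_functor K I0) (functor_id (rep_category K)).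
Proof.
refine (@NatTrans (rep_category K) (rep_category K) (induced_functor K I0) (functor_id
    _) counit_map _).
abstract (move=> X Y h; apply: rhom_eq => q v; rewrite /= !comp_lfunE /=;
  by rewrite -{1}[v]counitK /unit_at induced_map_gen unitK).
Defined.

Definition unit_iso : iso (munit : End (rep_category K)) (crystal_action K I0).
Proof.
refine (@nt_iso (rep_category K) (functor_id _) (induced_functor K I0) unit_nat
    counit_nat _ _).
- abstract (by move=> X; apply: rhom_eq => q v; rewrite /= comp_lfunE id_lfunE unitK).
- abstract (by move=> X; apply: rhom_eq => q v; rewrite /= comp_lfunE id_lfunE counitK).
Defined.

End Unit.

Section Laws.

Definition assoc_hom (A B C : crystal) :
  crystal_hom (ten_crystal (ten_crystal A B) C) (ten_crystal A (ten_crystal B C)) :=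
  iso_hom (ten_assoc A B C).
Definition lunit_hom (A : crystal) : crystal_hom (ten_crystal (Bcrystal 0) A) A :=
  iso_hom (ten_lunit A).
Definition runit_hom (A : crystal) : crystal_hom (ten_crystal A (Bcrystal 0)) A :=
  iso_hom (ten_runit A).

Lemma ten_hom_natural (A A' B B' : crystal) (f : crystal_hom A A')
    (g : crystal_hom B B') X q v :
  ten_at A' B' X q (induced_map_at A' (crystal_map g X) q
    (crystal_map_at f (induced B X) q v)) =
  crystal_map_at (ten_hom f g) X q (ten_at A B X q v).
Proof.
suff /(_ v) : (ten_at A' B' X q \o (induced_map_at A' (crystal_map g X) q \o
    crystal_map_at f (induced B X) q))%VF
  =1 (crystal_map_at (ten_hom f g) X q \o ten_at A B X q)%VF by rewrite !comp_lfunE.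
apply: gen2_ext => x y q1 q2 {}v vx vy.
have [vz ez] := comp_labelP vx vy.
rewrite !comp_lfunE ten_gen // !crystal_map_gen // hom_comp_label //.
case E: (hom_label f x) => [x'|]; last by rewrite !zero_lfunE !linear0.
have [e1 e2] := hom_labelP q E.
rewrite [gen_opt (induced B X) _ _ _]/gen_opt [obind _ _]/= induced_map_gen
    crystal_map_gen //.
case E': (hom_label g y) => [y'|]; last by rewrite !zero_lfunE !linear0.
have [e1' e2'] := hom_labelP q1 E'.
by rewrite [omap _ _]/= /gen_opt ten_gen ?e1 ?e2 ?e1' ?e2'.
Qed.

Lemma ten_assoc_eq (A B C : crystal) X q v :
  crystal_map_at (assoc_hom A B C) X q
    (ten_at (ten_crystal A B) C X q (ten_at A B (induced C X) q v)) =
  ten_at A (ten_crystal B C) X q (induced_map_at A (ten_map B C X) q v).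
Proof.
suff /(_ v) : (crystal_map_at (assoc_hom A B C) X q \o
    (ten_at (ten_crystal A B) C X q \o ten_at A B (induced C X) q))%VF =1
   (ten_at A (ten_crystal B C) X q \o induced_map_at A (ten_map B C X) q)%VF.
  by rewrite !comp_lfunE.
apply: gen_ext => x w vx; pose q1 := source q x.
suff /(_ w) : (crystal_map_at (assoc_hom A B C) X q \o
    (ten_at (ten_crystal A B) C X q \o ten_at A B (induced C X) q) \o
     gen (induced B (induced C X)) q x q1)%VF =1
   (ten_at A (ten_crystal B C) X q \o induced_map_at A (ten_map B C X) q \o
     gen (induced B (induced C X)) q x q1)%VF.
  by rewrite !comp_lfunE.
apply: gen2_ext => y z q2 q3 {w} v vy vz.
have [vxy exy] := comp_labelP vx vy; have [vyz eyz] := comp_labelP vy vz.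
have vz' : valid_label (source q (comp_label q x y)) z by rewrite exy.
have [vxyz exyz] := comp_labelP vxy vz'.
rewrite !comp_lfunE ten_gen // ten_gen ?exy //.
rewrite induced_map_gen ten_mapE ten_gen // ten_gen // crystal_map_gen ?exyz ?exy //.
by rewrite /= -(comp_labelA vx vy vz).
Qed.

Lemma ten_lunit_eq (A : crystal) X q v :
  crystal_map_at (lunit_hom A) X q (ten_at (Bcrystal 0) A X q (unit_at (induced A X) q
      v)) = v.
Proof.
suff /(_ v) : (crystal_map_at (lunit_hom A) X q \o
  (ten_at (Bcrystal 0) A X q \o unit_at (induced A X) q))%VF =1 \1%VF.
  by rewrite !comp_lfunE id_lfunE.
apply: gen_ext => x {}v vx; rewrite !comp_lfunE id_lfunE /unit_at.
have gq : admissible q by case/and3P: vx.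
have vu := unit_valid gq; have su := unit_source gq.
have vx' : valid_label (source q unit_label) x by rewrite su.
have [vz ez] := comp_labelP vu vx'.
rewrite ten_gen // crystal_map_gen //; last by rewrite ez su.
by rewrite comp_unit_l // /hom_label /= -surjective_pairing.
Qed.

Lemma ten_runit_eq (A : crystal) X q v :
  crystal_map_at (runit_hom A) X q (ten_at A (Bcrystal 0) X q (induced_map_at A
      (unit_map X) q v)) = v.
Proof.
suff /(_ v) : (crystal_map_at (runit_hom A) X q \o
  (ten_at A (Bcrystal 0) X q \o induced_map_at A (unit_map X) q))%VF =1 \1%VF.
  by rewrite !comp_lfunE id_lfunE.
apply: gen_ext => x {}v vx; rewrite !comp_lfunE id_lfunE induced_map_gen /= /unit_at.
have gq := admissible_source vx.
have vu := unit_valid gq; have su := unit_source gq.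
have [vz ez] := comp_labelP vx vu.
rewrite ten_gen ?su // crystal_map_gen //; last by rewrite ez su.
by rewrite comp_unit_r // /hom_label /= -surjective_pairing.
Qed.

End Laws.

Lemma induced_map_id B X : induced_map B (rhom_id X) = rhom_id (induced B X).
Proof. exact: (fmap1 (induced_functor K B)). Qed.

Definition rep_action : monoidal_functor Crystals (End (rep_category K)).
Proof.
refine (@MonoidalFunctor Crystals (End (rep_category K)) (crystal_action K) unit_iso
  (fun A B => ten_iso A B) _ _ _ _).
- abstract (move=> A A' B B' f g; apply: nat_trans_eq => X; apply: rhom_eq => q v;
    rewrite /= !comp_lfunE; exact: ten_hom_natural).
- abstract (move=> A B E; apply: nat_trans_eq => X; rewrite /= induced_map_id;
    apply: rhom_eq => q v; rewrite /= !comp_lfunE !id_lfunE; exact: ten_assoc_eq).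
- abstract (move=> A; apply: nat_trans_eq => X; rewrite /= induced_map_id;
    apply: rhom_eq => q v; rewrite /= !comp_lfunE !id_lfunE; exact: ten_lunit_eq).
- abstract (move=> A; apply: nat_trans_eq => X; apply: rhom_eq => q v;
    rewrite /= !comp_lfunE !id_lfunE; exact: ten_runit_eq).
Defined.

End Monoidal.

(** * Transport of a monoidal action along an equivalence *)

Section Transport.
Variables (C D : category) (E : functor C D) (G : functor D C).
Variables (u : forall X : C, iso X (G (E X))) (c : forall Y : D, iso (E (G Y)) Y).
Hypothesis u_natural : forall X X' (f : hom X X'),
  u X' \oc f = fmap G (fmap E f) \oc u X.
Hypothesis c_natural : forall Y Y' (f : hom Y Y'),
  c Y' \oc fmap E (fmap G f) = f \oc c Y.
Hypothesis c_E : forall X, c (E X) \oc fmap E (u X) = idm (E X).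
Hypothesis G_c : forall Y, fmap G (c Y) \oc u (G Y) = idm (G Y).
Variables (M : monoidal_category) (N : monoidal_functor M (End D)).

Let N0 (A : M) : functor D D := mfun N A.
Let N1 (A B : M) (f : hom A B) : nat_trans (N0 A) (N0 B) := fmap (mfun N) f.

(** The endofunctor H of D, seen on C through the equivalence. *)
Definition conj_obj (H : functor D D) : functor C C :=
    functor_comp G (functor_comp H E).

Definition conj_map (H H' : functor D D) (a : nat_trans H H') :
  nat_trans (conj_obj H) (conj_obj H').
Proof.
refine (@NatTrans C C (conj_obj H) (conj_obj H') (fun X => fmap G (a (E X))) _).
abstract (by move=> X Y f /=; rewrite -!fmapM nt_natural).
Defined.

Definition conj_functor : functor M (End C).
Proof.
refine (@Functor M (End C) (fun A => conj_obj (N0 A)) (fun A B f =>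
    conj_map (N1 f)) _ _).
- abstract (by move=> A; apply: nat_trans_eq => X; rewrite /= /N1 fmap1 /= fmap1).
- abstract (by move=> A B B' g f; apply: nat_trans_eq => X;
    rewrite /= /N1 fmapM /= fmapM).
Defined.

Let ten (A B : M) : nat_trans (functor_comp (N0 A) (N0 B)) (N0 (mten A B)) :=
  iso_hom (mf_ten N A B).
Let ten_inv (A B : M) : nat_trans (N0 (mten A B)) (functor_comp (N0 A) (N0 B)) :=
  iso_inv (mf_ten N A B).

Lemma tenK_at A B Y : ten_inv A B Y \oc ten A B Y = idm _.
Proof. exact: (congr1 (fun t : nat_trans _ _ => t Y) (iso_invK (mf_ten N A B))). Qed.
Lemma ten_invK_at A B Y : ten A B Y \oc ten_inv A B Y = idm _.
Proof. exact: (congr1 (fun t : nat_trans _ _ => t Y) (iso_homK (mf_ten N A B))). Qed.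

Lemma c_inv_natural Y Y' (f : hom Y Y') :
  iso_inv (c Y') \oc f = fmap E (fmap G f) \oc iso_inv (c Y).
Proof.
rewrite -[LHS]cmpm1 -(iso_homK (c Y)) !cmpA -(cmpA _ f) -c_natural.
by rewrite !cmpA iso_invK cmp1m.
Qed.

Lemma u_inv_natural X X' (f : hom X X') :
  iso_inv (u X') \oc fmap G (fmap E f) = f \oc iso_inv (u X).
Proof.
rewrite -[LHS]cmpm1 -(iso_homK (u X)) !cmpA -(cmpA _ (fmap G _)) -u_natural.
by rewrite !cmpA iso_invK cmp1m.
Qed.

(** The tensor structure of N is preceded by the comparison c, which removes E
    after G in the middle of the composite. *)
Definition conj_ten_hom A B : nat_trans
  (functor_comp (conj_obj (N0 A)) (conj_obj (N0 B))) (conj_obj (N0 (mten A B))).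
Proof.
refine (@NatTrans C C (functor_comp (conj_obj (N0 A)) (conj_obj (N0 B)))
  (conj_obj (N0 (mten A B)))
  (fun X => fmap G (ten A B (E X) \oc fmap (N0 A) (c (N0 B (E X))))) _).
abstract (by move=> X X' f /=; rewrite -!fmapM; congr (fmap G _);
  rewrite -cmpA -fmapM c_natural fmapM !cmpA; congr (_ \oc _);
      exact: (nt_natural (ten A B) (fmap E f))).
Defined.

Definition conj_ten_inv A B : nat_trans (conj_obj (N0 (mten A B)))
  (functor_comp (conj_obj (N0 A)) (conj_obj (N0 B))).
Proof.
refine (@NatTrans C C (conj_obj (N0 (mten A B)))
  (functor_comp (conj_obj (N0 A)) (conj_obj (N0 B)))
  (fun X => fmap G (fmap (N0 A) (iso_inv (c (N0 B (E X)))) \oc ten_inv A B (E X))) _).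
abstract (move=> X X' f /=; rewrite -!fmapM; congr (fmap G _);
  rewrite !cmpA -fmapM -c_inv_natural fmapM -!cmpA; congr (_ \oc _);
  exact: (nt_natural (ten_inv A B) (fmap E f))).
Defined.

Definition conj_ten A B : iso (mten (conj_functor A) (conj_functor B))
  (conj_functor (mten A B)).
Proof.
refine (@nt_iso C (functor_comp (conj_obj (N0 A)) (conj_obj (N0 B)))
  (conj_obj (N0 (mten A B))) (conj_ten_hom A B) (conj_ten_inv A B) _ _).
- abstract (move=> X /=; rewrite -fmapM -!cmpA (cmpA _ (ten A B _)) tenK_at cmp1m;
    by rewrite -fmapM iso_invK fmap1 fmap1).
- abstract (move=> X /=; rewrite -fmapM -!cmpA (cmpA (fmap _ _)) -fmapM iso_homK;
    by rewrite fmap1 cmp1m ten_invK_at fmap1).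
Defined.

Let un : nat_trans (functor_id D) (N0 munit) := iso_hom (mf_unit N).
Let un_inv : nat_trans (N0 munit) (functor_id D) := iso_inv (mf_unit N).
Lemma unK_at Y : un_inv Y \oc un Y = idm Y.
Proof. exact: (congr1 (fun t : nat_trans _ _ => t Y) (iso_invK (mf_unit N))). Qed.
Lemma un_invK_at Y : un Y \oc un_inv Y = idm _.
Proof. exact: (congr1 (fun t : nat_trans _ _ => t Y) (iso_homK (mf_unit N))). Qed.

Definition conj_unit_hom : nat_trans (functor_id C) (conj_obj (N0 munit)).
Proof.
refine (@NatTrans C C (functor_id C) (conj_obj (N0 munit))
  (fun X => fmap G (un (E X)) \oc u X) _).
abstract (by move=> X X' f /=; rewrite -cmpA u_natural !cmpA -!fmapM
  -(nt_natural un (fmap E f))).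
Defined.

Definition conj_unit_inv : nat_trans (conj_obj (N0 munit)) (functor_id C).
Proof.
refine (@NatTrans C C (conj_obj (N0 munit)) (functor_id C)
  (fun X => iso_inv (u X) \oc fmap G (un_inv (E X))) _).
abstract (by move=> X X' f /=; rewrite !cmpA -u_inv_natural -!cmpA -!fmapM
  (nt_natural un_inv (fmap E f))).
Defined.

Definition conj_unit : iso (munit : End C) (conj_functor munit).
Proof.
refine (@nt_iso C (functor_id C) (conj_obj (N0 munit)) conj_unit_hom conj_unit_inv _ _).
- abstract (by move=> X /=; rewrite -!cmpA (cmpA (fmap G _) (fmap G _)) -fmapM
    unK_at fmap1 cmp1m iso_invK).
- abstract (by move=> X /=; rewrite -!cmpA (cmpA (iso_hom _) (iso_inv _)) iso_homK cmp1m
    -fmapM un_invK_at fmap1).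
Defined.

Lemma ten_nt A B Y Y' (h : hom Y Y') :
  ten A B Y' \oc fmap (N0 A) (fmap (N0 B) h) = fmap (N0 (mten A B)) h \oc ten A B Y.
Proof. exact: (nt_natural (ten A B) h). Qed.

Lemma ten_natural_at A A' B B' (f : hom A A') (g : hom B B') Y :
  ten A' B' Y \oc (fmap (N0 A') (N1 g Y) \oc N1 f (N0 B Y)) =
  N1 (mtenm f g) Y \oc ten A B Y.
Proof. exact: (congr1 (fun t : nat_trans _ _ => t Y) (mf_ten_natural N f g)). Qed.

Lemma mf_assoc_at A B B' Y :
  N1 (massoc A B B') Y \oc (ten (mten A B) B' Y \oc ten A B (N0 B' Y)) =
  ten A (mten B B') Y \oc fmap (N0 A) (ten B B' Y).
Proof.
have := congr1 (fun t : nat_trans _ _ => t Y) (mf_assoc N A B B').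
by rewrite /= fmap1 cmp1m !cmpm1 => <-; rewrite cmpA.
Qed.

Lemma mf_lunit_at A Y :
  N1 (mlunit A) Y \oc (ten munit A Y \oc un (N0 A Y)) = idm _.
Proof.
have := congr1 (fun t : nat_trans _ _ => t Y) (mf_lunit N A).
by rewrite /= fmap1 cmp1m => <-; rewrite cmpA.
Qed.

Lemma mf_runit_at A Y :
  N1 (mrunit A) Y \oc (ten A munit Y \oc fmap (N0 A) (un Y)) = idm _.
Proof.
have := congr1 (fun t : nat_trans _ _ => t Y) (mf_runit N A).
by rewrite /= cmpm1 => <-; rewrite cmpA.
Qed.

(** The laws for N carry over by naturality of c and u; associativity uses
    that alone, and each of the two unit laws uses one of the triangle
    identities [G_c] and [c_E]. *)
Definition conj_monoidal : monoidal_functor M (End C).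
Proof.
refine (@MonoidalFunctor M (End C) conj_functor conj_unit conj_ten _ _ _ _).
- abstract (move=> A A' B B' f g; apply: nat_trans_eq => X /=;
    rewrite -!fmapM !cmpA -ten_natural_at -!cmpA; congr (fmap G (_ \oc _));
    rewrite cmpA -fmapM c_natural fmapM -!cmpA; congr (_ \oc _); exact/esym/nt_natural).
- abstract (move=> A B B'; apply: nat_trans_eq => X /=;
    rewrite !fmap1 !cmpm1 !cmp1m -!fmapM -!cmpA; congr (fmap G _);
    rewrite (cmpA (fmap (N0 (mten A B)) _)) -ten_nt -!cmpA -!fmapM;
    rewrite c_natural !cmpA -(cmpA (N1 _ _)); by rewrite mf_assoc_at -!cmpA -!fmapM).
- abstract (move=> A; apply: nat_trans_eq => X /=;
    rewrite !fmap1 cmp1m -!cmpA (cmpA (fmap G _) (fmap G (un _))) -!fmapM;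
    rewrite -!cmpA -(nt_natural un) !cmpA -!fmapM -!cmpA;
    rewrite /= !cmpA -(cmpA (N1 _ _)) mf_lunit_at cmp1m; exact: G_c).
- abstract (move=> A; apply: nat_trans_eq => X /=;
    rewrite cmpm1 -!fmapM -!cmpA -!fmapM (fmapM E) (cmpA (iso_hom _)) c_natural -cmpA
        c_E cmpm1;
    by rewrite mf_runit_at fmap1).
Defined.

End Transport.

(** * Graded category O as a category of representations *)

Section Equivalence.
Variable K : fieldType.
Local Notation OZ := (OZ K).
Local Notation RC := (rep_category K).

Definition int_box (N : nat) : seq int :=
  map Posz (iota 0 N.+1) ++ map Negz (iota 0 N).

Lemma mem_int_box N i : (i \in int_box N) = (`|i| <= N%:Z).
Proof.
have Pi : injective Posz by move=> a b [].
have Ni : injective Negz by move=> a b [].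
rewrite mem_cat; case: i => n.
  rewrite (mem_map Pi) mem_iota [X in _ || X](_ : _ = false); first by lia.
  by apply/negbTE/mapP => -[].
rewrite [X in X || _](_ : _ = false); last by apply/negbTE/mapP => -[].
by rewrite (mem_map Ni) mem_iota; lia.
Qed.

Section FromRep.

Lemma slice_fin (X : rep K) (l : int) (p : bool) : exists s : seq int,
  forall i, i \notin s -> forall v : X (l, p, i), v = 0.
Proof.
have [N XN] := rep_finite X; exists (int_box N) => i; rewrite mem_int_box => iN.
by apply: XN; rewrite /far_vertex /=; lia.
Qed.

Definition slice (X : rep K) (l : int) (p : bool) : Vect K :=
  GVect (slice_fin X l p) : Vect K.

Definition slice_var (X : rep K) (l : int) :
  hom (slice X l true) (shift K (-1) (slice X l false)) :=
  fun i => rep_step X (l, true, i).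
Definition slice_can (X : rep K) (l : int) :
  hom (slice X l false) (shift K (-1) (slice X l true)) :=
  fun i => rep_step X (l, false, i).

Lemma slice_var_can (X : rep K) (l : int) :
  fmap (shift K (-1)) (slice_var X l) \oc slice_can X l = g0 _ _.
Proof.
by apply: gvect_hom_eq => i v; rewrite /= comp_lfunE zero_lfunE;
  apply: (@rep_step2 K X (l, false, i)).
Qed.

Definition level (X : rep K) (k : nat) : O0 K := O0Obj (slice_var_can X k.+1).

Lemma level_fin (X : rep K) : exists N : nat,
  forall k, (N <= k)%N -> zero_object (level X k).
Proof.
have [N XN] := rep_finite X; exists N => k Nk; apply/O0_zeroP => i.
by split=> v; apply: XN; rewrite /far_vertex /=; lia.
Qed.

Definition rep_to_OZ_obj (X : rep K) : OZ := (slice X 0 true, Family (level_fin X)).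

Definition level_hom (X Y : rep K) (f : rhom X Y) (k : nat) :
  @hom (O0 K) (level X k) (level Y k).
Proof.
refine (@O0Hom K (level X k) (level Y k) (fun i => f (k.+1%:Z, false, i))
  (fun i => f (k.+1%:Z, true, i)) _ _).
- abstract (apply: gvect_hom_eq => i v; rewrite /= !comp_lfunE;
    exact: (@rhom_step K X Y f (k.+1%:Z, true, i))).
- abstract (apply: gvect_hom_eq => i v; rewrite /= !comp_lfunE;
    exact: (@rhom_step K X Y f (k.+1%:Z, false, i))).
Defined.

Definition rep_to_OZ : functor RC OZ.
Proof.
refine (@Functor RC OZ rep_to_OZ_obj
  (fun X Y f => (fun i => f (0, true, i), level_hom f)) _ _).
- abstract (move=> X; congr pair; apply: functional_extensionality_dep => k;
    exact: O0_hom_eq).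
- abstract (move=> X Y Z g f; congr pair; apply: functional_extensionality_dep => k;
    exact: O0_hom_eq).
Defined.

End FromRep.

Section ToRep.

Definition OZ_space (X : OZ) (q : vertex) : vectType K :=
  match q with
  | (Posz 0, true, i) => gsp X.1 i
  | (Posz k.+1, true, i) => gsp (Phi (X.2 k)) i
  | (Posz k.+1, false, i) => gsp (Psi (X.2 k)) i
  | _ => 'rV[K]_0
  end.

Definition OZ_step (X : OZ) (q : vertex) : 'Hom(OZ_space X q, OZ_space X (next_vertex
    q)) :=
  match q return 'Hom(OZ_space X q, OZ_space X (next_vertex q)) with
  | (Posz k.+1, true, i) => ovar (X.2 k) i
  | (Posz k.+1, false, i) => ocan (X.2 k) i
  | _ => 0
  end.

Lemma OZ_step2 X q : ~~ q.1.2 -> forall v, OZ_step X (next_vertex q) (OZ_step X q v) =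
    0.
Proof.
case: q => [[[[|k]|k] [|]] i] //= _ v; rewrite ?lfunE //.
have := gvect_hom_at (var_can (X.2 k)) v.
by rewrite /= comp_lfunE lfunE.
Qed.

Lemma OZ_not_admissible X q : ~~ admissible q -> forall v : OZ_space X q, v = 0.
Proof. by case: q => [[[[|k]|k] [|]] i] //= _ v; exact: thinmx0. Qed.

Lemma gvect_bound (V : gvect K) : exists N : nat, forall i : int,
  N%:Z < `|i| -> forall v : V i, v = 0.
Proof.
have [s sV] := gfin V; exists (\max_(i <- s) absz i)%N => i Ni; apply: sV.
apply: contraL Ni => si; rewrite -leNgt.
have : (absz i <= \max_(i <- s) absz i)%N by rewrite (big_rem i) //= leq_maxl.
by move: (\max_(i <- s) _)%N => n; lia.
Qed.

(** Beyond finitely many levels an object of OZ vanishes, and on each of the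
    others it has bounded degrees. *)
Lemma OZ_finite X : exists N, forall q, far_vertex N q -> forall v : OZ_space X q, v =
    0.
Proof.
have [N XN] := fam_fin X.2; have [N0 h0] := gvect_bound X.1.
have [M hM] : exists M : nat, forall k, (k < N)%N -> forall i : int, M%:Z < `|i| ->
    (forall v : gsp (Psi (X.2 k)) i, v = 0) /\ (forall v : gsp (Phi (X.2 k)) i, v = 0).
  elim: (N) => [|n [M hM]]; first by exists 0%N.
  have [a ha] := gvect_bound (Psi (X.2 n)); have [b hb] := gvect_bound (Phi (X.2 n)).
  exists (M + a + b)%N => k; rewrite ltnS leq_eqVlt => /orP[/eqP->|kn] i ib.
    by split; [apply: ha; lia|apply: hb; lia].
  by apply: hM => //; lia.
exists (N + N0 + M)%N => q; rewrite /far_vertex.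
have Z k i : (N + N0 + M < k.+1)%N || ((N + N0 + M)%N%:Z < `|i|) ->
    (forall v : gsp (Psi (X.2 k)) i, v = 0) /\ (forall v : gsp (Phi (X.2 k)) i, v = 0).
  have [kN|kN] := ltnP k N; first by move=> h; apply: hM => //; lia.
  by move=> _; have /O0_zeroP := XN k kN.
case: q => [[[[|k]|k] [|]] i] //= h v; try exact: thinmx0.
- by apply: h0; lia.
- by apply: (Z k i _).2; lia.
- by apply: (Z k i _).1; lia.
Qed.

Definition OZ_to_rep_obj (X : OZ) : rep K :=
    Rep (@OZ_step2 X) (@OZ_not_admissible X) (OZ_finite X).

Definition OZ_space_map (X Y : OZ) (f : hom X Y) (q : vertex) : 'Hom(OZ_space X q,
    OZ_space Y q) :=
  match q return 'Hom(OZ_space X q, OZ_space Y q) with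
  | (Posz 0, true, i) => f.1 i
  | (Posz k.+1, true, i) => mPhi (f.2 k) i
  | (Posz k.+1, false, i) => mPsi (f.2 k) i
  | _ => 0
  end.

Lemma OZ_space_map_step (X Y : OZ) (f : hom X Y) q v :
  OZ_space_map f (next_vertex q) (OZ_step X q v) = OZ_step Y q (OZ_space_map f q v).
Proof.
case: q v => [[[[|k]|k] [|]] i] /= v; rewrite ?lfunE ?linear0 //=.
- by have := gvect_hom_at (m_var (f.2 k)) v; rewrite /= !comp_lfunE.
- by have := gvect_hom_at (m_can (f.2 k)) v; rewrite /= !comp_lfunE.
Qed.

Definition OZ_to_rep_map (X Y : OZ) (f : hom X Y) : rhom (OZ_to_rep_obj X)
    (OZ_to_rep_obj Y) :=
  @RHom K (OZ_to_rep_obj X) (OZ_to_rep_obj Y) (OZ_space_map f) (@OZ_space_map_step X Y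
      f).

Definition OZ_to_rep : functor OZ RC.
Proof.
refine (@Functor OZ RC OZ_to_rep_obj OZ_to_rep_map _ _).
- abstract (move=> X; apply: rhom_eq => -[[[[|k]|k] [|]] i] v //=;
    by rewrite [LHS]thinmx0 [RHS]thinmx0).
- abstract (move=> X Y Z g f; apply: rhom_eq => -[[[[|k]|k] [|]] i] v //=;
    by rewrite [LHS]thinmx0 [RHS]thinmx0).
Defined.

End ToRep.

Definition level_id (X : OZ) k : @O0_hom K (X.2 k) (level (OZ_to_rep_obj X) k).
Proof.
refine (@O0Hom K (X.2 k) (level (OZ_to_rep_obj X) k) (fun i => \1%VF) (fun i =>
    \1%VF) _ _).
- abstract (by apply: gvect_hom_eq => i v; rewrite /= !comp_lfunE !id_lfunE).
- abstract (by apply: gvect_hom_eq => i v; rewrite /= !comp_lfunE !id_lfunE).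
Defined.

Definition level_id_inv (X : OZ) k : @O0_hom K (level (OZ_to_rep_obj X) k) (X.2 k).
Proof.
refine (@O0Hom K (level (OZ_to_rep_obj X) k) (X.2 k) (fun i => \1%VF) (fun i =>
    \1%VF) _ _).
- abstract (by apply: gvect_hom_eq => i v; rewrite /= !comp_lfunE !id_lfunE).
- abstract (by apply: gvect_hom_eq => i v; rewrite /= !comp_lfunE !id_lfunE).
Defined.

Lemma OZ_hom_eq (X Y : OZ) (f g : hom X Y) :
  (forall i v, f.1 i v = g.1 i v) ->
  (forall k i v, mPsi (f.2 k) i v = mPsi (g.2 k) i v) ->
  (forall k i v, mPhi (f.2 k) i v = mPhi (g.2 k) i v) -> f = g.
Proof.
case: f g => [a b] [a' b'] /= h1 h2 h3; congr pair; first exact: gvect_hom_eq.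
by apply: functional_extensionality_dep => k; apply: O0_hom_eq; apply: gvect_hom_eq;
    [exact: h2|exact: h3].
Qed.

Definition OZ_rep_OZ (X : OZ) : iso X (rep_to_OZ (OZ_to_rep X)).
Proof.
refine (@Iso OZ X (rep_to_OZ (OZ_to_rep X)) (fun i => \1%VF, level_id X) (fun i =>
    \1%VF, level_id_inv X) _ _).
- abstract (by apply: OZ_hom_eq => *; rewrite /= comp_lfunE !id_lfunE).
- abstract (by apply: OZ_hom_eq => *; rewrite /= comp_lfunE !id_lfunE).
Defined.

Lemma OZ_rep_OZ_natural (X X' : OZ) (f : hom X X') :
  OZ_rep_OZ X' \oc f = fmap rep_to_OZ (fmap OZ_to_rep f) \oc OZ_rep_OZ X.
Proof. by apply: OZ_hom_eq => *; rewrite /= !comp_lfunE !id_lfunE. Qed.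

(** All spaces are the same on both sides, except where both vanish. *)
Definition rep_OZ_rep_at (Y : rep K) (q : vertex) : 'Hom(OZ_space (rep_to_OZ_obj Y) q,
    Y q) :=
  match q return 'Hom(OZ_space (rep_to_OZ_obj Y) q, Y q) with
  | (Posz 0, true, i) => \1%VF
  | (Posz k.+1, true, i) => \1%VF
  | (Posz k.+1, false, i) => \1%VF
  | _ => 0
  end.

Definition rep_OZ_rep_inv_at (Y : rep K) (q : vertex) : 'Hom(Y q, OZ_space
    (rep_to_OZ_obj Y) q) :=
  match q return 'Hom(Y q, OZ_space (rep_to_OZ_obj Y) q) with
  | (Posz 0, true, i) => \1%VF
  | (Posz k.+1, true, i) => \1%VF
  | (Posz k.+1, false, i) => \1%VF
  | _ => 0
  end.

Lemma rep_OZ_rep_step (Y : rep K) q (v : OZ_to_rep (rep_to_OZ Y) q) :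
  rep_OZ_rep_at Y (next_vertex q) (rep_step (OZ_to_rep (rep_to_OZ Y)) q v) =
      rep_step Y q (rep_OZ_rep_at Y q v).
Proof.
case: q v => [[[[|k]|k] [|]] i] /= v; rewrite ?id_lfunE ?lfunE ?linear0 //=.
by rewrite [RHS]rep_not_admissible.
Qed.

Lemma rep_OZ_rep_inv_step (Y : rep K) q (v : Y q) :
  rep_OZ_rep_inv_at Y (next_vertex q) (rep_step Y q v) =
      rep_step (OZ_to_rep (rep_to_OZ Y)) q (rep_OZ_rep_inv_at Y q v).
Proof.
case: q v => [[[[|k]|k] [|]] i] /= v; rewrite ?id_lfunE ?lfunE ?linear0 //=.
by rewrite [v]rep_not_admissible // linear0.
Qed.

Lemma rep_OZ_rep_atK Y q v : rep_OZ_rep_inv_at Y q (rep_OZ_rep_at Y q v) = v.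
Proof.
case: q v => [[[[|k]|k] [|]] i] /= v; rewrite ?id_lfunE //.
all: by rewrite [LHS]thinmx0 [RHS]thinmx0.
Qed.

Lemma rep_OZ_rep_inv_atK Y q v : rep_OZ_rep_at Y q (rep_OZ_rep_inv_at Y q v) = v.
Proof.
case: q v => [[[[|k]|k] [|]] i] /= v; rewrite ?id_lfunE //.
all: by rewrite [LHS]rep_not_admissible // [RHS]rep_not_admissible.
Qed.

Definition rep_OZ_rep (Y : RC) : iso (OZ_to_rep (rep_to_OZ Y)) Y.
Proof.
refine (@Iso RC (OZ_to_rep (rep_to_OZ Y)) Y (@RHom K (OZ_to_rep (rep_to_OZ Y)) Y
    (rep_OZ_rep_at Y) (@rep_OZ_rep_step Y))
  (@RHom K Y (OZ_to_rep (rep_to_OZ Y)) (rep_OZ_rep_inv_at Y) (@rep_OZ_rep_inv_step Y))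
      _ _).
- abstract (by apply: rhom_eq => q v; rewrite /= comp_lfunE id_lfunE;
    exact: rep_OZ_rep_atK).
- abstract (by apply: rhom_eq => q v; rewrite /= comp_lfunE id_lfunE;
    exact: rep_OZ_rep_inv_atK).
Defined.

Lemma rep_OZ_rep_natural (Y Y' : RC) (f : hom Y Y') :
  rep_OZ_rep Y' \oc fmap OZ_to_rep (fmap rep_to_OZ f) = f \oc rep_OZ_rep Y.
Proof.
apply: rhom_eq => -[[[[|k]|k] [|]] i] v; rewrite /= !comp_lfunE ?id_lfunE //=.
all: by rewrite [LHS]rep_not_admissible // [RHS]rep_not_admissible.
Qed.

Lemma rep_OZ_rep_triangle (X : OZ) : rep_OZ_rep (OZ_to_rep X) \oc fmap OZ_to_rep
    (OZ_rep_OZ X) = idm (OZ_to_rep X).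
Proof.
apply: rhom_eq => -[[[[|k]|k] [|]] i] v; rewrite /= !comp_lfunE ?id_lfunE //=.
all: by rewrite [LHS]thinmx0 [RHS]thinmx0.
Qed.

Lemma OZ_rep_OZ_triangle (Y : RC) : fmap rep_to_OZ (rep_OZ_rep Y) \oc OZ_rep_OZ
    (rep_to_OZ Y) = idm (rep_to_OZ Y).
Proof. by apply: OZ_hom_eq => *; rewrite /= !comp_lfunE !id_lfunE. Qed.

Definition OZ_action : monoidal_functor Crystals (End OZ) :=
  conj_monoidal OZ_rep_OZ_natural rep_OZ_rep_natural rep_OZ_rep_triangle
      OZ_rep_OZ_triangle (rep_action K).

End Equivalence.

(** * The crystal B(1) acts by F *)

Section FundamentalCrystal.
Variable K : fieldType.
Local Notation OZ := (OZ K).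
Local Notation RC := (rep_category K).
Let B1 := Bcrystal 1.
Let up : B1 := ord0.
Let down : B1 := ord_max.
Implicit Types (X : OZ) (q : vertex).

Lemma glift_recast (B : crystal) (Y : vertex -> vectType K) q (W : vectType K)
    (g : forall x : B * nat, 'Hom(Y (source q x), W)) x q' v :
  q' = source q x -> valid_label q x ->
  glift g (gen Y q x q' v) = g x (recast Y q' (source q x) v).
Proof. by move=> e vx; subst q'; rewrite glift_gen // recast_id. Qed.

Lemma recast_trans (Y : vertex -> vectType K) q1 q2 q3 v : q1 = q2 ->
  recast Y q2 q3 (recast Y q1 q2 v) = recast Y q1 q3 v.
Proof. by move=> e; subst q2; rewrite recast_id. Qed.

(** The summands of F at levels 0, 1 and k + 2 are the generators of the
    action of B(1): [up] is v_1 and [down] is v_(-1). At level 1 the element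
    [up] comes from level 0 and gives the three pieces of pi^*. *)
Definition from_F X q : 'Hom(OZ_space (F K X) q, induced_space B1 (OZ_to_rep K X) q) :=
  match q return 'Hom(OZ_space (F K X) q, induced_space B1 (OZ_to_rep K X) q) with
  | (Posz 0, true, i) =>
      gen (OZ_to_rep K X) (Posz 0, true, i) (down, 0%N) (Posz 1, true, i)
  | (Posz 1, true, i) =>
     ((gen (OZ_to_rep K X) (Posz 1, true, i) (up, 2) (Posz 0, true, i - 2) \o
        (lin_fst _ _ \o lin_fst _ _)) +
      (gen (OZ_to_rep K X) (Posz 1, true, i) (up, 0%N) (Posz 0, true, i) \o
        (lin_snd _ _ \o lin_fst _ _)) +
      (gen (OZ_to_rep K X) (Posz 1, true, i) (down, 0%N) (Posz 2, true, i) \o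
         lin_snd _ _))%VF
  | (Posz 1, false, i) =>
     ((gen (OZ_to_rep K X) (Posz 1, false, i) (up, 1%N) (Posz 0, true, i - 1) \o
         lin_fst _ _) +
      (gen (OZ_to_rep K X) (Posz 1, false, i) (down, 0%N) (Posz 2, false, i) \o
         lin_snd _ _))%VF
  | (Posz k.+2, p, i) =>
      if p return 'Hom(OZ_space (F K X) (Posz k.+2, p, i), induced_space B1 (OZ_to_rep
          K X) (Posz k.+2, p, i))
      then
     ((gen (OZ_to_rep K X) (Posz k.+2, true, i) (up, 0%N) (Posz k.+1, true, i) \o
         lin_fst _ _) +
      (gen (OZ_to_rep K X) (Posz k.+2, true, i) (down, 0%N) (Posz k.+3, true, i) \o
         lin_snd _ _))%VF
      else
     ((gen (OZ_to_rep K X) (Posz k.+2, false, i) (up, 0%N) (Posz k.+1, false, i) \o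
         lin_fst _ _) +
      (gen (OZ_to_rep K X) (Posz k.+2, false, i) (down, 0%N) (Posz k.+3, false, i) \o
         lin_snd _ _))%VF
  | _ => 0
  end.

(** A conditional with a fixed type, from which the types of the inclusions in
    the branches below are inferred. *)
Definition case_hom (V W : vectType K) (b : bool) (f g : 'Hom(V, W)) : 'Hom(V, W) :=
  if b then f else g.

Definition to_F X q : 'Hom(induced_space B1 (OZ_to_rep K X) q, OZ_space (F K X) q) :=
  match q return 'Hom(induced_space B1 (OZ_to_rep K X) q, OZ_space (F K X) q) with
  | (Posz 0, true, i) =>
      glift (fun x => recast (OZ_to_rep K X) (source (Posz 0, true, i) x) (Posz 1,
          true, i))
  | (Posz 1, true, i) =>
      @glift K B1 (OZ_to_rep K X) (Posz 1, true, i) (OZ_space (F K X) (Posz 1, true,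
          i)) (fun x =>
        case_hom (x.1 == up)
          (case_hom (x.2 == 0%N)
            (lin_inl _ _ \o (lin_inr _ _ \o
                recast (OZ_to_rep K X) (source (Posz 1, true, i) x) (Posz 0, true, i)))
            (lin_inl _ _ \o (lin_inl _ _ \o
                recast (OZ_to_rep K X) (source (Posz 1, true, i) x) (Posz 0, true, i -
                    2))))
         (lin_inr _ _ \o recast (OZ_to_rep K X) (source (Posz 1, true, i) x) (Posz 2,
             true, i)))%VF
  | (Posz 1, false, i) =>
      @glift K B1 (OZ_to_rep K X) (Posz 1, false, i) (OZ_space (F K X) (Posz 1, false,
          i)) (fun x => case_hom (x.1 == up)
         (lin_inl _ _ \o recast (OZ_to_rep K X) (source (Posz 1, false, i) x) (Posz 0,
             true, i - 1))
         (lin_inr _ _ \o recast (OZ_to_rep K X) (source (Posz 1, false, i) x) (Posz 2,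
             false, i)))%VF
  | (Posz k.+2, true, i) =>
      @glift K B1 (OZ_to_rep K X) (Posz k.+2, true, i) (OZ_space (F K X) (Posz k.+2,
          true, i)) (fun x => case_hom (x.1 == up)
         (lin_inl _ _ \o recast (OZ_to_rep K X) (source (Posz k.+2, true, i) x) (Posz
             k.+1, true, i))
         (lin_inr _ _ \o recast (OZ_to_rep K X) (source (Posz k.+2, true, i) x) (Posz
             k.+3, true, i)))%VF
  | (Posz k.+2, false, i) =>
      @glift K B1 (OZ_to_rep K X) (Posz k.+2, false, i) (OZ_space (F K X) (Posz k.+2,
          false, i)) (fun x => case_hom (x.1 == up)
         (lin_inl _ _ \o recast (OZ_to_rep K X) (source (Posz k.+2, false, i) x) (Posz
             k.+1, false, i))
         (lin_inr _ _ \o recast (OZ_to_rep K X) (source (Posz k.+2, false, i) x) (Posz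
             k.+3, false, i)))%VF
  | _ => 0
  end.

Lemma hits_wall_up l : hits_wall l up = (l <= 1).
Proof. by rewrite /hits_wall /= /Bwt /Beps /=; lia. Qed.

Lemma hits_wall_down l : hits_wall l down = (l <= 0).
Proof. by rewrite /hits_wall /= /Bwt /Beps /=; lia. Qed.

Lemma sourceE (B : crystal) l p i (b : B) d : source (l, p, i) (b, d) =
  if hits_wall l b then (l - cwt b, true, i - d%:Z - (ceps b - (l - cwt b)) *+ 2)
  else (l - cwt b, p, i).
Proof. by []. Qed.

Lemma cwt_up : cwt up = 1. Proof. by []. Qed.
Lemma cwt_down : cwt down = -1. Proof. by []. Qed.
Lemma ceps_up : ceps up = 0. Proof. by []. Qed.
Lemma ceps_down : ceps down = 1. Proof. by []. Qed.
Let B1E := (cwt_up, cwt_down, ceps_up, ceps_down, hits_wall_up, hits_wall_down).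

Lemma source_up_wall p i d : source (Posz 1, p, i) (up, d) = (Posz 0, true, i - d%:Z).
Proof. by rewrite sourceE; case w: (hits_wall _ _); move: w; rewrite !B1E => w;
    congr (_, _, _); lia. Qed.

Lemma source_up k p i d : source (Posz k.+2, p, i) (up, d) = (Posz k.+1, p, i).
Proof. by rewrite sourceE; case w: (hits_wall _ _); move: w; rewrite !B1E => w;
    congr (_, _, _); lia. Qed.

Lemma source_down_wall p i : source (Posz 0, p, i) (down, 0%N) = (Posz 1, true, i).
Proof. by rewrite sourceE; case w: (hits_wall _ _); move: w; rewrite !B1E => w;
    congr (_, _, _); lia. Qed.

Lemma source_down k p i d : source (Posz k.+1, p, i) (down, d) = (Posz k.+2, p, i).
Proof. by rewrite sourceE; case w: (hits_wall _ _); move: w; rewrite !B1E => w;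
    congr (_, _, _); lia. Qed.

Lemma valid_labelE (B : crystal) l p i (b : B) d : valid_label (l, p, i) (b, d) =
  [&& (0 <= l) && ((l == 0) ==> p), 0 <= l - cwt b &
   if hits_wall l b then [&& d < 3, odd d == ~~ p & (l == 0%Z) ==> (d == 0)]%N
   else d == 0%N].
Proof. by []. Qed.

Lemma valid_up_wall p i d : valid_label (Posz 1, p, i) (up, d) =
    (d < 3)%N && (odd d == ~~ p).
Proof. by rewrite valid_labelE; case w: (hits_wall _ _); move: w; rewrite !B1E => w;
    lia. Qed.

Lemma valid_up k p i d : valid_label (Posz k.+2, p, i) (up, d) = (d == 0%N).
Proof. by rewrite valid_labelE; case w: (hits_wall _ _); move: w; rewrite !B1E => w;
    lia. Qed.

Lemma valid_up0 p i d : valid_label (Posz 0, p, i) (up, d) = false.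
Proof. by rewrite valid_labelE; case w: (hits_wall _ _); move: w; rewrite !B1E => w;
    lia. Qed.

Lemma valid_down0 p i d : valid_label (Posz 0, p, i) (down, d) = p && (d == 0%N).
Proof. by rewrite valid_labelE; case w: (hits_wall _ _); move: w; rewrite !B1E => w;
    lia. Qed.

Lemma valid_down k p i d : valid_label (Posz k.+1, p, i) (down, d) = (d == 0%N).
Proof. by rewrite valid_labelE; case w: (hits_wall _ _); move: w; rewrite !B1E => w;
    lia. Qed.

Definition label_simp := (source_up_wall, source_up, source_down_wall, source_down,
    valid_up_wall,
  valid_up, valid_up0, valid_down0, valid_down).

Lemma B1_cases (b : B1) : b = up \/ b = down.
Proof.
by case: b => -[|[|//]] h; [left|right]; apply: val_inj.
Qed.

Lemma lfunD (V W : vectType K) (f : 'Hom(V, W)) x y : f (x + y) = f x + f y.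
Proof. exact: linearD. Qed.

Lemma from_FK X q v : to_F X q (from_F X q v) = v.
Proof.
case: q v => [[[[|[|k]]|k] [|]] i] v; try by rewrite [LHS]thinmx0 [RHS]thinmx0.
- apply: etrans (@glift_recast B1 (OZ_to_rep K X) (Posz 0, true, i) _ _ (down, 0%N)
    (Posz 1, true, i) v _ _) _; rewrite ?label_simp //.
  by rewrite !recast_id.
- rewrite /to_F /from_F; set g := (X in glift X).
  have H := @glift_recast B1 (OZ_to_rep K X) (Posz 1, true, i) _ g.
  have G1 u : g (up, 2) u = (recast (OZ_to_rep K X) _ (Posz 0, true, i - 2) u, 0, 0).
    by rewrite /g /case_hom !comp_lfunE !linE.
  have G2 u : g (up, 0%N) u = (0, recast (OZ_to_rep K X) _ (Posz 0, true, i) u, 0).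
    by rewrite /g /case_hom !comp_lfunE !linE.
  have G3 u : g (down, 0%N) u = (0, recast (OZ_to_rep K X) _ (Posz 2, true, i) u).
    by rewrite /g /case_hom comp_lfunE linE.
  rewrite !add_lfunE !comp_lfunE !linE !lfunD.
  rewrite (H (up, 2) (Posz 0, true, i - 2) v.1.1) ?label_simp //.
  rewrite (H (up, 0%N) (Posz 0, true, i) v.1.2) ?label_simp ?subr0 //.
  rewrite (H (down, 0%N) (Posz 2, true, i) v.2) ?label_simp ?subr0 //.
  rewrite G1 G2 G3 !recast_trans ?label_simp ?subr0 // !recast_id.
  by case: v => -[a b] w; congr (_, _, _); rewrite /= ?addr0 ?add0r.
- rewrite /to_F /from_F; set g := (X in glift X).
  have H := @glift_recast B1 (OZ_to_rep K X) (Posz 1, false, i) _ g.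
  have G1 u : g (up, 1%N) u = (recast (OZ_to_rep K X) _ (Posz 0, true, i - 1) u, 0) by
      rewrite /g /case_hom comp_lfunE linE.
  have G2 u : g (down, 0%N) u = (0, recast (OZ_to_rep K X) _ (Posz 2, false, i) u) by
      rewrite /g /case_hom comp_lfunE linE.
  rewrite !add_lfunE !comp_lfunE !linE !lfunD.
  rewrite (H (up, 1%N) (Posz 0, true, i - 1) v.1) ?label_simp //.
  rewrite (H (down, 0%N) (Posz 2, false, i) v.2) ?label_simp //.
  rewrite G1 G2 !recast_trans ?label_simp // !recast_id.
  by case: v => a w; congr (_, _); rewrite /= ?addr0 ?add0r.
- rewrite /to_F /from_F; set g := (X in glift X).
  have H := @glift_recast B1 (OZ_to_rep K X) (Posz k.+2, true, i) _ g.
  have G1 u : g (up, 0%N) u = (recast (OZ_to_rep K X) _ (Posz k.+1, true, i) u, 0) by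
      rewrite /g /case_hom comp_lfunE linE.
  have G2 u : g (down, 0%N) u = (0, recast (OZ_to_rep K X) _ (Posz k.+3, true, i) u) by
      rewrite /g /case_hom comp_lfunE linE.
  rewrite !add_lfunE !comp_lfunE !linE !lfunD.
  rewrite (H (up, 0%N) (Posz k.+1, true, i) v.1) ?label_simp //.
  rewrite (H (down, 0%N) (Posz k.+3, true, i) v.2) ?label_simp //.
  rewrite G1 G2 !recast_trans ?label_simp // !recast_id.
  by case: v => a w; congr (_, _); rewrite /= ?addr0 ?add0r.
- rewrite /to_F /from_F; set g := (X in glift X).
  have H := @glift_recast B1 (OZ_to_rep K X) (Posz k.+2, false, i) _ g.
  have G1 u : g (up, 0%N) u = (recast (OZ_to_rep K X) _ (Posz k.+1, false, i) u, 0) by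
      rewrite /g /case_hom comp_lfunE linE.
  have G2 u : g (down, 0%N) u = (0, recast (OZ_to_rep K X) _ (Posz k.+3, false, i) u)
      by rewrite /g /case_hom comp_lfunE linE.
  rewrite !add_lfunE !comp_lfunE !linE !lfunD.
  rewrite (H (up, 0%N) (Posz k.+1, false, i) v.1) ?label_simp //.
  rewrite (H (down, 0%N) (Posz k.+3, false, i) v.2) ?label_simp //.
  rewrite G1 G2 !recast_trans ?label_simp // !recast_id.
  by case: v => a w; congr (_, _); rewrite /= ?addr0 ?add0r.
Qed.

Lemma lfun0 (V W : vectType K) (f : 'Hom(V, W)) : f 0 = 0.
Proof. exact: linear0. Qed.

(** With [from_FK] this yields the other cancellation law without computing
    [to_F] on generators. *)
Lemma from_F_onto X q x (v : OZ_to_rep K X (source q x)) : valid_label q x ->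
  exists w, from_F X q w = gen (OZ_to_rep K X) q x (source q x) v.
Proof.
case: q v => [[[[|[|k]]|k] p] i] v; case: x v => b d.
all: case: (B1_cases b) => ->.
- by rewrite !label_simp.
- rewrite [valid_label _ _]label_simp => v /andP[pT /eqP dE]; subst d;
    case: p pT v => // _.
  by rewrite label_simp => v; exists v.
- rewrite !label_simp => v /andP[d3 dp]; move: v.
  case: p dp => dp; case: d d3 dp => [|[|[|//]]] // _ _ v; rewrite ?subr0 in v *.
  + exists ((0, v), 0); rewrite /from_F !add_lfunE !comp_lfunE !linE.
    by rewrite !lfun0 addr0 add0r.
  + exists ((v, 0), 0); rewrite /from_F !add_lfunE !comp_lfunE !linE.
    by rewrite !lfun0 !addr0.
  + exists (v, 0); rewrite /from_F !add_lfunE !comp_lfunE !linE.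
    by rewrite lfun0 addr0.
- rewrite !label_simp => v /eqP dE; subst d; case: p v => v.
  + exists (0, v); rewrite /from_F !add_lfunE !comp_lfunE !linE.
    by rewrite !lfun0 !add0r.
  + exists (0, v); rewrite /from_F !add_lfunE !comp_lfunE !linE.
    by rewrite !lfun0 !add0r.
- rewrite !label_simp => v /eqP dE; subst d; case: p v => v.
  + exists (v, 0); rewrite /from_F !add_lfunE !comp_lfunE !linE.
    by rewrite !lfun0 !addr0.
  + exists (v, 0); rewrite /from_F !add_lfunE !comp_lfunE !linE.
    by rewrite !lfun0 !addr0.
- rewrite !label_simp => v /eqP dE; subst d; case: p v => v.
  + exists (0, v); rewrite /from_F !add_lfunE !comp_lfunE !linE.
    by rewrite !lfun0 !add0r.
  + exists (0, v); rewrite /from_F !add_lfunE !comp_lfunE !linE.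
    by rewrite !lfun0 !add0r.
- by move=> v /and3P[/andP[]].
- by move=> v /and3P[/andP[]].
Qed.

Lemma to_FK X q v : from_F X q (to_F X q v) = v.
Proof.
suff /(_ v) : (from_F X q \o to_F X q)%VF =1 \1%VF by rewrite comp_lfunE id_lfunE.
apply: gen_ext => x {}v vx; rewrite comp_lfunE id_lfunE.
by have [w <-] := from_F_onto v vx; rewrite from_FK.
Qed.

Lemma gen_gcast X q (x : B1 * nat) i j (e : i = j) (v : (X.1 : gvect K) i) :
  gen (OZ_to_rep K X) q x (Posz 0, true, j) (gcast X.1 e v) =
  gen (OZ_to_rep K X) q x (Posz 0, true, i) v.
Proof. by case: j / e; rewrite /= id_lfunE. Qed.

(** The maps pi_var and pi_can only shift pieces, which is what [induced_step]
    does on the wall summand [up] at level 1. *)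
Lemma from_F_step X q v : from_F X (next_vertex q) (OZ_step (F K X) q v) =
    induced_step B1 (OZ_to_rep K X) q (from_F X q v).
Proof.
have W q0 x q' u := @induced_step_wall K B1 (OZ_to_rep K X) q0 x q' u.
have I q0 x q' u := @induced_step_id K B1 (OZ_to_rep K X) q0 x q' u.
case: q v => [[[[|[|k]]|k] [|]] i] v; try by rewrite [v]thinmx0 !lfun0.
- rewrite /OZ_step /from_F zero_lfunE lfun0.
  by rewrite (W _ _ (Posz 1, true, i) v) ?label_simp // gen_invalid // label_simp.
- have -> : OZ_step (F K X) (Posz 1, true, i) v =
     (gcast X.1 (var_degree i) v.1.2, ovar (X.2 1%N) i v.2).
    by rewrite /OZ_step /= lin_sumE /= comp_lfunE linE.
  rewrite /from_F !add_lfunE !comp_lfunE !linE !lfunD.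
  rewrite (W _ _ (Posz 0, true, i - 2) v.1.1) ?label_simp //.
  rewrite [gen _ _ (next_copy _) _ _]gen_invalid ?label_simp // add0r.
  rewrite (W _ _ (Posz 0, true, i) v.1.2) ?label_simp ?subr0 //.
  rewrite (I _ _ (Posz 2, true, i) v.2) ?label_simp //.
  by congr (_ + _); exact: gen_gcast.
- have -> : OZ_step (F K X) (Posz 1, false, i) v =
     ((gcast X.1 (can_degree i) v.1, 0), ocan (X.2 1%N) i v.2).
    by rewrite /OZ_step /= lin_sumE /= comp_lfunE linE.
  rewrite /from_F !add_lfunE !comp_lfunE !linE !lfunD.
  rewrite (W _ _ (Posz 0, true, i - 1) v.1) ?label_simp //.
  rewrite (I _ _ (Posz 2, false, i) v.2) ?label_simp //.
  by congr (_ + _); rewrite lfun0 addr0; exact: gen_gcast.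
- have -> : OZ_step (F K X) (Posz k.+2, true, i) v =
     (ovar (X.2 k) i v.1, ovar (X.2 k.+2) i v.2).
    by rewrite /OZ_step /= lin_sumE.
  rewrite /from_F !add_lfunE !comp_lfunE !linE !lfunD.
  rewrite (I _ _ (Posz k.+1, true, i) v.1) ?label_simp //.
  by rewrite (I _ _ (Posz k.+3, true, i) v.2) ?label_simp.
- have -> : OZ_step (F K X) (Posz k.+2, false, i) v =
     (ocan (X.2 k) i v.1, ocan (X.2 k.+2) i v.2).
    by rewrite /OZ_step /= lin_sumE.
  rewrite /from_F !add_lfunE !comp_lfunE !linE !lfunD.
  rewrite (I _ _ (Posz k.+1, false, i) v.1) ?label_simp //.
  by rewrite (I _ _ (Posz k.+3, false, i) v.2) ?label_simp.
Qed.

Lemma from_F_natural X X' (f : hom X X') q v :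
  from_F X' q (OZ_space_map (fmap (F K) f) q v) =
      induced_map_at B1 (OZ_to_rep_map f) q (from_F X q v).
Proof.
have G q0 x q' u := @induced_map_gen K B1 (OZ_to_rep K X) (OZ_to_rep K X')
    (OZ_to_rep_map f) q0 x q' u.
case: q v => [[[[|[|k]]|k] [|]] i] v; try by rewrite [v]thinmx0 !lfun0.
- by rewrite /from_F (G _ _ (Posz 1, true, i) v).
- have -> : OZ_space_map (fmap (F K) f) (Posz 1, true, i) v =
     ((f.1 (i - 2) v.1.1, f.1 i v.1.2), mPhi (f.2 1%N) i v.2).
    by rewrite /OZ_space_map /= lin_sumE /= lin_sumE.
  rewrite /from_F !add_lfunE !comp_lfunE !linE !lfunD.
  by rewrite (G _ _ (Posz 0, true, i - 2) v.1.1) (G _ _ (Posz 0, true, i) v.1.2)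
     (G _ _ (Posz 2, true, i) v.2).
- have -> : OZ_space_map (fmap (F K) f) (Posz 1, false, i) v =
     (f.1 (i - 1) v.1, mPsi (f.2 1%N) i v.2).
    by rewrite /OZ_space_map /= lin_sumE.
  rewrite /from_F !add_lfunE !comp_lfunE !linE !lfunD.
  by rewrite (G _ _ (Posz 0, true, i - 1) v.1) (G _ _ (Posz 2, false, i) v.2).
- have -> : OZ_space_map (fmap (F K) f) (Posz k.+2, true, i) v =
     (mPhi (f.2 k) i v.1, mPhi (f.2 k.+2) i v.2).
    by rewrite /OZ_space_map /= lin_sumE.
  rewrite /from_F !add_lfunE !comp_lfunE !linE !lfunD.
  by rewrite (G _ _ (Posz k.+1, true, i) v.1) (G _ _ (Posz k.+3, true, i) v.2).
- have -> : OZ_space_map (fmap (F K) f) (Posz k.+2, false, i) v =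
     (mPsi (f.2 k) i v.1, mPsi (f.2 k.+2) i v.2).
    by rewrite /OZ_space_map /= lin_sumE.
  rewrite /from_F !add_lfunE !comp_lfunE !linE !lfunD.
  by rewrite (G _ _ (Posz k.+1, false, i) v.1) (G _ _ (Posz k.+3, false, i) v.2).
Qed.

Lemma to_F_step X q (v : induced B1 (OZ_to_rep K X) q) :
  to_F X (next_vertex q) (induced_step B1 (OZ_to_rep K X) q v) =
      OZ_step (F K X) q (to_F X q v).
Proof. by rewrite -{1}[v]to_FK -from_F_step from_FK. Qed.

Lemma to_F_natural X X' (f : hom X X') q v :
  to_F X' q (induced_map_at B1 (OZ_to_rep_map f) q v) =
      OZ_space_map (fmap (F K) f) q (to_F X q v).
Proof. by rewrite -{1}[v]to_FK -from_F_natural from_FK. Qed.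

Definition from_F_map X : @hom RC (OZ_to_rep K (F K X)) (induced B1 (OZ_to_rep K X)) :=
  @RHom K (OZ_to_rep K (F K X)) (induced B1 (OZ_to_rep K X)) (from_F X) (@from_F_step
      X).

Definition to_F_map X : @hom RC (induced B1 (OZ_to_rep K X)) (OZ_to_rep K (F K X)) :=
  @RHom K (induced B1 (OZ_to_rep K X)) (OZ_to_rep K (F K X)) (to_F X) (@to_F_step X).

Lemma from_F_to_F X : from_F_map X \oc to_F_map X = idm _.
Proof. by apply: rhom_eq => q v; rewrite /= comp_lfunE id_lfunE to_FK. Qed.

Lemma to_F_from_F X : to_F_map X \oc from_F_map X = idm _.
Proof. by apply: rhom_eq => q v; rewrite /= comp_lfunE id_lfunE from_FK. Qed.

Let action_B1 : functor OZ OZ :=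
  conj_obj (OZ_to_rep K) (rep_to_OZ K) (induced_functor K B1).

Definition action_B1_to_F : nat_trans action_B1 (F K).
Proof.
refine (@NatTrans OZ OZ action_B1 (F K)
  (fun X => iso_inv (OZ_rep_OZ (F K X)) \oc fmap (rep_to_OZ K) (to_F_map X)) _).
abstract (move=> X X' f; rewrite cmpA -(u_inv_natural (@OZ_rep_OZ_natural K)) -!cmpA;
  congr (_ \oc _);
  refine (etrans (esym (fmapM (rep_to_OZ K) (to_F_map X') (induced_map B1
      (OZ_to_rep_map f))))
    (etrans _ (fmapM (rep_to_OZ K) (fmap (OZ_to_rep K) (fmap (F K) f)) (to_F_map X))));
  congr (fmap _ _); apply: rhom_eq => q v; rewrite /= !comp_lfunE; exact: to_F_natural).
Defined.

Definition F_to_action_B1 : nat_trans (F K) action_B1.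
Proof.
refine (@NatTrans OZ OZ (F K) action_B1
  (fun X => fmap (rep_to_OZ K) (from_F_map X) \oc OZ_rep_OZ (F K X)) _).
abstract (move=> X X' f; rewrite -cmpA OZ_rep_OZ_natural !cmpA;
  congr (_ \oc _);
  refine (etrans (esym (fmapM (rep_to_OZ K) (from_F_map X') (fmap (OZ_to_rep K) (fmap
      (F K) f))))
    (etrans _ (fmapM (rep_to_OZ K) (induced_map B1 (OZ_to_rep_map f)) (from_F_map X))));
  congr (fmap _ _); apply: rhom_eq => q v; rewrite /= !comp_lfunE;
      exact: from_F_natural).
Defined.

Lemma F_to_action_B1K X :
  (fmap (rep_to_OZ K) (from_F_map X) \oc OZ_rep_OZ (F K X)) \oc
  (iso_inv (OZ_rep_OZ (F K X)) \oc fmap (rep_to_OZ K) (to_F_map X)) = idm _.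
Proof.
by rewrite -cmpA (cmpA (iso_hom _)) iso_homK cmp1m -fmapM from_F_to_F fmap1.
Qed.

Lemma action_B1_to_FK X :
  (iso_inv (OZ_rep_OZ (F K X)) \oc fmap (rep_to_OZ K) (to_F_map X)) \oc
  (fmap (rep_to_OZ K) (from_F_map X) \oc OZ_rep_OZ (F K X)) = idm _.
Proof.
by rewrite -cmpA (cmpA (fmap _ _)) -fmapM to_F_from_F fmap1 cmp1m iso_invK.
Qed.

Lemma action_B1_iso_F : @isomorphic (End OZ) (OZ_action K (Bcrystal 1)) (F K).
Proof.
constructor; exact: (@nt_iso OZ action_B1 (F K) action_B1_to_F F_to_action_B1
    F_to_action_B1K action_B1_to_FK).
Qed.

End FundamentalCrystal.

Theorem mainTheorem1 (R : realType) :
  exists M : monoidal_functor Crystals (End (OZ R[i])),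
    @isomorphic (End (OZ R[i])) (M (Bcrystal 1)) (F R[i]).
Proof. by exists (OZ_action R[i]); exact: action_B1_iso_F. Qed.
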